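(* Let $p=p(n)$ satisfy $p(n)\le 1/2$ and $p=\Omega(1/n)$ (i.e. there is a constant $c_0>0$ with $p(n)\ge c_0/n$ for all sufficiently large $n$), and let $G_n\sim G(n,p)$. Let $w=w(n)\ge 1$ be any function. Then the following hold. (1) If $p=\sqrt{\frac{\ln n}{nw}}$, then there are constants $0<c\le C$ such that, with high probability, $$c\cdot\frac{np\ln(ew)}{\ln n}\ \le\ \operatorname{fun}(G_n)\ \le\ C\cdot\frac{np\ln(ew)}{\ln n}.$$ (2) If $p=\sqrt{\frac{w\ln n}{n}}$, then there are constants $0<c\le C$ such that, with high probability, $$c\cdot\frac{\ln(ew)}{p}\ \le\ \operatorname{fun}(G_n)\ \le\ C\cdot\frac{\ln(ew)}{p}.$$
   Context: All graphs are finite, simple and undirected. $G(n,p)$ is the random graph on vertex set $[n]=\{1,\dots,n\}$ in which each edge is included independently with probability $p=p(n)$. ''With high probability'' means with probability tending to $1$ as $n\to\infty$. Here $e$ is the base of the natural logarithm. Functionality: let $G$ be a graph with adjacency matrix $A$. A vertex $y\in V(G)$ is a function of a set $S=\{x_1,\dots,x_k\}\subseteq V(G)\setminus\{y\}$ if there is a Boolean function $f$ of $k$ variables such that for every vertex $z\in V(G)\setminus(S\cup\{y\})$ we have $A(y,z)=f(A(z,x_1),\dots,A(z,x_k))$; equivalently, the adjacency between $y$ and $z$ depends only on $N(z)\cap S$ for $z\in V(G)\setminus(S\cup\{y\})$. The functionality $\operatorname{fun}_G(y)$ of the vertex $y$ in $G$ is the minimum $k$ such that $y$ is a function of some set of $k$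 other vertices of $G$. The functionality of $G$ is $$\operatorname{fun}(G)=\max_{H}\ \min_{y\in V(H)}\operatorname{fun}_H(y),$$ where the maximum is over all (nonempty) induced subgraphs $H$ of $G$. *)

(* Defs.v *)
From mathcomp Require Import all_boot all_order all_algebra.

Set Implicit Arguments.
Unset Strict Implicit.
Unset Printing Implicit Defensive.

Import GRing.Theory.

Record sgraph (V : finType) := SGraph {
  adj : rel V;
  adj_sym : symmetric adj;
  adj_irr : irreflexive adj }.

Section Functionality.
Variables (V : finType) (G : sgraph V).

(* The vertices x_1, ..., x_k of S are listed by [enum_val]; as f ranges over
   all Boolean functions of #|S| variables, the choice of order is immaterial. *)
Definition function_of (y : V) (S : {set V}) : bool :=
  (y \notin S) &&
  [exists f : {ffun {ffun 'I_#|S| -> bool} -> bool},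
    [forall z : V, (z \notin y |: S) ==>
      (adj G y z == f [ffun i => adj G z (enum_val i)])]].

Lemma function_of_setC1 (y : V) : function_of y [set~ y].
Proof.
rewrite /function_of !inE eqxx /=; apply/existsP; exists [ffun=> true].
by apply/forallP => z; rewrite !inE orbN.
Qed.

(* By [function_of_setC1], the minimum ranges over a nonempty family. *)
Definition vertex_fun (y : V) : nat :=
  #|[arg min_(S < [set~ y] | function_of y S) #|S|]|.

Definition induced (H : {set V}) : sgraph {x : V | x \in H} :=
  @SGraph {x : V | x \in H} (fun x y => adj G (val x) (val y))
    (fun x y => adj_sym G (val x) (val y)) (fun x => adj_irr G (val x)).

End Functionality.

(* The default value #|V| exceeds every [vertex_fun G y] (which is at most
   #|V| - 1), so this is the true minimum whenever V is nonempty. *)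
Definition min_vertex_fun (V : finType) (G : sgraph V) : nat :=
  \big[minn/#|V|]_(y : V) vertex_fun G y.

Definition functionality (V : finType) (G : sgraph V) : nat :=
  \max_(H : {set V} | H != set0) min_vertex_fun (induced G H).

Section RandomGraph.
Variable n : nat.

Definition potential_edge := {e : {set 'I_n} | #|e| == 2}.

Definition edges_adj (E : {set potential_edge}) : rel 'I_n :=
  fun i j => [exists e in E, val e == [set i; j]].

Lemma edges_adj_sym E : symmetric (edges_adj E).
Proof. by move=> i j; rewrite /edges_adj setUC. Qed.

Lemma edges_adj_irr E : irreflexive (edges_adj E).
Proof.
move=> i; apply/negbTE/existsP => -[[e /= card_e]] /andP[_ /eqP /= eE].
by move: card_e; rewrite eE setUid cards1.
Qed.

Definition graph_of_edges (E : {set potential_edge}) : sgraph 'I_n :=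
  SGraph (@edges_adj_sym E) (@edges_adj_irr E).

Local Open Scope ring_scope.

Variables (R : pzRingType) (p : R).

Definition gnp_weight (E : {set potential_edge}) : R :=
  \prod_(e : potential_edge) (if e \in E then p else 1 - p).

Definition gnp_prob (A : pred (sgraph 'I_n)) : R :=
  \sum_(E : {set potential_edge} | A (graph_of_edges E)) gnp_weight E.

End RandomGraph.

Arguments gnp_prob n {R} p A.

(* Main.v *)
(* Write x = ln (e w) and let S be a set of which y is a function in H.

   Lower bounds.  If some z in H is adjacent to no vertex of S and not to y,
   then every neighbour of y outside S has a neighbour in S, whence
   deg y <= |S| (1 + c) where c is the largest codegree.  In case (1), c is
   O(ln n / x) and some large H has minimum degree of order n p.  In case (2),
   H = G and a union bound over (y, S) shows that, when |S| <= x / (100 p), some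
   neighbour and some non-neighbour of y both have no neighbour in S.

   Upper bounds.  If w >= n^(1/400) then ln (e w) has order ln n.  In case (1),
   G is O(n p)-degenerate; in case (2), any 5 ln n / p vertices separate all the
   others up to a small matching of unseparated pairs, which can be added.
   If w < n^(1/400), a small H has a vertex of small degree.  In a large H take
   ten disjoint blocks and, for each block, cover the neighbours of y by
   neighbourhoods of few vertices of the block: greedily, where a step picks a
   vertex with about ln n / (x + i) neighbours among the 2^-i fraction still
   uncovered.  The greedy choice may get stuck for some y, but not for
   many y with disjoint uncovered sets at once, since the probability of that
   beats the union bound over H.  All but few neighbours of y then have nine
   neighbours in the chosen set S, and few disjoint pairs of vertices have nine
   common neighbours in S: adding to S a maximal matching of such pairs and the
   uncovered neighbours makes y a function of S. *)

Require Import Defs.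
From mathcomp Require Import all_boot all_order all_algebra.
From mathcomp Require Import zify ring lra.

Set Implicit Arguments.
Unset Strict Implicit.
Unset Printing Implicit Defensive.

Import Order.TTheory GRing.Theory Num.Theory.

(** * Functionality of induced subgraphs *)

(** The set H is chosen after the graph, and a union bound over its 2^n candidates is hopeless. A
    stuck greedy step is therefore certified by few vertices: a block of [m0] of them and [r]
    disjoint sets of size v, at most n^(m0 + r v) choices, for which [m0 r] independent events of
    probability at least beta all fail. It is enough that [r] and [m0 / v] both exceed (ln n) / beta
    by a large factor. The demand ln n / (x + i) of stage i has the largest order that keeps beta a
    small negative power of n; stage i then costs a multiple of (x + i) / 2^i, so the total has the
    order of the first stage. In case (2) the degrees, of order n p = w ln n / p, are too large for
    the greedy cover. There about 2 x / p arbitrary vertices of a block already cover all but 9 ln n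
    / p neighbours of any y, and what is left resembles the case w = 1. The number nine: p is close
    to n^(-1/2), so having nine common neighbours in S makes a pair of vertices improbable enough to
    pay both for its n^2 choices and for the factor n^2 allotted to each vertex of S in the union
    bound. *)

Definition determines (V : finType) (G : sgraph V) (H S : {set V}) (y : V) :=
  {in H :\: (y |: S) &, forall z z',
    {in S, forall x, adj G z x = adj G z' x} -> adj G y z = adj G y z'}.

Lemma function_ofP (V : finType) (G : sgraph V) (y : V) (S : {set V}) :
  reflect (y \notin S /\ determines G [set: V] S y) (function_of G y S).
Proof.
apply: (iffP andP) => -[yS].
  move=> /existsP[f /forallP Hf]; split=> // z z'; rewrite !inE !andbT => zS zS' e.
  have := Hf z; have := Hf z'; rewrite !inE zS zS' /= => /eqP -> /eqP ->.
  by congr (f _); apply/ffunP => i; rewrite !ffunE e // enum_valP.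
move=> det; split=> //; apply/existsP.
(* The Boolean function accepts exactly the traces on S left by the neighbours of y outside S. *)
exists [ffun g => [exists z, [&& z \notin y |: S, adj G y z &
  g == [ffun i : 'I_#|S| => adj G z (enum_val i)]]]].
apply/forallP => z; apply/implyP => zS; rewrite ffunE; apply/eqP.
apply/idP/existsP => [yz|[z' /and3P[zS' yz' /eqP/ffunP e]]].
  by exists z; rewrite zS yz eqxx.
rewrite (det z z') ?inE ?andbT //; try by move: zS zS'; rewrite !inE.
by move=> x xS; have := e (enum_rank_in xS x); rewrite !ffunE enum_rankK_in.
Qed.

Lemma vertex_fun_le (V : finType) (G : sgraph V) (y : V) (S : {set V}) :
  function_of G y S -> vertex_fun G y <= #|S|.
Proof.
move=> fS; rewrite /vertex_fun; case: arg_minnP; first exact: function_of_setC1.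
by move=> S' _; apply.
Qed.

Lemma vertex_fun_witness (V : finType) (G : sgraph V) (y : V) :
  exists2 S, function_of G y S & vertex_fun G y = #|S|.
Proof.
rewrite /vertex_fun; case: arg_minnP; first exact: function_of_setC1.
by move=> S fS _; exists S.
Qed.

Lemma bigminn_le (I : eqType) (s : seq I) (F : I -> nat) m i :
  i \in s -> \big[minn/m]_(j <- s) F j <= F i.
Proof.
elim: s => // j s IHs; rewrite inE big_cons => /orP[/eqP ->|/IHs le].
  exact: geq_minl.
exact: leq_trans (geq_minr _ _) le.
Qed.

Lemma leq_bigminn (I : finType) (F : I -> nat) m k :
  k <= m -> (forall i, k <= F i) -> k <= \big[minn/m]_i F i.
Proof. by move=> km kF; elim/big_rec: _ => // i x _ kx; rewrite leq_min kF. Qed.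

Lemma functionality_le (V : finType) (G : sgraph V) k :
  (forall H : {set V}, H != set0 -> exists y (S : {set V}),
     [/\ y \in H, S \subset H, y \notin S, determines G H S y & #|S| <= k]) ->
  functionality G <= k.
Proof.
move=> wit; apply/bigmax_leqP => H /wit[y [S [yH sSH yS det cS]]].
apply: leq_trans cS; pose y' : {x | x \in H} := exist _ y yH.
apply: (@leq_trans (vertex_fun (induced G H) y')).
  by apply: bigminn_le; rewrite mem_index_enum.
pose S' : {set {x | x \in H}} := [set u | val u \in S].
apply: (@leq_trans #|S'|).
  apply: vertex_fun_le; apply/function_ofP; split; first by rewrite inE.
  move=> z z'; rewrite !inE !andbT => zS zS' e; apply: det.
  - by rewrite !inE (valP z) andbT; move: zS; rewrite -val_eqE.
  - by rewrite !inE (valP z') andbT; move: zS'; rewrite -val_eqE.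
  move=> x xS; have xH := subsetP sSH x xS.
  by have := e (exist _ x xH); rewrite inE => /(_ xS).
rewrite -(card_imset _ val_inj); apply: subset_leq_card.
by apply/subsetP => x /imsetP[u]; rewrite inE => uS ->.
Qed.

(** The condition [k <= #|H|] takes care of the default value in the definition of the minimum. *)
Lemma functionality_ge (V : finType) (G : sgraph V) (H : {set V}) k :
  H != set0 -> k <= #|H| ->
  (forall y (S : {set V}), y \in H -> S \subset H -> y \notin S -> determines G H S y -> k <= #|S|) ->
  k <= functionality G.
Proof.
move=> H0 kH wit; apply: leq_trans (@leq_bigmax_cond _ (fun H => H != set0)
  (fun H => min_vertex_fun (induced G H)) _ H0).
apply: leq_bigminn => [|[y yH]]; first by rewrite card_sig (eq_card (B := mem H)).
have [S' /function_ofP[yS' det] ->] := vertex_fun_witness (induced G H) (exist _ y yH).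
rewrite -(card_imset _ val_inj); apply: (wit y) => //.
- by apply/subsetP => x /imsetP[u _ ->]; exact: valP.
- by apply: contra yS' => /imsetP[u uS yu]; rewrite (_ : exist _ _ _ = u) //; apply: val_inj.
move=> z z'; rewrite !inE => /andP[zS zH] /andP[zS' zH'] e.
have nS u (uH : u \in H) : ~~ ((u == y) || (u \in val @: S')) ->
    exist _ u uH \in [set: {x | x \in H}] :\: (exist _ y yH |: S').
  rewrite !inE andbT -val_eqE /= !negb_or => /andP[-> /=].
  by apply: contra => uS; apply/imsetP; exists (exist _ u uH).
apply: (det _ _ (nS z zH zS) (nS z' zH' zS')) => x xS /=.
by apply: e; apply/imsetP; exists x.
Qed.

(** * Blocks, matchings and greedy covers *)

Section Combinatorics.
Variable V : finType.
Implicit Types (A B D H S T X Y Z : {set V}) (x y z : V).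

Lemma exists_subset_card A m : m <= #|A| -> exists2 B : {set V}, B \subset A & #|B| = m.
Proof.
rewrite -bin_gt0 -cards_draws card_gt0 => /set0Pn[B].
by rewrite inE => /andP[sB /eqP]; exists B.
Qed.

Lemma leq_card_bigcup (I : finType) (P : pred I) (F : I -> {set V}) m c :
  #|P| <= c -> (forall i, P i -> #|F i| <= m) -> #|\bigcup_(i | P i) F i| <= c * m.
Proof.
move=> cP Fm; apply: (@leq_trans (\sum_(i | P i) m)).
  apply: (big_ind2 (fun (B : {set V}) k => #|B| <= k)) => [|B k B' k' hB hB'|i Pi]; rewrite ?cards0 ?Fm //.
  by rewrite (leq_trans (leq_card_setU _ _).1) // leq_add.
by rewrite sum_nat_const leq_mul2r cP orbT.
Qed.

Lemma disjoint_blocks H m a : a * m <= #|H| ->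
  exists X : nat -> {set V},
    (forall i, i < a -> X i \subset H /\ #|X i| = m) /\
    (forall i j, i < a -> j < a -> i != j -> [disjoint X i & X j]).
Proof.
elim: a => [|a IHa] ha; first by exists (fun=> set0).
have [|X [XH Xd]] := IHa; first by apply: leq_trans ha; rewrite leq_mul2r leqnSn orbT.
have [|B sB cB] := @exists_subset_card (H :\: \bigcup_(i : 'I_a) X i) m.
  rewrite cardsD leq_subRL; last exact/subset_leq_card/subsetIl.
  apply: leq_trans ha; rewrite mulSn addnC leq_add2l.
  apply: leq_trans (subset_leq_card (subsetIr _ _)) _.
  by apply: leq_card_bigcup => [|i _]; rewrite ?card_ord // (XH i (ltn_ord i)).2.
have BX i : i < a -> [disjoint B & X i].
  move=> ia; rewrite -setI_eq0 -subset0; apply/subsetP => x /setIP[/(subsetP sB)].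
  by rewrite inE => /andP[/bigcupP nx _] xi; case: nx; exists (Ordinal ia).
exists (fun i => if i == a then B else X i); split=> [i|i j].
  rewrite ltnS leq_eqVlt; case: eqP => [_ _|_ /= /XH //].
  by split=> //; apply: subset_trans sB (subsetDl _ _).
rewrite !ltnS (leq_eqVlt i) (leq_eqVlt j); case: eqP => [->|_]; case: eqP => [->|_] //=.
- by rewrite eqxx.
- by move=> _ ja _; exact: BX.
- by move=> ia _ _; rewrite disjoint_sym; exact: BX.
exact: Xd.
Qed.

(** All endpoints are distinct, not only the pairs: this makes the events attached to different
    pairs depend on disjoint sets of edges. *)
Definition matching (r : rel V) D (s : seq (V * V)) :=
  [&& uniq (unzip1 s ++ unzip2 s), all (fun u => r u.1 u.2) s &
      all (fun u => (u.1 \in D) && (u.2 \in D)) s].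

(** A matching of q pairs that cannot be extended inside D has no related pair off its 2 q
    endpoints, which then form T. *)
Lemma matching_or_cover (r : rel V) D q :
  (exists2 s, size s = q & matching r D s) \/
  exists T : {set V}, [/\ T \subset D, #|T| <= 2 * q &
    {in D :\: T &, forall z z', z != z' -> ~~ r z z'}].
Proof.
elim: q => [|q [[s sz ms]|[T [sT cT nT]]]]; first by left; exists [::].
  2: by right; exists T; split=> //; apply: leq_trans cT _; rewrite leq_mul2l leqnSn.
pose T := [set z in unzip1 s ++ unzip2 s].
have cT : #|T| <= 2 * q.
  rewrite cardsE (leq_trans (card_size _)) // size_cat !size_map sz; lia.
have sT : T \subset D.
  case/and3P: ms => _ _ /allP sD; apply/subsetP => z; rewrite inE mem_cat.
  by case/orP => /mapP[u /sD /andP[? ?] ->].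
case: (boolP [exists u : V * V, [&& u.1 \in D :\: T, u.2 \in D :\: T, u.1 != u.2 & r u.1 u.2]]).
  case/existsP=> -[a b] /and4P[/= /setDP[aD aT] /setDP[bD bT] ab rab]; left.
  exists ((a, b) :: s); first by rewrite /= sz.
  case/and3P: ms => us rs sD; rewrite /matching /= rab rs aD bD sD !andbT.
  move: aT bT; rewrite !inE /= => aT bT.
  have -> : uniq (unzip1 s ++ b :: unzip2 s) = uniq (b :: unzip1 s ++ unzip2 s).
    by apply: perm_uniq; rewrite -cat1s -[b :: _ ++ _]cat1s perm_catCA.
  by rewrite /= bT us !mem_cat inE (negbTE ab) /= -mem_cat aT.
move/existsPn => nu; right; exists T; split=> //; first lia.
by move=> z z' zD zD' nz; have := nu (z, z'); rewrite zD zD' nz.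
Qed.

End Combinatorics.

Section Graph.
Variables (V : finType) (G : sgraph V).
Implicit Types (A B D H S T X Y Z : {set V}) (x y z : V).

Definition nbr x : {set V} := [set z | adj G x z].
Definition nbrs S : {set V} := \bigcup_(x in S) nbr x.

Lemma in_nbr x z : (z \in nbr x) = adj G x z. Proof. by rewrite inE. Qed.

Lemma nbr_irr x : x \notin nbr x. Proof. by rewrite inE adj_irr. Qed.

Lemma nbrs0 : nbrs set0 = set0. Proof. exact: big_set0. Qed.

Lemma nbrsU S T : nbrs (S :|: T) = nbrs S :|: nbrs T.
Proof. exact: bigcup_setU. Qed.

Lemma nbrs1 x : nbrs [set x] = nbr x. Proof. exact: big_set1. Qed.

Lemma determines_card_nbr H S y t d : y \in H -> y \notin S ->
  determines G H S y ->
  (forall x z, x != z -> #|nbr x :&: nbr z| <= t) ->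
  (forall x, #|nbr x| <= d) -> #|S|.+1 * d.+1 < #|H| ->
  #|nbr y :&: H| <= #|S| * t.+1.
Proof.
move=> yH yS det cod deg big.
(* The #|S| + 1 closed neighbourhoods of y and of S, of at most d + 1 vertices each, do not cover H;
   any vertex left over has an empty trace on S and is not adjacent to y. *)
have [z' z'H nz'] : exists2 z', z' \in H &
    z' \notin \bigcup_(x in y |: S) (x |: nbr x).
  apply/subsetPn; apply/negP => /subset_leq_card; apply/negP; rewrite -ltnNge.
  apply: leq_ltn_trans big; apply: leq_card_bigcup => [|x _].
    by apply: leq_trans (leq_card_setU _ _).1 _; rewrite cards1 add1n.
  by apply: leq_trans (leq_card_setU _ _).1 _; rewrite cards1 add1n ltnS.
have far x : x \in y |: S -> z' != x /\ ~~ adj G x z'.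
  move=> xS; apply/andP; rewrite -negb_or; apply: contra nz' => nx.
  by apply/bigcupP; exists x; rewrite // !inE.
have sub : nbr y :&: H \subset S :|: \bigcup_(x in S) (nbr y :&: nbr x).
  apply/subsetP => z /setIP[zy zH]; rewrite inE; case: (boolP (z \in S)) => //= zS.
  apply/bigcupP; case: (boolP [exists x in S, adj G z x]).
    by case/exists_inP=> x xS zx; exists x; rewrite // inE zy in_nbr adj_sym.
  move/exists_inPn => nzS; exfalso.
  have := det z z'; rewrite !inE !negb_or zH z'H zS !andbT.
  have -> : z != y by apply: contraTneq zy => ->; exact: nbr_irr.
  have [z'y nyz'] := far y (setU11 _ _).
  have z'S : z' \notin S by apply/negP => /(setU1r y)/far[]; rewrite eqxx.
  rewrite z'y z'S -(in_nbr y z) zy (negbTE nyz') => /(_ isT isT) H0.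
  suff : true = false by [].
  apply: H0 => x xS; rewrite (negbTE (nzS x xS)) adj_sym.
  by have [_ /negbTE ->] := far x (setU1r y xS).
apply: leq_trans (subset_leq_card sub) _.
apply: leq_trans (leq_card_setU _ _).1 _; rewrite mulnS leq_add2l.
apply: leq_card_bigcup => // x xS; apply: cod.
by apply: contraNneq yS => ->.
Qed.

(* H maximises e(H) - d |H| / 2, so deleting a vertex does not pay. *)
Lemma dense_subgraph (R : realFieldType) (d : R) : (0 <= d)%R ->
  exists H, [/\ (forall y, y \in H -> (d <= 2 * #|nbr y :&: H|%:R)%R) &
    (\sum_x #|nbr x|%:R - d * #|V|%:R <= \sum_(x in H) #|nbr x :&: H|%:R)%R].
Proof.
move=> d0; pose e2 H : nat := \sum_(x in H) #|nbr x :&: H|.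
pose f H : R := ((e2 H)%:R + d * #|~: H|%:R)%R.
have [H _ maxH] := @Order.TotalTheory.arg_maxP _ _ _ (setT : {set V}) predT f isT.
have e2D1 y : y \in H -> e2 H = e2 (H :\ y) + 2 * #|nbr y :&: H|.
  move=> yH; rewrite /e2 (big_setD1 y) //=.
  have cE z : #|nbr z :&: H| = #|nbr z :&: (H :\ y)| + (y \in nbr z).
    by rewrite setIDA [LHS](cardsD1 y) inE yH andbT addnC.
  under eq_bigr do rewrite cE.
  rewrite big_split /= mul2n -addnn [RHS]addnC -addnA; congr (_ + _).
  rewrite addnC; congr (_ + _); rewrite -sum1_card big_mkcond /= [RHS]big_mkcond /=.
  apply: eq_bigr => z _; rewrite !inE [adj G z y]adj_sym andbC.
  have [->|_] /= := eqVneq z y; first by rewrite adj_irr; case: (y \in H).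
  by case: (adj G y z); case: (z \in H).
exists H; split=> [y yH|].
  have : (f (H :\ y) <= f H)%R := maxH (H :\ y) isT; rewrite /f (e2D1 y yH).
  have -> : #|~: (H :\ y)| = #|~: H|.+1.
    by rewrite setCD setUC cardsU1 inE yH.
  rewrite -addn1 !natrD; lra.
have : (f setT <= f H)%R := maxH setT isT; rewrite /f setCT cards0 mulr0 addr0.
have -> : e2 setT = \sum_x #|nbr x|.
  by rewrite /e2; apply: eq_big => [x|x _]; rewrite ?inE ?setIT.
rewrite -!natr_sum -/(e2 H) lerBlDr => /le_trans; apply; rewrite lerD2l.
by rewrite ler_wpM2l // ler_nat max_card.
Qed.
Lemma greedy_cover X B t b : 0 < t ->
  (forall A, A \subset B -> b < #|A| -> exists2 x, x \in X & t <= #|nbr x :&: A|) ->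
  exists S, [/\ S \subset X, #|S| * t <= #|B| & #|B :\: nbrs S| <= b].
Proof.
move=> t0; elim: {B}#|B|.+1 {-2}B (ltnSn #|B|) => // m IHm B; rewrite ltnS => cB step.
have [small|big] := leqP #|B| b.
  by exists set0; rewrite sub0set cards0 nbrs0 setD0.
have [x xX tx] := step B (subxx B) big.
have cB' : #|nbr x :&: B| + #|B :\: nbr x| = #|B| by rewrite setIC cardsID.
have [||S [sS cS lS]] := IHm (B :\: nbr x).
- by apply: leq_trans cB; rewrite -cB' -add1n leq_add2r (leq_trans t0).
- by move=> A sA; apply: step; apply: subset_trans sA (subsetDl _ _).
exists (x |: S); rewrite subUset sub1set xX sS nbrsU nbrs1 -setDDl; split=> //.
apply: (@leq_trans (#|S|.+1 * t)).
  by rewrite leq_mul2r cardsU1 -add1n leq_add2r leq_b1 orbT.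
by rewrite mulSn -cB' leq_add.
Qed.

Lemma staged_greedy_cover X B (u t : nat -> nat) m :
  #|B| <= u 0 -> (forall i, i < m -> 0 < t i) ->
  (forall i A, i < m -> A \subset B -> u i.+1 < #|A| ->
     exists2 x, x \in X & t i <= #|nbr x :&: A|) ->
  exists S, [/\ S \subset X, #|S| <= \sum_(i < m) u i %/ t i
    & #|B :\: nbrs S| <= u m].
Proof.
move=> Bu; elim: m => [|m IHm] t0 step.
  by exists set0; rewrite sub0set cards0 nbrs0 setD0.
have [||S [sS cS lS]] := IHm.
- by move=> i im; apply: t0; rewrite ltnS ltnW.
- by move=> i A im; apply: step; rewrite ltnS ltnW.
have [|S' [sS' cS' lS']] := @greedy_cover X (B :\: nbrs S) (t m) (u m.+1) (t0 m (ltnSn m)).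
  by move=> A sA; apply: step => //; apply: subset_trans sA (subsetDl _ _).
exists (S :|: S'); rewrite subUset sS sS' nbrsU -setDDl; split=> //.
apply: leq_trans (leq_card_setU _ _).1 _; rewrite big_ord_recr /= leq_add //.
by rewrite leq_divRL ?t0 //; apply: leq_trans cS' _.
Qed.

(** Asking for one hit among [r] disjoint sets is what survives a union bound over X and A: the
    property fails only if all [m0 * r] pairs (x, i) fail at once. *)
Definition spreading r v t m0 := forall X (A : 'I_r -> {set V}),
  #|X| = m0 -> (forall i, #|A i| = v) ->
  (forall i j, i != j -> [disjoint A i & A j]) ->
  (forall i, [disjoint X & A i]) ->
  exists i, exists2 x, x \in X & t <= #|nbr x :&: A i|.

Definition stuck X B t u :=
  [exists A : {set V}, [&& A \subset B, u < #|A| & [forall x in X, #|nbr x :&: A| < t]]].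

(* The witnesses of r stuck vertices become disjoint after deleting codegrees,
   which contradicts spreading. *)
Lemma card_stuck r v t m0 c u X Y (B : V -> {set V}) :
  spreading r v t m0 -> #|X| = m0 ->
  (forall x y, x != y -> #|nbr x :&: nbr y| <= c) -> r * c + v <= u ->
  (forall y, B y \subset nbr y :\: X) ->
  #|[set y in Y | stuck X (B y) t u]| < r.
Proof.
move=> spr cX cod rcv sB; rewrite ltnNge; apply/negP => rle.
have [Y' sY' cY'] := exists_subset_card rle.
pose y (i : 'I_r) : V := enum_val (cast_ord (esym cY') i).
have y_inj : injective y by move=> i j /enum_val_inj /cast_ord_inj.
have st i : {A : {set V} | [&& A \subset B (y i), u < #|A| &
    [forall x in X, #|nbr x :&: A| < t]]}.
  apply: sigW; apply/existsP.
  by have /(subsetP sY') := enum_valP (cast_ord (esym cY') i); rewrite inE => /andP[].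
pose A0 i := sval (st i) :\: \bigcup_(j | j != i) nbr (y j).
have vA0 i : v <= #|A0 i|.
  rewrite /A0; case: (st i) => A /= /and3P[sA uA _].
  have : #|A :&: \bigcup_(j | j != i) nbr (y j)| <= r * c.
    rewrite setIC big_distrl /=; apply: leq_card_bigcup => [|j ji].
      by apply: leq_trans (max_card _) _; rewrite card_ord.
    apply: leq_trans (cod (y j) (y i) _); last by rewrite (inj_eq y_inj).
    apply: subset_leq_card; apply: setIS; apply: subset_trans sA _.
    exact: subset_trans (sB _) (subsetDl _ _).
  move=> h; rewrite cardsD leq_subRL ?subset_leq_card ?subsetIl //.
  by apply: leq_trans (ltnW uA); apply: leq_trans rcv; rewrite leq_add2r.
have A1 i : {A : {set V} | (A \subset A0 i) && (#|A| == v)}.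
  by apply: sigW; have [A sA cA] := exists_subset_card (vA0 i); exists A; rewrite sA cA eqxx.
pose A i := sval (A1 i).
have sA i : A i \subset A0 i by rewrite /A; case: (A1 i) => ? /= /andP[].
have sAst i : A i \subset sval (st i) by apply: subset_trans (sA i) (subsetDl _ _).
have sAB i : A i \subset nbr (y i) :\: X.
  by apply: subset_trans (sB (y i)); apply: subset_trans (sAst i) _; case: (st i) => ? /= /and3P[].
have [|||i [x xX tx]] := spr X A cX.
- by move=> i; rewrite /A; case: (A1 i) => ? /= /andP[_ /eqP].
- move=> i j ij; rewrite -setI_eq0 -subset0; apply/subsetP => z /setIP[zi zj].
  have /setDP[_ /bigcupP[]] := subsetP (sA j) z zj.
  by exists i => //; have /setDP[] := subsetP (sAB i) z zi.
- move=> i; rewrite -setI_eq0 -subset0; apply/subsetP => z /setIP[zX zi].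
  by have /setDP[_] := subsetP (sAB i) z zi; rewrite zX.
have /and3P[_ _ /forall_inP/(_ x xX)] := svalP (st i).
rewrite ltnNge => /negP; apply; apply: leq_trans tx _.
by apply: subset_leq_card; apply: setIS.
Qed.

End Graph.

(** * Deterministic upper bounds on functionality *)

Section UpperBound.
Variables (V : finType) (G : sgraph V).
Implicit Types (A B D H S T X Y Z : {set V}) (x y z : V).

Lemma determines_nbr H y : determines G H (nbr G y :&: H) y.
Proof.
move=> z z'; rewrite !inE !negb_or => /andP[/andP[_ nz] zH] /andP[/andP[_ nz'] zH'] _.
by move: nz nz'; rewrite zH zH' !andbT => /negbTE -> /negbTE ->.
Qed.

Definition uncovered Z y := [set z in nbr G y :\: Z | [forall x in Z, ~~ adj G z x]].

Definition twins S s : rel V := fun z z' => s <= #|nbr G z :&: nbr G z' :&: S|.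

(* z lies in at most one of the s + 1 disjoint blocks X i. *)
Lemma card_hits (S : nat -> {set V}) (X : nat -> {set V}) T s z :
  (forall i j, i < s.+1 -> j < s.+1 -> i != j -> [disjoint X i & X j]) ->
  (forall i, i < s.+1 -> S i \subset X i) -> (forall i, i < s.+1 -> S i \subset T) ->
  (forall i, i < s.+1 -> z \notin X i -> exists2 x, x \in S i & adj G z x) ->
  s <= #|nbr G z :&: T|.
Proof.
move=> dX SX ST hit.
pose J := [set i : 'I_s.+1 | z \notin X i].
have cJ : s <= #|J|.
  have le1 : #|~: J| <= 1.
    apply/card_le1_eqP => i j; rewrite !inE !negbK => zi zj.
    apply/eqP; apply/negPn/negP => ij.
    by have := dX j i (ltn_ord j) (ltn_ord i) ij => /pred0P/(_ z) /=; rewrite zi zj.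
  by rewrite -(leq_add2r 1) addn1 -[X in X <= _](card_ord s.+1) -(cardsC J) leq_add2l.
pose w (i : 'I_s.+1) := odflt z [pick x | (x \in S i) && adj G z x].
have wP i : i \in J -> (w i \in S i) && adj G z (w i).
  rewrite inE => /(hit i (ltn_ord i))[x xS zx]; rewrite /w.
  by case: pickP => [//|/(_ x)]; rewrite xS zx.
apply: leq_trans cJ _; rewrite -(card_in_imset (f := w)); last first.
  move=> i j iJ jJ wij; apply/eqP; apply/negPn/negP => ij.
  have /andP[/(subsetP (SX i (ltn_ord i))) xi _] := wP i iJ.
  have /andP[/(subsetP (SX j (ltn_ord j))) xj _] := wP j jJ.
  by have := dX i j (ltn_ord i) (ltn_ord j) ij => /pred0P/(_ (w i)) /=; rewrite xi wij xj.
apply: subset_leq_card; apply/subsetP => x /imsetP[i /wP/andP[xS zx] ->].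
by rewrite !inE zx (subsetP (ST i (ltn_ord i))).
Qed.

(* For each of the s + 1 blocks, K1 of its vertices leave at most [u 0] neighbours
   of y uncovered; stage [i] of the greedy cover then goes from at most [u i] to
   at most [u i.+1] uncovered ones, [t i] at a time. *)
Lemma functionality_le_cover (s M k K1 Kg c m0 q r m : nat) (u t v : nat -> nat) :
  (forall H, H != set0 -> #|H| <= M -> exists2 y, y \in H & #|nbr G y :&: H| <= k) ->
  (forall Z y, #|Z| = K1 -> y \notin Z -> #|uncovered Z y| <= u 0) ->
  (forall x y, x != y -> #|nbr G x :&: nbr G y| <= c) ->
  (forall i, i < m -> [/\ spreading G r (v i) (t i) m0, r * c + v i <= u i.+1 & 0 < t i]) ->
  (forall S l, #|S| <= s.+1 * (K1 + Kg) -> size l = q -> ~~ matching (twins S s) (~: S) l) ->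
  \sum_(i < m) u i %/ t i <= Kg ->
  K1 <= m0 -> s.+1 * m0 + s.+1 * (m * r) <= M ->
  functionality G <= maxn k (s.+1 * (K1 + Kg) + s.+1 * u m + 2 * q).
Proof.
move=> hsmall hunc hcod hspr htwin hKg hK1 hM.
apply: functionality_le => H H0; have [HM|MH] := leqP #|H| M.
  have [y yH yk] := hsmall H H0 HM; exists y, (nbr G y :&: H); split=> //.
  - exact: subsetIr.
  - by rewrite inE negb_and nbr_irr.
  - exact: determines_nbr.
  - by rewrite leq_max yk.
have [|X [XH dX]] := @disjoint_blocks _ H m0 s.+1; first by lia.
have exZ i : {Z : {set V} | (i < s.+1) ==> ((Z \subset X i) && (#|Z| == K1))}.
  apply: sigW; case: ltnP => [/XH[_ cX]|_]; last by exists set0.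
  have [|Z sZ cZ] := @exists_subset_card _ (X i) K1; first by rewrite cX.
  by exists Z; rewrite sZ cZ eqxx.
pose Z i := sval (exZ i).
have ZP i : i < s.+1 -> Z i \subset X i /\ #|Z i| = K1.
  by move=> si; rewrite /Z; case: (exZ i) => Z' /= /implyP/(_ si)/andP[? /eqP].
pose B i y := (nbr G y :&: H) :\: X i :\: nbrs G (Z i).
have sB i y : B i y \subset nbr G y :\: X i.
  by apply: subset_trans (subsetDl _ _) _; apply: setSD; exact: subsetIl.
(* The vertex y is sought outside all blocks, hence outside everything that is later picked from
   them. *)
pose Y := H :\: \bigcup_(i < s.+1) X i.
pose bad := \bigcup_(w : 'I_s.+1 * 'I_m)
  [set y in Y | stuck G (X w.1) (B w.1 y) (t w.2) (u w.2.+1)].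
have cbad : #|bad| <= s.+1 * m * r.
  apply: leq_card_bigcup => [|[i l] _].
    by rewrite card_prod !card_ord.
  have [spr rc _] := hspr l (ltn_ord l).
  by apply/ltnW/(card_stuck _ spr (XH i (ltn_ord i)).2 hcod rc (sB i)).
(* More than (s + 1) m r vertices of H lie outside the blocks, and each of the (s + 1) m pairs of a
   block and a stage spoils fewer than r of them. *)
have [y yY ybad] : exists2 y, y \in Y & y \notin bad.
  apply/subsetPn; apply/negP => /subset_leq_card; apply/negP; rewrite -ltnNge.
  apply: leq_ltn_trans cbad _; rewrite /Y cardsD.
  have : #|H :&: \bigcup_(i < s.+1) X i| <= s.+1 * m0.
    apply: leq_trans (subset_leq_card (subsetIr _ _)) _.
    by apply: leq_card_bigcup => [|i _]; rewrite ?card_ord // (XH i (ltn_ord i)).2.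
  by lia.
have /setDP[yH yX] := yY.
have nyX i : i < s.+1 -> y \notin X i.
  by move=> si; apply: contra yX => yi; apply/bigcupP; exists (Ordinal si).
have exS i : {S : {set V} | (i < s.+1) ==> [&& S \subset X i, #|S| <= Kg &
    #|B i y :\: nbrs G S| <= u m]}.
  apply: sigW; case: ltnP => [si|_]; last by exists set0.
  have [|||S [sS cS lS]] := @staged_greedy_cover _ G (X i) (B i y) u t m.
  - apply: leq_trans (hunc (Z i) y (ZP i si).2 _).
      apply: subset_leq_card; apply/subsetP => z; rewrite !inE.
      move=> /andP[nz /andP[zX /andP[yz zH]]]; rewrite yz andbT.
      apply/andP; split; first by apply: contra zX; apply/subsetP; case: (ZP i si).
      apply/forall_inP => x xZ; apply: contra nz => zx; apply/bigcupP; exists x => //.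
      by rewrite in_nbr adj_sym.
    by apply: contra (nyX i si); apply/subsetP; case: (ZP i si).
  - by move=> l lm; have [] := hspr l lm.
  - move=> l A lm sA uA; apply/exists_inP; apply: contraNT ybad => nex.
    apply/bigcupP; exists (Ordinal si, Ordinal lm) => //; rewrite inE yY /=.
    apply/existsP; exists A; rewrite sA uA /=; apply/forall_inP => x xX.
    by rewrite ltnNge; move/exists_inPn: nex; apply.
  by exists S; rewrite sS lS andbT (leq_trans cS).
pose S' i := sval (exS i).
have SP i : i < s.+1 -> [/\ S' i \subset X i, #|S' i| <= Kg & #|B i y :\: nbrs G (S' i)| <= u m].
  by move=> si; rewrite /S'; case: (exS i) => ? /= /implyP/(_ si)/and3P[].
pose W i := Z i :|: S' i.
have WX i : i < s.+1 -> W i \subset X i.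
  by move=> si; rewrite subUset (ZP i si).1; have [-> _ _] := SP i si.
pose S := \bigcup_(i < s.+1) W i.
pose L := \bigcup_(i < s.+1) (B i y :\: nbrs G (S' i)).
have cS : #|S| <= s.+1 * (K1 + Kg).
  apply: leq_card_bigcup => [|i _]; first by rewrite card_ord.
  apply: leq_trans (leq_card_setU _ _).1 _; rewrite (ZP i (ltn_ord i)).2 leq_add2l.
  by have [] := SP i (ltn_ord i).
have cL : #|L| <= s.+1 * u m.
  apply: leq_card_bigcup => [|i _]; first by rewrite card_ord.
  by have [] := SP i (ltn_ord i).
have [[l sl ml]|[T [sT cT nT]]] := matching_or_cover (twins S s) (H :\: (y |: (S :|: L))) q.
  have /negP[] := htwin S l cS sl; case/and3P: ml => ul tl /allP Dl.
  rewrite /matching ul tl; apply/allP => w /Dl.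
  by rewrite !inE !negb_or => /andP[] /andP[/andP[_ /andP[-> _]] _] /andP[/andP[_ /andP[-> _]] _].
exists y, (S :|: L :|: T); split=> //.
- rewrite !subUset (subset_trans sT (subsetDl _ _)) andbT; apply/andP; split.
    apply/bigcupsP => i _; apply: subset_trans (WX i (ltn_ord i)) _.
    by have [] := XH i (ltn_ord i).
  apply/bigcupsP => i _; apply/subsetP => z; rewrite !inE.
  by move=> /andP[_] /andP[_] /andP[_] /andP[].
- rewrite !inE !negb_or; apply/andP; split; last first.
    by apply/negP => /(subsetP sT); rewrite !inE eqxx.
  apply/andP; split; apply/bigcupP => -[i _].
    by move/(subsetP (WX i (ltn_ord i))); rewrite (negbTE (nyX i (ltn_ord i))).
  by rewrite !inE adj_irr !andbF.
- have key z z' : z \in H :\: (y |: (S :|: L :|: T)) -> z' \in H :\: (y |: (S :|: L :|: T)) ->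
      {in S :|: L :|: T, forall x, adj G z x = adj G z' x} -> adj G y z -> adj G y z'.
    move=> zD zD' e yz; apply/negPn/negP => nyz'.
    have sDT w : w \in H :\: (y |: (S :|: L :|: T)) -> w \in H :\: (y |: (S :|: L)) :\: T.
      by rewrite !inE; case: (w == y); case: (w \in S); case: (w \in L); case: (w \in T).
    have nz : z != z' by apply: contraNneq nyz' => <-.
    have /negP[] := nT z z' (sDT z zD) (sDT z' zD') nz.
    rewrite /twins -setIA (_ : nbr G z' :&: S = nbr G z :&: S); last first.
      by apply/setP => x; rewrite !inE; case xS: (x \in S); rewrite ?andbF // e // !inE xS.
    rewrite setIA setIid; apply: (card_hits dX WX) => [i si|i si zX].
      exact: (bigcup_sup (Ordinal si)).
    have zL : z \notin L by move: zD; rewrite !inE !negb_or => /andP[/andP[_ /andP[/andP[_ ->]]]].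
    have zB : z \notin B i y :\: nbrs G (S' i).
      by apply: contra zL => zB; apply/bigcupP; exists (Ordinal si).
    have zH : z \in H by move: zD; rewrite inE => /andP[].
    case: (boolP (z \in nbrs G (Z i))) => [/bigcupP[x xZ]|nzZ].
      by rewrite in_nbr adj_sym => zx; exists x; rewrite // inE xZ.
    case: (boolP (z \in nbrs G (S' i))) => [/bigcupP[x xZ]|nzS].
      by rewrite in_nbr adj_sym => zx; exists x; rewrite // inE xZ orbT.
    by move: zB; rewrite !inE nzS nzZ zX yz zH.
  move=> z z' zD zD' e; apply/idP/idP; apply: key => // x xS; by rewrite e.
apply: leq_trans (leq_maxr _ _); apply: leq_trans (leq_card_setU _ _).1 _.
rewrite leq_add //; apply: leq_trans (leq_card_setU _ _).1 _.
by rewrite leq_add.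
Qed.

Lemma functionality_le_degenerate k :
  (forall H, H != set0 -> exists2 y, y \in H & #|nbr G y :&: H| <= k) ->
  functionality G <= k.
Proof.
move=> hdeg; apply: functionality_le => H /hdeg[y yH yk].
exists y, (nbr G y :&: H); split=> //; first exact: subsetIr.
  by rewrite inE negb_and nbr_irr.
exact: determines_nbr.
Qed.

Definition same_trace S : rel V := fun z z' => [forall x in S, adj G z x == adj G z' x].

Lemma functionality_le_separating k q :
  (forall S l, #|S| = k -> size l = q -> ~~ matching (same_trace S) (~: S) l) ->
  functionality G <= k + 2 * q.
Proof.
move=> hsep; apply: functionality_le => H H0.
(* A set this small is settled by all its other vertices; a larger one contains some y outside S and
   T. *)
have [small|big] := leqP #|H| (k + 2 * q).+1.
  have /set0Pn[y yH] := H0; exists y, (H :\ y); split=> //.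
  - exact: subsetDl.
  - by rewrite !inE eqxx.
  - by move=> z z'; rewrite !inE; case: eqP; case: (z \in H).
  by move: small; rewrite (cardsD1 y) yH.
have [S sS cS] : exists2 S : {set V}, S \subset H & #|S| = k.
  by apply: exists_subset_card; lia.
have [[l sl ml]|[T [sT cT nT]]] := matching_or_cover (same_trace S) (H :\: S) q.
  have /negP[] := hsep S l cS sl; case/and3P: ml => ul tl /allP Dl.
  rewrite /matching ul tl; apply/allP => w /Dl.
  by rewrite !inE => /andP[/andP[-> _] /andP[-> _]].
have cST : #|S :|: T| <= k + 2 * q.
  by apply: leq_trans (leq_card_setU _ _).1 _; rewrite cS leq_add2l.
have [y yH yS] : exists2 y, y \in H & y \notin S :|: T.
  apply/subsetPn; apply/negP => /subset_leq_card; apply/negP; rewrite -ltnNge.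
  by apply: leq_ltn_trans cST _; apply: ltn_trans big.
exists y, (S :|: T); split=> //.
  by rewrite subUset sS (subset_trans sT (subsetDl _ _)).
move=> z z' zD zD' e; have [-> //|nz] := eqVneq z z'.
have sDT w : w \in H :\: (y |: (S :|: T)) -> w \in H :\: S :\: T.
  by rewrite !inE; case: (w == y); case: (w \in S); case: (w \in T).
have /negP[] := nT z z' (sDT z zD) (sDT z' zD') nz.
by apply/forall_inP => x xS; rewrite e // inE xS.
Qed.

End UpperBound.

Local Open Scope ring_scope.

(** * Random subsets with independent elements *)

Section Bernoulli.
Variables (R : realFieldType) (T : finType) (p : R).
Hypothesis p01 : 0 <= p <= 1.
Implicit Types (Q : pred {set T}) (E F B : {set T}).

Definition bern_weight (E : {set T}) : R :=
  \prod_(e : T) (if e \in E then p else 1 - p).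

Definition pr (Q : pred {set T}) : R := \sum_(E | Q E) bern_weight E.

Lemma bern_weight_ge0 E : 0 <= bern_weight E.
Proof.
have /andP[p0 p1] := p01.
by apply: prodr_ge0 => e _; case: ifP => _; rewrite ?subr_ge0.
Qed.

Lemma pr_ge0 Q : 0 <= pr Q.
Proof. by apply: sumr_ge0 => E _; exact: bern_weight_ge0. Qed.

(** At a = 1 this gives total mass 1; at a = 1/e it gives the lower tail of the number of edges. *)
Lemma pr_mgf (a : R) :
  \sum_(E : {set T}) bern_weight E * a ^+ #|E| = (p * a + (1 - p)) ^+ #|T|.
Proof.
rewrite -[RHS]prodr_const bigA_distr /=.
apply: eq_bigr => E _; rewrite /bern_weight -prodr_const [X in _ * X]big_mkcond /=.
rewrite -big_split /=; apply: eq_bigr => e _.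
by case: ifP => // _; rewrite mulr1.
Qed.

Lemma pr_predT : pr predT = 1.
Proof.
have := pr_mgf 1; rewrite mulr1 addrC subrK expr1n => <-.
by apply: eq_bigr => E _; rewrite expr1n mulr1.
Qed.

Lemma pr_mono Q Q' : (forall E, Q E -> Q' E) -> pr Q <= pr Q'.
Proof.
move=> sQ; rewrite /pr [leRHS](bigID Q) /= -[leLHS]addr0 lerD //.
  rewrite le_eqVlt; apply/orP; left; apply/eqP; apply: eq_bigl => E.
  by case QE: (Q E); rewrite ?andbF // (sQ _ QE).
by apply: sumr_ge0 => E _; exact: bern_weight_ge0.
Qed.

Lemma eq_pr Q Q' : Q =1 Q' -> pr Q = pr Q'.
Proof. by move=> eQ; apply: eq_bigl. Qed.

Lemma prC Q : pr (predC Q) = 1 - pr Q.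
Proof.
by apply/eqP; rewrite eq_sym subr_eq -pr_predT /pr addrC [X in X == _](bigID Q).
Qed.

Lemma pr_pred0 Q : (forall E, ~~ Q E) -> pr Q = 0.
Proof. by move=> Q0; apply: big_pred0 => E; apply/negbTE. Qed.

Lemma pr_orb Q Q' : pr (fun E => Q E || Q' E) <= pr Q + pr Q'.
Proof.
rewrite /pr (bigID Q) /= lerD //.
  by rewrite le_eqVlt (eq_bigl Q) ?eqxx // => E; case: (Q E); rewrite ?andbF.
by apply: pr_mono => E /andP[/orP[->|]].
Qed.

Lemma pr_exists (I : finType) (D : pred I) (Q : I -> pred {set T}) :
  pr (fun E => [exists i, D i && Q i E]) <= \sum_(i | D i) pr (Q i).
Proof.
rewrite /pr; under [leRHS]eq_bigr do rewrite big_mkcond.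
rewrite exchange_big /= big_mkcond /=; apply: ler_sum => E _.
have s0 (P : pred I) : 0 <= \sum_(i | P i) (if Q i E then bern_weight E else 0).
  by apply: sumr_ge0 => i _; case: ifP => // _; exact: bern_weight_ge0.
case: existsP => [[i /andP[Di Qi]]|_]; last exact: s0.
by rewrite (bigD1 i) //= Qi lerDl; exact: s0.
Qed.

Lemma pr_exists_le (I : finType) (D : pred I) (Q : I -> pred {set T}) (b : R) :
  0 <= b -> (forall i, D i -> pr (Q i) <= b) ->
  pr (fun E => [exists i, D i && Q i E]) <= #|D|%:R * b.
Proof.
move=> b0 Qb; apply: (le_trans (pr_exists _ _)).
apply: (@le_trans _ _ (\sum_(i | D i) b)); first exact: ler_sum.
by rewrite sumr_const mulr_natl.
Qed.

(** Measurability of Q with respect to the coordinates in F. *)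
Definition depends_on (F : {set T}) (Q : pred {set T}) :=
  forall E E', E :&: F = E' :&: F -> Q E = Q E'.

Lemma depends_onS F F' Q : F \subset F' -> depends_on F Q -> depends_on F' Q.
Proof.
move=> sF dQ E E' eE; apply: dQ.
by rewrite -(setIidPr sF) !setIA eE.
Qed.

Lemma depends_onC F Q : depends_on F Q -> depends_on F (predC Q).
Proof. by move=> dQ E E' /dQ /= ->. Qed.

Lemma depends_on_and F Q Q' : depends_on F Q -> depends_on F Q' ->
  depends_on F (fun E => Q E && Q' E).
Proof. by move=> dQ dQ' E E' eE; rewrite (dQ _ _ eE) (dQ' _ _ eE). Qed.

Lemma depends_on_all (I : finType) (D : pred I) F (Q : I -> pred {set T}) :
  (forall i, D i -> depends_on F (Q i)) ->
  depends_on F (fun E => [forall i, D i ==> Q i E]).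
Proof.
move=> dQ E E' eE; apply: eq_forallb => i.
by case Di: (D i) => //=; apply: dQ.
Qed.

(* Swapping the F-parts of two independent copies of the random set preserves
   the joint law. *)
Lemma pr_and F Q Q' : depends_on F Q -> depends_on (~: F) Q' ->
  pr (fun E => Q E && Q' E) = pr Q * pr Q'.
Proof.
move=> dQ dQ'; rewrite -[LHS]mulr1 -pr_predT /pr !mulr_suml.
under eq_bigr do rewrite mulr_sumr.
under [RHS]eq_bigr do rewrite mulr_sumr.
rewrite !pair_big /=.
pose mix (A B : {set T}) := (A :&: F) :|: (B :\: F).
pose h (u : {set T} * {set T}) := (mix u.1 u.2, mix u.2 u.1).
have hK : involutive h.
  by case=> A B; congr (_, _); apply/setP => e; rewrite !inE;
     case: (e \in F) (e \in A) (e \in B) => [] [] [].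
have mixF A B : mix A B :&: F = A :&: F.
  by apply/setP => e; rewrite !inE; case: (e \in F) (e \in A) (e \in B) => [] [] [].
have mixC A B : mix A B :&: ~: F = B :&: ~: F.
  by apply/setP => e; rewrite !inE; case: (e \in F) (e \in A) (e \in B) => [] [] [].
rewrite (reindex_inj (inv_inj hK)) /=; apply: eq_big => [[A B]|[A B] _] /=.
  by rewrite andbT (dQ _ _ (mixF A B)) (dQ' _ _ (mixC A B)).
rewrite /bern_weight -!big_split /=; apply: eq_bigr => e _.
by rewrite !inE; case: (e \in F) (e \in A) (e \in B) => [] [] [] //=; rewrite mulrC.
Qed.

Lemma pr_forall (I : finType) (D : {set I}) (F : I -> {set T})
    (Q : I -> pred {set T}) :
  (forall i, i \in D -> depends_on (F i) (Q i)) ->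
  {in D &, forall i j, i != j -> [disjoint F i & F j]} ->
  pr (fun E => [forall i in D, Q i E]) = \prod_(i in D) pr (Q i).
Proof.
elim: {D}#|D| {1 3 4 5 6}D (erefl #|D|) => [|m IHm] D.
  move=> /eqP; rewrite cards_eq0 => /eqP -> _ _; rewrite big_set0 -pr_predT.
  by apply: eq_pr => E; apply/forallP => i; rewrite inE.
move=> cD dQ dF; have /card_gt0P[i iD] : (0 < #|D|)%N by rewrite cD.
rewrite (big_setD1 i) //= -IHm; first last.
- by move=> j k /setD1P[_ jD] /setD1P[_ kD]; apply: dF.
- by move=> j /setD1P[_ jD]; apply: dQ.
- by move: cD; rewrite (cardsD1 i) iD => -[].
rewrite -(@pr_and (F i)); [|exact: dQ|].
  apply: eq_pr => E; apply/forall_inP/andP => [H|[Qi /forall_inP H] j jD].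
    by split; [exact: H | apply/forall_inP => j /setD1P[_]; exact: H].
  by have [->//|ji] := eqVneq j i; apply: H; rewrite !inE ji.
apply: depends_on_all => j; rewrite inE => /andP[ji jD].
apply: (@depends_onS (F j)); last exact: dQ.
apply/subsetP => e ej; rewrite inE; apply/negP => ei.
by move: (dF j i jD iD); rewrite inE in ji; rewrite ji => /(_ isT) /pred0P /(_ e) /=; rewrite ej ei.
Qed.

Lemma pr_prod (a b : T -> R) :
  \sum_(E : {set T}) bern_weight E * \prod_e (if e \in E then a e else b e)
  = \prod_e (p * a e + (1 - p) * b e).
Proof.
rewrite bigA_distr /=; apply: eq_bigr => E _.
by rewrite -big_split /=; apply: eq_bigr => e _; case: ifP.
Qed.

Lemma pr_setI F B : B \subset F ->
  pr (fun E => E :&: F == B) = p ^+ #|B| * (1 - p) ^+ #|F :\: B|.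
Proof.
move=> sBF.
(* The product of these factors is the indicator of [E :&: F = B], so the expectation factorises
   over the elements of T. *)
pose a e : R := if e \in F then (e \in B)%:R else 1.
pose b e : R := if e \in F then (e \notin B)%:R else 1.
transitivity (\sum_(E : {set T})
    bern_weight E * \prod_e (if e \in E then a e else b e)).
  rewrite /pr big_mkcond; apply: eq_bigr => E _.
  case: eqP => [EB|nEB].
    rewrite big1 ?mulr1 // => e _; rewrite /a /b -EB !inE.
    by case: (e \in E); case: (e \in F).
  have [e ne] : exists e, (e \in E :&: F) != (e \in B).
    apply/existsP; apply: contra_notT nEB => /existsPn H.
    by apply/setP => e; apply/eqP; move: (H e); rewrite negbK.
  rewrite (bigD1 e) //= [X in _ * (X * _)](_ : _ = 0) ?mul0r ?mulr0 //.
  move: (subsetP sBF e) ne; rewrite /a /b !inE.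
  case: (e \in B) => [/(_ isT) ->|_]; first by case: (e \in E).
  by case: (e \in E); case: (e \in F).
rewrite pr_prod (bigID (mem B)) /=; congr (_ * _).
  rewrite -prodr_const; apply: eq_bigr => e eB.
  by rewrite /a /b (subsetP sBF) // eB mulr1 mulr0 addr0.
rewrite -prodr_const (bigID (mem F)) /= [X in _ * X]big1 ?mulr1.
  apply: eq_big => [e|e /andP[/negbTE eB eF]]; first by rewrite inE.
  by rewrite /a /b eF eB mulr0 mulr1 add0r.
by move=> e /andP[_ /negbTE eF]; rewrite /a /b eF; ring.
Qed.

Lemma pr_in e : pr (fun E => e \in E) = p.
Proof.
rewrite (@eq_pr _ (fun E => E :&: [set e] == [set e])); last first.
  by move=> E; rewrite (sameP eqP setIidPr) sub1set.
by rewrite pr_setI // cards1 setDv cards0 expr0 expr1 mulr1.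
Qed.

Lemma depends_on_in e : depends_on [set e] (fun E => e \in E).
Proof. by move=> E E' /setP/(_ e); rewrite !inE eqxx !andbT. Qed.

Lemma pr_subset F : pr (fun E => F \subset E) = p ^+ #|F|.
Proof.
rewrite (@eq_pr _ (fun E => E :&: F == F)); last by move=> E; exact/setIidPr/eqP.
by rewrite pr_setI // setDv cards0 expr0 mulr1.
Qed.

Lemma pr_eq_in e e' : e != e' ->
  pr (fun E => (e \in E) == (e' \in E)) = p ^+ 2 + (1 - p) ^+ 2.
Proof.
move=> ne; have dis : depends_on (~: [set e]) (fun E => e' \in E).
  apply: (@depends_onS [set e']); last exact: depends_on_in.
  by rewrite sub1set !inE eq_sym.
rewrite /pr (bigID (fun E => e \in E)) /=; congr (_ + _).
  rewrite -[LHS]/(pr (fun E => ((e \in E) == (e' \in E)) && (e \in E))).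
  rewrite (@eq_pr _ (fun E => (e \in E) && (e' \in E))); last first.
    by move=> E; case: (e \in E); rewrite ?andbT ?andbF.
  by rewrite (pr_and (@depends_on_in e)) // !pr_in.
rewrite -[LHS]/(pr (fun E => ((e \in E) == (e' \in E)) && (e \notin E))).
rewrite (@eq_pr _ (fun E => predC (fun E => e \in E) E && predC (fun E => e' \in E) E)).
  by rewrite (pr_and (depends_onC (@depends_on_in e)) (depends_onC dis)) !prC !pr_in.
by move=> E /=; case: (e \in E); rewrite ?andbT ?andbF; case: (e' \in E).
Qed.

(** Only intersections of size exactly t are counted; prescribing different intersections gives
    disjoint events, so the probabilities add up. *)
Lemma pr_card_ge F t :
  'C(#|F|, t)%:R * (p ^+ t * (1 - p) ^+ (#|F| - t)) <= pr (fun E => t <= #|E :&: F|)%N.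
Proof.
rewrite -cards_draws mulr_natl -sumr_const.
apply: (@le_trans _ _ (\sum_(B in [set B : {set T} | B \subset F & #|B| == t])
    pr (fun E => E :&: F == B))).
  apply: ler_sum => B; rewrite inE => /andP[sBF /eqP cB].
  by rewrite pr_setI // cardsD (setIidPr sBF) cB.
rewrite /pr; under eq_bigr do rewrite big_mkcond.
rewrite exchange_big /= [leRHS]big_mkcond; apply: ler_sum => E _.
rewrite big_mkcond (bigD1 (E :&: F)) //= eqxx big1 ?addr0 => [|B /negbTE nB].
  rewrite inE subsetIr /=; case: eqP => [->|_]; first by rewrite leqnn.
  by case: ifP => // _; exact: bern_weight_ge0.
by rewrite eq_sym nB if_same.
Qed.

End Bernoulli.

(** * Union bounds in G(n, p) *)

Section GnpEvents.
Variables (R : realFieldType) (n : nat) (p : R).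
Implicit Types (x y z : 'I_n) (A X : {set 'I_n}) (E : {set potential_edge n}).

Lemma gnp_probE (A : pred (sgraph 'I_n)) :
  gnp_prob n p A = pr p (fun E => A (graph_of_edges E)).
Proof. by []. Qed.

Definition star x A : {set potential_edge n} :=
  [set e | [exists z in A, val e == [set x; z]]].

Lemma in_star x A (e : potential_edge n) :
  reflect (exists2 z, z \in A & val e = [set x; z]) (e \in star x A).
Proof.
rewrite inE; apply: (iffP existsP) => [[z /andP[zA /eqP ez]]|[z zA ez]].
  by exists z.
by exists z; rewrite zA ez eqxx.
Qed.

(** The only edge that stars with two different centres can share is the one joining the centres. *)
Lemma star_disjoint x x' A A' : x != x' -> ~~ ((x \in A') && (x' \in A)) ->
  [disjoint star x A & star x' A'].
Proof.
move=> nxx nAA; rewrite -setI_eq0; apply/eqP/setP => e; rewrite [RHS]inE.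
apply/negP => /setIP[/in_star[z zA ez] /in_star[z' zA']].
rewrite ez => ezz.
have : x \in [set x'; z'] by rewrite -ezz !inE eqxx.
have : x' \in [set x; z] by rewrite ezz !inE eqxx.
rewrite !inE (negbTE nxx) eq_sym (negbTE nxx) /= => /eqP x'z /eqP xz'.
by move: nAA; rewrite xz' zA' x'z zA.
Qed.

Lemma star_disjointr x A A' : [disjoint A & A'] -> [disjoint star x A & star x A'].
Proof.
move=> dA; rewrite -setI_eq0; apply/eqP/setP => e; rewrite [RHS]inE.
apply/negP => /setIP[/in_star[z zA ez] /in_star[z' zA']].
rewrite ez => ezz.
have zz : z == z'.
  have : z \in [set x; z'] by rewrite -ezz !inE eqxx orbT.
  have : z' \in [set x; z] by rewrite ezz !inE eqxx orbT.
  by rewrite !inE => /orP[/eqP ->|/eqP ->] /orP[]; rewrite ?eqxx // => /eqP ->.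
by move/pred0P/(_ z): dA; rewrite /= zA (eqP zz) zA'.
Qed.

Lemma starS x A A' : A \subset A' -> star x A \subset star x A'.
Proof.
move=> sA; apply/subsetP => e /in_star[z zA ez]; apply/in_star.
by exists z => //; exact: (subsetP sA).
Qed.

Lemma depends_on_adj x z : depends_on (star x [set z]) (fun E => edges_adj E x z).
Proof.
move=> E E' /setP eE; apply: eq_existsb => e; case: eqP; rewrite ?andbF // => ez.
have es : e \in star x [set z] by apply/in_star; exists z; rewrite ?inE.
by move: (eE e); rewrite !in_setI es !andbT.
Qed.

Lemma depends_on_adj_sub x z A (zA : z \in A) :
  depends_on (star x A) (fun E => edges_adj E x z).
Proof.
by apply: depends_onS (@depends_on_adj x z); apply: starS; rewrite sub1set.
Qed.

Lemma edge_between x z : x != z ->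
  {e : potential_edge n | val e = [set x; z] & forall E, edges_adj E x z = (e \in E)}.
Proof.
move=> nxz; have c2 : #|[set x; z]| == 2%N by rewrite cards2 nxz.
exists (exist _ [set x; z] c2) => // E; apply/existsP/idP => [[e /andP[eE /eqP ez]]|eE].
  by rewrite (_ : exist _ _ _ = e) //; apply: val_inj.
by exists (exist _ [set x; z] c2); rewrite eE /=.
Qed.

Lemma pr_adj x z : x != z -> pr p (fun E => edges_adj E x z) = p.
Proof.
by move=> /edge_between[e _ eE]; rewrite (@eq_pr _ _ _ _ _ eE) pr_in.
Qed.

Lemma pr_nadj x z : x != z -> pr p (fun E => ~~ edges_adj E x z) = 1 - p.
Proof. by move=> nxz; rewrite -[in RHS](pr_adj nxz) -prC. Qed.

Lemma set2_inj x z z' : x != z -> x != z' -> [set x; z] = [set x; z'] -> z = z'.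
Proof.
move=> nz nz' /setP/(_ z); rewrite !inE eqxx orbT => /esym/orP[]/eqP // zx.
by rewrite zx eqxx in nz.
Qed.

Lemma card_star_adj x A E : x \notin A ->
  #|E :&: star x A| = #|[set z in A | edges_adj E x z]|.
Proof.
move=> xA; have neq z : z \in A -> x != z.
  by move=> zA; apply: contraNneq xA => ->.
rewrite -(card_imset _ val_inj).
rewrite -[RHS](@card_in_imset _ _ (fun z => [set x; z])); last first.
  move=> z z'; rewrite !inE => /andP[zA _] /andP[zA' _].
  by apply: set2_inj; apply: neq.
apply: eq_card => B; apply/imsetP/imsetP => [[e]|[z]].
  rewrite inE => /andP[eE /in_star[z zA ez]] ->; exists z => //.
  by rewrite inE zA; apply/existsP; exists e; rewrite eE ez eqxx.
rewrite inE => /andP[zA /existsP[e /andP[eE /eqP ez]]] ->; exists e => //.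
by rewrite inE eE; apply/in_star; exists z.
Qed.

Lemma card_star x A : x \notin A -> #|star x A| = #|A|.
Proof.
move=> xA; rewrite -[star x A]setTI card_star_adj //; apply: eq_card => z.
rewrite inE; case zA : (z \in A) => //=.
have nxz : x != z by apply: contraNneq xA => ->.
by have [e _ ->] := edge_between nxz; rewrite inE.
Qed.

Lemma pr_and_nadj (Q : pred {set potential_edge n}) y z X :
  depends_on (star z [set y]) Q -> y \notin X -> z \notin X ->
  pr p (fun E => Q E && [forall x in X, ~~ edges_adj E z x])
  = pr p Q * (1 - p) ^+ #|X|.
Proof.
move=> dQ yX zX; rewrite (@pr_and _ _ p (star z [set y])) //.
  congr (_ * _); rewrite (@pr_forall _ _ p _ _ (fun x => star z [set x])).
  - rewrite (eq_bigr (fun=> 1 - p)) ?prodr_const // => x xX.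
    by rewrite pr_nadj //; apply: contraNneq zX => ->.
  - by move=> x xX; apply: depends_onC; apply: depends_on_adj.
  move=> x x' _ _ nxx; apply: star_disjointr.
  by rewrite disjoints1 inE.
apply: depends_on_all => x xX; apply: depends_onC.
apply: (@depends_onS _ (star z [set x])); last exact: depends_on_adj.
rewrite -disjoints_subset; apply: star_disjointr.
by rewrite disjoints1 inE; apply: contraNneq yX => <-.
Qed.

End GnpEvents.

Section GnpBounds.
Variables (R : realFieldType) (n : nat) (p : R).
Hypothesis p01 : 0 <= p <= 1.
Local Notation V := 'I_n.
Local Notation gr := (@graph_of_edges n).
Implicit Types (E : {set potential_edge n}) (A B D H S T X Y Z : {set V}) (x y z : V).

Let p0 : 0 <= p. Proof. by case/andP: p01. Qed.
Let p1 : 0 <= 1 - p. Proof. by rewrite subr_ge0; case/andP: p01. Qed.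

Lemma star_disjoint_out X z z' : z \notin X -> z' \notin X -> z != z' ->
  [disjoint star z X & star z' X].
Proof. by move=> zX zX' nz; apply: star_disjoint; rewrite // negb_and zX. Qed.

(** The q uncovered neighbours are independent, as their edges to y and Z form disjoint stars. For k
    = 0 the set Z is empty and the bound concerns the maximum degree; case (1) uses it in this
    form. *)
Lemma pr_uncovered k q :
  pr p (fun E => [exists Z : {set V}, (#|Z| == k) && [exists y, (y \notin Z) &&
     (q <= #|uncovered (gr E) Z y|)%N]])
  <= 'C(n, k)%:R * (n%:R * ('C(n, q)%:R * (p * (1 - p) ^+ k) ^+ q)).
Proof.
have b0 : 0 <= p * (1 - p) ^+ k by rewrite mulr_ge0 ?exprn_ge0.
have := @pr_exists_le _ _ p p01 _ (fun Z : {set V} => #|Z| == k)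
  (fun Z E => [exists y, (y \notin Z) && (q <= #|uncovered (gr E) Z y|)%N])
  (n%:R * ('C(n, q)%:R * (p * (1 - p) ^+ k) ^+ q)).
have -> : #|(fun Z : {set V} => #|Z| == k)| = 'C(n, k).
  by rewrite -[in RHS](card_ord n) -card_draws cardsE.
apply; first by rewrite !mulr_ge0 ?exprn_ge0.
move=> Z /eqP cZ.
apply: (@le_trans _ _ (#|[pred y | y \notin Z]|%:R * ('C(n, q)%:R * (p * (1 - p) ^+ k) ^+ q))); last first.
  rewrite ler_wpM2r ?mulr_ge0 ?exprn_ge0 // ler_nat.
  by apply: leq_trans (max_card _) _; rewrite card_ord.
apply: pr_exists_le => //; first by rewrite mulr_ge0 ?exprn_ge0.
move=> y yZ.
apply: (@le_trans _ _ (pr p (fun E => [exists Q : {set V},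
   ((Q \subset ~: (y |: Z)) && (#|Q| == q)) && [forall z in Q,
      edges_adj E z y && [forall x in Z, ~~ edges_adj E z x]]]))).
  apply: pr_mono => // E /exists_subset_card[Q sQ cQ].
  apply/existsP; exists Q; rewrite cQ eqxx andbT; apply/andP; split.
    apply: subset_trans sQ _; apply/subsetP => z; rewrite !inE negb_or => /andP[/andP[-> yz] _].
    by rewrite andbT; apply: contraTneq yz => ->; rewrite adj_irr.
  apply/forall_inP => z /(subsetP sQ); rewrite !inE => /andP[/andP[_ yz] ->].
  by rewrite andbT -[edges_adj _ _ _]/(adj (gr E) z y) adj_sym.
apply: le_trans (pr_exists_le (b := (p * (1 - p) ^+ k) ^+ q) p01 _ _) _.
- by rewrite exprn_ge0.
- move=> Q /andP[sQ /eqP <-].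
  rewrite (@pr_forall _ _ p _ _ (fun z => star z (y |: Z))).
  + rewrite -prodr_const; apply: ler_prod => z /(subsetP sQ).
    rewrite !inE negb_or => /andP[nzy zZ]; rewrite pr_ge0 //=.
    rewrite (@pr_and_nadj _ _ p (fun E => edges_adj E z y) y) ?pr_adj ?cZ //.
    exact: depends_on_adj.
  + move=> z zQ; apply: depends_on_and; first by apply: depends_on_adj_sub; rewrite !inE eqxx.
    apply: depends_on_all => x xZ; apply: depends_onC; apply: depends_on_adj_sub.
    by rewrite !inE xZ orbT.
  move=> z z' /(subsetP sQ) zQ /(subsetP sQ) zQ'; apply: star_disjoint_out.
    by move: zQ; rewrite inE.
  by move: zQ'; rewrite inE.
rewrite ler_wpM2r ?exprn_ge0 // ler_nat -cardsE cards_draws.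
by apply: leq_bin2l; apply: leq_trans (max_card _) _; rewrite card_ord.
Qed.

Lemma pr_codegree q :
  pr p (fun E => [exists x, true && [exists y, (x != y) &&
     (q <= #|nbr (gr E) x :&: nbr (gr E) y|)%N]])
  <= n%:R * (n%:R * ('C(n, q)%:R * p ^+ (2 * q))).
Proof.
have b0 : 0 <= 'C(n, q)%:R * p ^+ (2 * q) by rewrite mulr_ge0 ?exprn_ge0.
apply: le_trans (pr_exists_le (b := n%:R * ('C(n, q)%:R * p ^+ (2 * q))) p01 _ _) _.
- by rewrite mulr_ge0.
- move=> x _; apply: (le_trans (pr_exists_le (b := 'C(n, q)%:R * p ^+ (2 * q)) p01 b0 _)); last first.
    by rewrite ler_wpM2r // ler_nat; apply: leq_trans (max_card _) _; rewrite card_ord.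
  move=> y nxy.
  apply: (@le_trans _ _ (pr p (fun E => [exists Q : {set V},
     ((Q \subset ~: [set x; y]) && (#|Q| == q)) && [forall z in Q,
        [forall w in [set x; y], edges_adj E z w]]]))).
    apply: pr_mono => // E /exists_subset_card[Q sQ cQ].
    apply/existsP; exists Q; rewrite cQ eqxx andbT; apply/andP; split.
      apply: subset_trans sQ _; apply/subsetP => z; rewrite !inE negb_or => /andP[xz yz].
      by apply/andP; split; [apply: contraTneq xz|apply: contraTneq yz] => ->; rewrite adj_irr.
    apply/forall_inP => z /(subsetP sQ); rewrite !inE => /andP[xz yz].
    apply/forall_inP => w; rewrite -[edges_adj _ _ _]/(adj (gr E) z w) adj_sym !inE.
    by case/orP => /eqP ->.
  apply: le_trans (pr_exists_le (b := p ^+ (2 * q)) p01 _ _) _.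
  + by rewrite exprn_ge0.
  + move=> Q /andP[sQ /eqP <-]; rewrite exprM.
    have nQ z w : z \in Q -> w \in [set x; y] -> z != w.
      by move=> /(subsetP sQ); rewrite inE => zn wx; apply: contraNneq zn => ->.
    rewrite (@pr_forall _ _ p _ _ (fun z => star z [set x; y])).
    * rewrite -prodr_const; apply: ler_prod => z zQ; rewrite pr_ge0 //=.
      rewrite (@pr_forall _ _ p _ _ (fun w => star z [set w])).
      - rewrite (eq_bigr (fun=> p)) ?prodr_const ?cards2 ?nxy // => w wx.
        by rewrite pr_adj // nQ.
      - by move=> w wx; apply: depends_on_adj.
      - by move=> w w' _ _ nw; apply: star_disjointr; rewrite disjoints1 inE.
    * by move=> z zQ; apply: depends_on_all => w wx; apply: depends_on_adj_sub.
    * by move=> z z' /(subsetP sQ) zQ /(subsetP sQ) zQ'; apply: star_disjoint_out; rewrite -in_setC.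
  rewrite ler_wpM2r ?exprn_ge0 // ler_nat -cardsE cards_draws.
  by apply: leq_bin2l; apply: leq_trans (max_card _) _; rewrite card_ord.
by rewrite ler_wpM2r ?(mulr_ge0 _ b0) // ler_nat; apply: leq_trans (max_card _) _; rewrite card_ord.
Qed.

End GnpBounds.

Lemma leq_bin_exp m s : ('C(m, s) <= m ^ s)%N.
Proof.
apply: (@leq_trans (m ^_ s)); first by rewrite -bin_ffact leq_pmulr // fact_gt0.
elim: s => // s IHs; rewrite ffactnSr expnSr; apply: leq_mul => //.
exact: leq_subr.
Qed.

Lemma card_sets_le (V : finType) k :
  (#|[pred S : {set V} | (#|S| <= k)%N]| <= #|V|.+1 ^ k)%N.
Proof.
(* Every set of at most k elements is reached from its enumeration padded with [None] to length
   k. *)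
pose im (f : {ffun 'I_k -> option V}) : {set V} := [set x | Some x \in codom f].
have -> : (#|V|.+1 ^ k = #|{: {ffun 'I_k -> option V}}|)%N.
  by rewrite card_ffun card_option card_ord.
apply: leq_trans (leq_image_card im _); apply: subset_leq_card.
apply/subsetP => S; rewrite inE => cS; apply/imageP.
exists [ffun i : 'I_k => nth None (map Some (enum S)) i] => //.
apply/setP => x; rewrite inE; apply/idP/codomP => [xS|[i]].
  have ix : (index x (enum S) < size (enum S))%N by rewrite index_mem mem_enum.
  have ik : (index x (enum S) < k)%N by rewrite (leq_trans ix) // -cardE.
  exists (Ordinal ik); rewrite ffunE /= (nth_map x) // nth_index //.
  by rewrite mem_enum.
rewrite ffunE; case: (ltnP i (size (enum S))) => [iS|iS].
  by rewrite (nth_map x) // => -[->]; rewrite -mem_enum mem_nth.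
by rewrite nth_default ?size_map.
Qed.

Lemma uniq_pairs_inj (V : eqType) q (l : q.-tuple (V * V)) :
  uniq (unzip1 l ++ unzip2 l) ->
  injective (fun u : 'I_q * bool => if u.2 then (tnth l u.1).1 else (tnth l u.1).2).
Proof.
rewrite cat_uniq => /and3P[u1 /hasPn u12 u2].
have inj1 : injective (fun i => (tnth l i).1).
  have /tuple_uniqP inj : uniq (map_tuple fst l) by [].
  by move=> i j eij; apply: inj; rewrite !tnth_map.
have inj2 : injective (fun i => (tnth l i).2).
  have /tuple_uniqP inj : uniq (map_tuple snd l) by [].
  by move=> i j eij; apply: inj; rewrite !tnth_map.
have n12 i j : (tnth l i).2 <> (tnth l j).1.
  move=> eij; have /u12/negP[] : (tnth l i).2 \in unzip2 l by rewrite map_f ?mem_tnth.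
  by rewrite eij /= map_f ?mem_tnth.
case=> i [] [j []] //= => [/inj1 ->|/esym/n12|/n12|/inj2 ->] //.
Qed.

Section GnpBounds2.
Variables (R : realFieldType) (n : nat) (p : R).
Hypothesis p01 : 0 <= p <= 1.
Local Notation V := 'I_n.
Local Notation gr := (@graph_of_edges n).
Implicit Types (E : {set potential_edge n}) (A B D H S T X Y Z : {set V}) (x y z : V).

Let p0 : 0 <= p. Proof. by case/andP: p01. Qed.
Let p1 : 0 <= 1 - p. Proof. by rewrite subr_ge0; case/andP: p01. Qed.

Definition outside_pairs q S (l : q.-tuple (V * V)) :=
  uniq (unzip1 l ++ unzip2 l) && all (fun u => (u.1 \notin S) && (u.2 \notin S)) l.

Lemma outside_pairsP q S (l : q.-tuple (V * V)) : outside_pairs S l ->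
  forall i, ((tnth l i).1 \notin S) && ((tnth l i).2 \notin S).
Proof. by case/andP=> _ /allP lS i; exact: (lS _ (mem_tnth i l)). Qed.

Lemma matching_outside (r : rel V) q S (l : q.-tuple (V * V)) :
  matching r (~: S) l -> outside_pairs S l /\ forall i, r (tnth l i).1 (tnth l i).2.
Proof.
case/and3P=> ul /allP rl /allP Dl; split=> [|i]; last exact: rl (mem_tnth i l).
by rewrite /outside_pairs ul; apply/allP => u /Dl; rewrite !inE.
Qed.

(** For each pair, s common neighbours in S are fixed in at most k^s ways, which prescribes 2 s
    edges. All these edges join S to different vertices outside S, so the q pairs are
    independent. *)
Lemma pr_twins k s q :
  pr p (fun E => [exists S : {set V}, (#|S| <= k)%N && [exists l : q.-tuple (V * V),
     true && matching (twins (gr E) S s) (~: S) l]])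
  <= (n.+1 ^ k)%:R * ((n ^ 2)%:R ^+ q * ((k ^ s)%:R ^+ q * p ^+ (2 * s * q))).
Proof.
have b0 : 0 <= (k ^ s)%:R ^+ q * p ^+ (2 * s * q) by rewrite mulr_ge0 ?exprn_ge0.
have b1 : 0 <= (n ^ 2)%:R ^+ q * ((k ^ s)%:R ^+ q * p ^+ (2 * s * q)).
  by rewrite mulr_ge0 // exprn_ge0.
have key S (l : q.-tuple (V * V)) : (#|S| <= k)%N ->
    pr p (fun E => matching (twins (gr E) S s) (~: S) l)
    <= (k ^ s)%:R ^+ q * p ^+ (2 * s * q).
  move=> cS; have [ol|nol] := boolP (outside_pairs S l); last first.
    rewrite pr_pred0 // => E; apply: contra nol.
    by case/matching_outside.
  pose zz (u : 'I_q * bool) := if u.2 then (tnth l u.1).1 else (tnth l u.1).2.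
  have zz_inj : injective zz by apply: uniq_pairs_inj; case/andP: ol.
  have zzS u : zz u \notin S.
    by have := outside_pairsP ol u.1; rewrite /zz; case: ifP => _ /andP[].
  pose drw : {set {set V}} := [set T : {set V} | T \subset S & #|T| == s].
  apply: (@le_trans _ _ (pr p (fun E => [exists T : {ffun 'I_q -> {set V}},
      (T \in ffun_on (mem drw)) &&
      [forall u : 'I_q * bool, [forall x in T u.1, edges_adj E (zz u) x]]]))).
    apply: pr_mono => // E /matching_outside[_ tw].
    have exT i : {T : {set V} | (T \in drw) &&
       (T \subset nbr (gr E) (tnth l i).1 :&: nbr (gr E) (tnth l i).2)}.
      apply: sigW; have [T sT cT] := exists_subset_card (tw i).
      by move: sT; rewrite subsetI => /andP[sT sTS]; exists T; rewrite inE sTS cT eqxx sT.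
    apply/existsP; exists [ffun i => sval (exT i)]; apply/andP; split.
      by apply/ffun_onP => i; rewrite ffunE; case: (exT i) => ? /= /andP[].
    apply/forallP => -[i b]; apply/forall_inP => x; rewrite ffunE.
    case: (exT i) => T /= /andP[_ /subsetP sT] /sT; rewrite !inE => /andP[].
    by rewrite /zz /=; case: b.
  apply: le_trans (pr_exists_le (b := p ^+ (2 * s * q)) p01 _ _) _.
  - by rewrite exprn_ge0.
  - move=> T /ffun_onP TP.
    have TS i : T i \subset S by have := TP i; rewrite inE => /andP[].
    have cT i : #|T i| = s by have := TP i; rewrite inE => /andP[_ /eqP].
    rewrite (@eq_pr _ _ _ _ (fun E => [forall u in [set: 'I_q * bool],
       [forall x in T u.1, edges_adj E (zz u) x]])); last first.
      by move=> E; apply: eq_forallb => u; rewrite inE.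
    rewrite (@pr_forall _ _ p _ _ (fun u => star (zz u) (T u.1))).
    + rewrite (eq_bigr (fun=> p ^+ s)) => [|u _].
        rewrite prodr_const cardsT card_prod card_ord card_bool -exprM.
        by rewrite (_ : s * (q * 2) = 2 * s * q)%N //; lia.
      rewrite (@pr_forall _ _ p _ _ (fun x => star (zz u) [set x])).
      * rewrite (eq_bigr (fun=> p)) ?prodr_const ?cT // => x xT.
        by rewrite pr_adj //; apply: contraNneq (zzS u) => ->; exact: (subsetP (TS u.1)).
      * by move=> x xT; apply: depends_on_adj.
      * by move=> x x' _ _ nx; apply: star_disjointr; rewrite disjoints1 inE.
    + by move=> u _; apply: depends_on_all => x xT; apply: depends_on_adj_sub.
    + move=> u u' _ _ nu; apply: star_disjoint; first by rewrite (inj_eq zz_inj).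
      by rewrite negb_and; apply/orP; left; apply: contra (zzS u); apply/subsetP.
  rewrite ler_wpM2r ?exprn_ge0 // card_ffun_on card_ord natrX.
  rewrite lerXn2r ?nnegrE // ler_nat cards_draws.
  by apply: leq_trans (leq_bin2l _ cS) _; exact: leq_bin_exp.
apply: le_trans (pr_exists_le p01 b1 _) _ => [S cS|]; last first.
  by rewrite ler_wpM2r // ler_nat -[X in X.+1](card_ord n) card_sets_le.
apply: (le_trans (pr_exists_le (b := (k ^ s)%:R ^+ q * p ^+ (2 * s * q)) p01 b0 _)).
  by move=> l _; exact: key.
by rewrite ler_wpM2r // -natrX ler_nat card_tuple card_prod card_ord mulnn.
Qed.

Lemma pr_same_trace k q : p <= 2^-1 ->
  pr p (fun E => [exists S : {set V}, (#|S| == k) && [exists l : q.-tuple (V * V),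
     true && matching (same_trace (gr E) S) (~: S) l]])
  <= (n ^ k)%:R * ((n ^ 2)%:R ^+ q * (1 - p) ^+ (k * q)).
Proof.
move=> ph.
have b0 : 0 <= (1 - p) ^+ (k * q) by rewrite exprn_ge0.
have b1 : 0 <= (n ^ 2)%:R ^+ q * (1 - p) ^+ (k * q) by rewrite mulr_ge0 // exprn_ge0.
have key S (l : q.-tuple (V * V)) : #|S| = k ->
    pr p (fun E => matching (same_trace (gr E) S) (~: S) l) <= (1 - p) ^+ (k * q).
  move=> cS; have [ol|nol] := boolP (outside_pairs S l); last first.
    rewrite pr_pred0 // => E; apply: contra nol.
    by case/matching_outside.
  have z_inj : injective (fun u : 'I_q * bool => if u.2 then (tnth l u.1).1 else (tnth l u.1).2).
    by apply: uniq_pairs_inj; case/andP: ol.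
  pose z1 i := (tnth l i).1; pose z2 i := (tnth l i).2.
  have z1S i : z1 i \notin S by have /andP[] := outside_pairsP ol i.
  have z2S i : z2 i \notin S by have /andP[] := outside_pairsP ol i.
  have z11 i j : i != j -> z1 i != z1 j.
    by apply: contra_neq => e; have [] := z_inj (i, true) (j, true) e.
  have z22 i j : i != j -> z2 i != z2 j.
    by apply: contra_neq => e; have [] := z_inj (i, false) (j, false) e.
  have z12 i j : z1 i != z2 j.
    by apply/eqP => e; have [] := z_inj (i, true) (j, false) e.
  pose F (u : V * 'I_q) := star (z1 u.2) [set u.1] :|: star (z2 u.2) [set u.1].
  apply: (@le_trans _ _ (pr p (fun E => [forall u in setX S [set: 'I_q],
      edges_adj E (z1 u.2) u.1 == edges_adj E (z2 u.2) u.1]))).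
    apply: pr_mono => // E /matching_outside[_ tw].
    apply/forall_inP => -[x i]; rewrite !inE andbT /= => xS.
    by have /forall_inP/(_ x xS) := tw i.
  rewrite (@pr_forall _ _ p _ _ F).
  - apply: (@le_trans _ _ (\prod_(u in setX S [set: 'I_q]) (1 - p))); last first.
      by rewrite prodr_const cardsX cS cardsT card_ord.
    apply: ler_prod => -[x i]; rewrite !inE andbT /= => xS; rewrite pr_ge0 //=.
    have nz z : z \notin S -> z != x by apply: contraNneq => ->.
    have [e1 v1 E1] := edge_between (nz _ (z1S i)).
    have [e2 v2 E2] := edge_between (nz _ (z2S i)).
    rewrite (@eq_pr _ _ _ _ (fun E => (e1 \in E) == (e2 \in E))) => [|E]; last first.
      by rewrite E1 E2.
    rewrite pr_eq_in; last first.
      apply: contra_neq (z12 i i) => e12; apply: (@set2_inj _ x).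
      - by rewrite eq_sym nz.
      - by rewrite eq_sym nz.
      by rewrite ![[set x; _]]setUC -v1 -v2 e12.
    (* Two independent edges agree with probability p^2 + (1 - p)^2 = (1 - p) - p (1 - 2 p), and p
       <= 1/2. *)
    have : 0 <= p * (1 - 2 * p) by rewrite mulr_ge0 //; lra.
    by rewrite !expr2; lra.
  - move=> [x i] _ E E' eE; congr (_ == _).
      by apply: (depends_onS (subsetUl _ _) (@depends_on_adj _ (z1 i) x)) eE.
    by apply: (depends_onS (subsetUr _ _) (@depends_on_adj _ (z2 i) x)) eE.
  move=> [x i] [x' j]; rewrite !inE !andbT /= => xS x'S nu.
  have dst z z' : z \notin S -> z' \notin S -> (z != z') || (x != x') ->
      [disjoint star z [set x] & star z' [set x']].
    move=> zS z'S; case: (eqVneq z z') => [<- /= nx|nz _].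
      by apply: star_disjointr; rewrite disjoints1 inE.
    by apply: star_disjoint; rewrite // !inE negb_and; apply/orP; left;
       apply: contraNneq zS => ->.
  have nij : (i != j) || (x != x').
    by rewrite orbC -negb_and; apply: contra nu => /andP[/eqP -> /eqP ->].
  rewrite /F /= -setI_eq0 setIUl !setIUr !setU_eq0 !setI_eq0.
  rewrite !dst //; first by case/orP: nij => [/z22 ->|->]; rewrite ?orbT.
  - by rewrite eq_sym z12.
  - by rewrite z12.
  - by case/orP: nij => [/z11 ->|->]; rewrite ?orbT.
apply: le_trans (pr_exists_le p01 b1 _) _ => [S /eqP cS|]; last first.
  rewrite ler_wpM2r // ler_nat.
  have -> : #|(fun S : {set V} => #|S| == k)| = 'C(n, k).
    by rewrite -[in RHS](card_ord n) -card_draws cardsE.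
  exact: leq_bin_exp.
apply: (le_trans (pr_exists_le (b := (1 - p) ^+ (k * q)) p01 b0 _)).
  by move=> l _; exact: key.
by rewrite ler_wpM2r // -natrX ler_nat card_tuple card_prod card_ord mulnn.
Qed.

(** Here b bounds from below the probability that one x has t neighbours in one v-set. Since X and
    the sets A i are pairwise disjoint, the [m0 * r] pairs (x, i) involve disjoint stars, hence
    independent events. *)
Lemma pr_not_spreading r v t m0 b : 0 <= 1 - b ->
  b <= 'C(v, t)%:R * (p ^+ t * (1 - p) ^+ (v - t)) ->
  pr p (fun E => [exists X : {set V}, (#|X| == m0) && [exists A : {ffun 'I_r -> {set V}},
     [&& [forall i, #|A i| == v], [forall i, [forall j, (i != j) ==> [disjoint A i & A j]]]
       & [forall i, [disjoint X & A i]]] &&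
     [forall x in X, [forall i, (#|nbr (gr E) x :&: A i| < t)%N]]]])
  <= (n ^ m0)%:R * ((n ^ v)%:R ^+ r * (1 - b) ^+ (m0 * r)).
Proof.
move=> b_le1 b_le.
have b0 : 0 <= (1 - b) ^+ (m0 * r) by rewrite exprn_ge0.
have b1 : 0 <= (n ^ v)%:R ^+ r * (1 - b) ^+ (m0 * r) by rewrite mulr_ge0 // exprn_ge0.
apply: le_trans (pr_exists_le p01 b1 _) _ => [X /eqP cX|]; last first.
  rewrite ler_wpM2r // ler_nat.
  have -> : #|(fun S : {set V} => #|S| == m0)| = 'C(n, m0).
    by rewrite -[in RHS](card_ord n) -card_draws cardsE.
  exact: leq_bin_exp.
apply: le_trans (pr_exists_le p01 b0 _) _ => [A /and3P[/forallP cA /forallP dA /forallP dXA]|]; last first.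
  rewrite ler_wpM2r // -natrX ler_nat.
  pose drw : {set {set V}} := [set T : {set V} | T \subset [set: V] & #|T| == v].
  apply: (@leq_trans #|(ffun_on (mem drw) : simpl_pred {ffun 'I_r -> {set V}})|).
    apply: subset_leq_card; apply/subsetP => A /and3P[/forallP cA _ _].
    by apply/ffun_onP => i; rewrite inE subsetT cA.
  rewrite card_ffun_on card_ord cards_draws cardsT card_ord.
  by case: (r) => // r'; rewrite leq_exp2r // leq_bin_exp.
have xA x i : x \in X -> x \notin A i.
  by move=> xX; apply/negP => xi; move/pred0P/(_ x): (dXA i); rewrite /= xX xi.
rewrite (@eq_pr _ _ _ _ (fun E => [forall u in setX X [set: 'I_r],
    predC (fun E => t <= #|E :&: star u.1 (A u.2)|)%N E])); last first.
  move=> E; apply/forall_inP/forall_inP => [H [x i]|H x xX].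
    rewrite !inE andbT /= => xX; rewrite card_star_adj ?xA // -ltnNge.
    move/forallP/(_ i): (H x xX); congr (_ < _)%N; apply: eq_card => z.
    by rewrite !inE andbC.
  apply/forallP => i; have := H (x, i); rewrite !inE xX /= => /(_ isT).
  rewrite card_star_adj ?xA // -ltnNge; congr (_ < _)%N; apply: eq_card => z.
  by rewrite !inE andbC.
rewrite (@pr_forall _ _ p _ _ (fun u => star u.1 (A u.2))).
- apply: (@le_trans _ _ (\prod_(u in setX X [set: 'I_r]) (1 - b))); last first.
    by rewrite prodr_const cardsX cX cardsT card_ord.
  apply: ler_prod => -[x i]; rewrite !inE andbT /= => xX; rewrite pr_ge0 //= prC lerD2l lerN2.
  apply: le_trans b_le _; rewrite -(eqP (cA i)) -(card_star (xA x i xX)).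
  exact: pr_card_ge.
- move=> u _ E E' eE; congr (~~ (_ <= _)%N).
  by congr #|pred_of_set _|.
move=> [x i] [x' j]; rewrite !inE !andbT /= => xX x'X nu.
have [exx|nx] := eqVneq x x'; last first.
  by apply: star_disjoint => //; rewrite negb_and xA.
rewrite -exx; apply: star_disjointr.
move/forallP/(_ j)/implyP: (dA i); apply; apply: contra nu => /eqP ->.
by rewrite exx.
Qed.

Lemma pr_card_ge_le (T : finType) (F : {set T}) q :
  pr p (fun E : {set T} => q <= #|E :&: F|)%N <= 'C(#|F|, q)%:R * p ^+ q.
Proof.
apply: (@le_trans _ _ (pr p (fun E : {set T} => [exists B : {set T},
    ((B \subset F) && (#|B| == q)) && (B \subset E)]))).
  apply: pr_mono => // E /exists_subset_card[B]; rewrite subsetI => /andP[BE BF] cB.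
  by apply/existsP; exists B; rewrite BF cB eqxx BE.
apply: le_trans (pr_exists_le (b := p ^+ q) p01 _ _) _.
- by rewrite exprn_ge0.
- by move=> B /andP[_ /eqP <-]; rewrite pr_subset.
by rewrite ler_wpM2r ?exprn_ge0 // ler_nat -cardsE cards_draws.
Qed.

Definition inner H : {set potential_edge n} := [set e : potential_edge n | val e \subset H].

Lemma card_inner H : (#|inner H| <= 'C(#|H|, 2))%N.
Proof.
rewrite -cards_draws -(card_imset _ val_inj); apply: subset_leq_card.
by apply/subsetP => B /imsetP[e]; rewrite !inE => eH ->; rewrite eH (valP e).
Qed.

Lemma sum_degree_le E H :
  (\sum_(y in H) #|nbr (gr E) y :&: H| <= 2 * #|E :&: inner H|)%N.
Proof.
pose P := [set u : V * V | [&& u.1 \in H, u.2 \in H & edges_adj E u.1 u.2]].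
have -> : (\sum_(y in H) #|nbr (gr E) y :&: H| = #|P|)%N.
  rewrite -sum1_card (eq_bigr (fun y => \sum_(z in H | edges_adj E y z) 1%N)) => [|y yH].
    rewrite pair_big_dep; apply: eq_bigl => -[y z].
    by rewrite inE /= andbA.
  by rewrite -sum1_card; apply: eq_bigl => z; rewrite !inE andbC.
have sub : P \subset \bigcup_(e in E :&: inner H) [set u | [set u.1; u.2] == val e].
  apply/subsetP => -[y z]; rewrite inE /= => /and3P[yH zH /existsP[e /andP[eE /eqP ee]]].
  apply/bigcupP; exists e; last by rewrite inE /= ee.
  by rewrite !inE eE ee subUset !sub1set yH zH.
apply: leq_trans (subset_leq_card sub) _; rewrite mulnC.
apply: leq_card_bigcup => // e _.
have /cards2P[a [b [ab vab]]] := valP e.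
apply: (@leq_trans #|[set (a, b); (b, a)]|); last by rewrite cards2; case: (_ != _).
apply: subset_leq_card; apply/subsetP => -[y z]; rewrite vab !inE /= => /eqP yz.
have : y \in [set a; b] by rewrite -yz !inE eqxx.
have : z \in [set a; b] by rewrite -yz !inE eqxx orbT.
have : a \in [set y; z] by rewrite yz !inE eqxx.
have : b \in [set y; z] by rewrite yz !inE eqxx orbT.
rewrite !inE !xpair_eqE.
by do 4!(case/orP => /eqP ?); subst; rewrite ?eqxx ?orbT // in ab *.
Qed.

(** Minimum degree above 2 j forces at least j #|H| edges among the pairs inside H. *)
Lemma pr_min_degree j M :
  pr p (fun E => [exists H : {set V}, ((H != set0) && (#|H| <= M)%N) &&
     [forall y in H, (2 * j < #|nbr (gr E) y :&: H|)%N]])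
  <= \sum_(1 <= m < M.+1) 'C(n, m)%:R * ('C('C(m, 2), m * j)%:R * p ^+ (m * j)).
Proof.
pose g m : R := 'C('C(m, 2), m * j)%:R * p ^+ (m * j).
have g0 m : 0 <= g m by rewrite mulr_ge0 ?exprn_ge0.
have key H : pr p (fun E => [forall y in H, (2 * j < #|nbr (gr E) y :&: H|)%N]) <= g #|H|.
  apply: (@le_trans _ _ (pr p (fun E => #|H| * j <= #|E :&: inner H|)%N)).
    apply: pr_mono => // E /forall_inP deg.
    rewrite -(leq_pmul2l (isT : 0 < 2)%N); apply: leq_trans (sum_degree_le E H).
    rewrite mulnCA -sum_nat_const; apply: leq_sum => y yH.
    exact: ltnW (deg y yH).
  apply: le_trans (pr_card_ge_le _ _) _; rewrite /g ler_wpM2r ?exprn_ge0 // ler_nat.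
  exact/leq_bin2l/card_inner.
apply: (le_trans (pr_exists p01 _ _)).
apply: (@le_trans _ _ (\sum_(H : {set V} | (H != set0) && (#|H| <= M)%N) g #|H|)).
  by apply: ler_sum => H _; exact: key.
(* The sets H are sorted by their size m. *)
under eq_bigr => H /andP[H0 HM].
  rewrite (_ : g #|H| = \sum_(1 <= m < M.+1 | m == #|H|) g m); last first.
    by rewrite big_nat1_eq card_gt0 H0 ltnS HM.
  over.
under eq_bigr do rewrite big_mkcond.
rewrite exchange_big /=; apply: ler_sum => m _.
rewrite -big_mkcondr /= sumr_const -[X in X <= _]mulr_natl ler_wpM2r // ler_nat.
have <- : #|[set H : {set V} | #|H| == m]| = 'C(n, m).
  by rewrite -[in RHS](card_ord n) -card_draws.
by apply: subset_leq_card; apply/subsetP => H /andP[_ /eqP mH]; rewrite inE -mH.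
Qed.

Lemma sum_degree_ge E : (#|E| <= \sum_x #|nbr (gr E) x|)%N.
Proof.
have -> : (\sum_x #|nbr (gr E) x| = #|[set u : V * V | edges_adj E u.1 u.2]|)%N.
  rewrite -[RHS]sum1_card (eq_bigr (fun y => \sum_(z | edges_adj E y z) 1%N)) => [|y _].
    by rewrite pair_big_dep; apply: eq_bigl => -[y z]; rewrite inE.
  by rewrite -sum1_card; apply: eq_bigl => z; rewrite !inE.
rewrite -(card_imset (mem E) val_inj).
apply: leq_trans (leq_imset_card (fun u : V * V => [set u.1; u.2]) _).
apply: subset_leq_card; apply/subsetP => B /imsetP[e eE ->].
have /cards2P[a [b [ab vab]]] := valP e.
apply/imsetP; exists (a, b) => //; rewrite inE; apply/existsP.
by exists e; rewrite eE vab eqxx.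
Qed.

(** For fixed y and S the other vertices are independent. As p <= 1/2, non-adjacency to y is at
    least as likely as adjacency, so p (1 - p)^k is a lower bound for both values of b. *)
Lemma pr_no_empty_trace (b : bool) k : p <= 2^-1 -> (k < n)%N ->
  pr p (fun E => [exists S : {set V}, (#|S| <= k)%N && [exists y, (y \notin S) &&
     [forall z in ~: (y |: S), ~~ ((edges_adj E z y == b) &&
        [forall x in S, ~~ edges_adj E z x])]]])
  <= (n.+1 ^ k)%:R * (n%:R * (1 - p * (1 - p) ^+ k) ^+ (n - k.+1)).
Proof.
move=> ph kn.
have p2 : 0 <= p * (1 - p) ^+ k <= 1.
  rewrite mulr_ge0 ?exprn_ge0 //= mulr_ile1 ?exprn_ge0 ?exprn_ile1 //; move: p0 ph => *; lra.
have b0 : 0 <= (1 - p * (1 - p) ^+ k) ^+ (n - k.+1).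
  by rewrite exprn_ge0 // subr_ge0; case/andP: p2.
have b1 : 0 <= n%:R * (1 - p * (1 - p) ^+ k) ^+ (n - k.+1) by rewrite mulr_ge0.
apply: le_trans (pr_exists_le p01 b1 _) _ => [S cS|]; last first.
  by rewrite ler_wpM2r // ler_nat -[X in X.+1](card_ord n) card_sets_le.
apply: le_trans (pr_exists_le p01 b0 _) _ => [y yS|]; last first.
  by rewrite ler_wpM2r // ler_nat; apply: leq_trans (max_card _) _; rewrite card_ord.
have dadj z X : y \in X -> depends_on (star z X) (fun E => edges_adj E z y == b).
  by move=> yX E E' eE; congr (_ == b); apply: (depends_on_adj_sub yX) eE.
rewrite (@pr_forall _ _ p _ _ (fun z => star z (y |: S))).
- apply: (@le_trans _ _ (\prod_(z in ~: (y |: S)) (1 - p * (1 - p) ^+ k))).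
    apply: ler_prod => z; rewrite !inE negb_or => /andP[zy zS]; rewrite pr_ge0 //=.
    rewrite -[X in X <= _]/(pr p (predC (fun E => (edges_adj E z y == b) && [forall x in S, ~~ edges_adj E z x]))).
    rewrite prC lerD2l lerN2 (@pr_and_nadj _ _ p (fun E => edges_adj E z y == b) y) //; last first.
      by apply: dadj; rewrite inE.
    apply: ler_pM; rewrite ?exprn_ge0 //; last first.
      by apply: ler_wiXn2l => //; move: p0 => *; lra.
    case: b {dadj} => /=.
      by rewrite (@eq_pr _ _ _ _ (fun E => edges_adj E z y)) ?pr_adj // => E; rewrite eqb_id.
    rewrite (@eq_pr _ _ _ _ (fun E => ~~ edges_adj E z y)) ?pr_nadj //; lra.
  rewrite prodr_const; apply: ler_wiXn2l; first by rewrite subr_ge0; case/andP: p2.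
    by rewrite lerBlDr lerDl; case/andP: p2.
  rewrite -(leq_add2l #|y |: S|) cardsC card_ord addnBA //.
  rewrite leq_subLR leq_add2r; apply: leq_trans (leq_card_setU _ _).1 _.
  by rewrite cards1 add1n ltnS.
- move=> z zS; apply: depends_onC; apply: depends_on_and.
    by apply: dadj; rewrite !inE eqxx.
  by apply: depends_on_all => x xS; apply: depends_onC; apply: depends_on_adj_sub; rewrite !inE xS orbT.
by move=> z z' zS zS'; apply: star_disjoint_out; rewrite -in_setC.
Qed.

End GnpBounds2.

From mathcomp Require Import all_classical all_reals all_analysis.

Import Order.TTheory GRing.Theory Num.Theory.
Import numFieldNormedType.Exports.

Local Open Scope classical_set_scope.
Local Open Scope ring_scope.

(** * Numerical estimates *)

Section RealEstimates.
Variable R : realType.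
Implicit Types (a c x y : R) (n k q t v m : nat).

Lemma expR1_ge2 : 2 <= expR 1 :> R.
Proof. by have := expR_ge1Dx (1 : R); lra. Qed.

(** From 5/6 <= e^(-1/6) and (6/5)^6 < 3. *)
Lemma expR1_le3 : expR 1 <= 3 :> R.
Proof.
have h : 5 / 6 <= expR (- (1 / 6)) :> R by have := expR_ge1Dx (- (1 / 6) : R); lra.
have ue : expR (- (1 / 6)) ^+ 6 * expR 1 = 1 :> R.
  by rewrite -expRM_natl -expRD -[RHS]expR0; congr expR; field.
have hu : (5 / 6) ^+ 6 <= expR (- (1 / 6)) ^+ 6 :> R.
  by rewrite lerXn2r ?nnegrE ?expR_ge0 //; lra.
have := ler_wpM2r (expR_ge0 (1 : R)) hu; rewrite ue; lra.
Qed.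

Lemma onesub_le_expR x : 1 - x <= expR (- x).
Proof. exact: expR_ge1Dx. Qed.

Lemma onesubX_le x m : x <= 1 -> (1 - x) ^+ m <= expR (- (x * m%:R)).
Proof.
move=> x1; rewrite -mulNr expRM_natr; apply: lerXn2r; rewrite ?nnegrE ?expR_ge0 ?subr_ge0 //.
exact: onesub_le_expR.
Qed.

Lemma onesub_ge_expR x : 0 <= x <= 2^-1 -> expR (- (2 * x)) <= 1 - x.
Proof.
move=> /andP[x0 xh]; rewrite expRN -div1r ler_pdivrMr ?expR_gt0 //.
apply: (@le_trans _ _ ((1 - x) * (1 + 2 * x))); last first.
  by rewrite ler_wpM2l ?expR_ge1Dx //; lra.
have : 0 <= x * (1 - 2 * x) by apply: mulr_ge0 => //; lra.
lra.
Qed.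

Lemma onesubX_ge x m : 0 <= x <= 2^-1 -> expR (- (2 * x * m%:R)) <= (1 - x) ^+ m.
Proof.
move=> x01; rewrite -mulNr expRM_natr; apply: lerXn2r; rewrite ?nnegrE ?expR_ge0 //.
  by case/andP: x01 => _; lra.
exact: onesub_ge_expR.
Qed.

Lemma exp_fact q : (q%:R : R) ^+ q <= q`!%:R * expR 1 ^+ q.
Proof.
case: q => [|q]; first by rewrite !expr0 mulr1 fact0.
have f0 : 0 < (q.+1)`!%:R :> R by rewrite ltr0n fact_gt0.
rewrite mulrC -ler_pdivrMr // -expRM_natr mul1r.
by apply: le_trans (expR_ge1Dxn q (ler0n R q.+1)); rewrite lerDr.
Qed.

Lemma bin_exp_le n q a : 0 <= a ->
  'C(n, q)%:R * a ^+ q <= (expR 1 * n%:R * a / q%:R) ^+ q.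
Proof.
move=> a0; case: q => [|q]; first by rewrite bin0 !expr0 mulr1.
rewrite expr_div_n ler_pdivlMr ?exprn_gt0 ?ltr0n // mulrAC exprMn.
rewrite ler_wpM2r ?exprn_ge0 // mulrC exprMn.
apply: (@le_trans _ _ ((q.+1)`!%:R * expR 1 ^+ q.+1 * 'C(n, q.+1)%:R)).
  by rewrite ler_wpM2r // exp_fact.
rewrite [leLHS](_ : _ = expR 1 ^+ q.+1 * ('C(n, q.+1) * (q.+1)`!)%:R); last first.
  by rewrite natrM; ring.
rewrite bin_ffact ler_wpM2l ?exprn_ge0 ?expR_ge0 // -natrX ler_nat.
by elim: (q.+1) => // s IHs; rewrite ffactnSr expnSr leq_mul // leq_subr.
Qed.

(** The number n a is the mean of a binomial count. Once q exceeds e n a by a factor e^c, the union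
    bound over q-sets gains e^(-c) per element. *)
Lemma bin_tail n q a c : 0 <= a -> expR 1 * n%:R * a <= q%:R * expR (- c) ->
  'C(n, q)%:R * a ^+ q <= expR (- (c * q%:R)).
Proof.
move=> a0 h; apply: (le_trans (bin_exp_le _ _ a0)).
case: q h => [|q] h; first by rewrite expr0 mulr0 oppr0 expR0.
rewrite -mulNr expRM_natr; apply: lerXn2r; rewrite ?nnegrE ?divr_ge0 ?mulr_ge0 ?expR_ge0 //.
by rewrite ler_pdivrMr ?ltr0n // [leRHS]mulrC.
Qed.

Lemma bin_ge v t : (0 < t <= v)%N -> (v%:R / t%:R : R) ^+ t <= 'C(v, t)%:R.
Proof.
move=> /andP[t0 tv]; rewrite expr_div_n ler_pdivrMr ?exprn_gt0 ?ltr0n //.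
rewrite -!natrX -natrM ler_nat mulnC {t0}.
elim: t v tv => [|t IHt] [|v] // tv.
have [->|t0] := posnP t; first by rewrite !expn1 bin1 mul1n.
(* Since t <= v, the ratio (v + 1) / (t + 1) is at most v / t, and the induction hypothesis
   applies. *)
have key : (v.+1 ^ t <= t.+1 ^ t * 'C(v, t))%N.
  rewrite -(@leq_pmul2l (t ^ t)) ?expn_gt0 ?t0 //.
  apply: (@leq_trans (t.+1 ^ t * v ^ t)); first by rewrite -!expnMn leq_exp2r //; lia.
  by rewrite [leqRHS]mulnCA leq_mul2l IHt ?orbT.
by rewrite expnS expnSr -mulnA -mul_bin_diag mulnCA leq_mul2l key orbT.
Qed.

Lemma natr_expR n k : (0 < n)%N -> (n%:R : R) ^+ k = expR (k%:R * ln n%:R).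
Proof. by move=> n0; rewrite expRM_natl lnK // posrE ltr0n. Qed.

Lemma natrS_expR n k : (1 < n)%N -> (n.+1 ^ k)%:R <= expR (2 * k%:R * ln n%:R) :> R.
Proof.
move=> n1; rewrite -mulrA mulrCA mulrC expRM_natr natrX; apply: lerXn2r; rewrite ?nnegrE ?expR_ge0 //.
by rewrite -natr_expR ?(ltnW n1) // -natrX ler_nat; nia.
Qed.

End RealEstimates.

(** * Upper bounds when [w] is a power of [n] *)

Section EasyUpperBounds.
Variables (R : realType) (n : nat) (p : R).
Hypothesis p0h : 0 <= p <= 2^-1.
Local Notation gr := (@graph_of_edges n).
Local Notation L := (ln (n%:R : R)).

Let p0 : 0 <= p. Proof. by case/andP: p0h. Qed.
Let p01 : 0 <= p <= 1.
Proof. by case/andP: p0h => -> h; rewrite (le_trans h) // invf_le1 ?ler1n. Qed.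

Lemma sum_nat_half N :
  \sum_(1 <= m < N.+1) m%:R / 2 ^+ m = 2 - (N + 2)%:R / 2 ^+ N :> R.
Proof.
elim: N => [|N IHN]; first by rewrite big_geq // expr0; lra.
rewrite big_nat_recr //= IHN !exprS; field.
by rewrite expf_neq0.
Qed.

(** Up to e <= 3, [rho] is the base in the binomial tail. It is at most 1 by the first bound, so 2 m
    of its m j factors are kept; together with (3 n / m)^m for the choice of the set they give at
    most (m / (2 M))^m by the second bound. This is at most (m / M) / 2^m, and the sum of m / 2^m
    stays below 2. *)
Lemma min_degree_sum M j : (0 < M)%N -> (2 <= j)%N -> 3 * M%:R * p <= 2 * j%:R ->
  27 * n%:R * p ^+ 2 * M%:R <= 2 * j%:R ^+ 2 ->
  \sum_(1 <= m < M.+1) 'C(n, m)%:R * ('C('C(m, 2), m * j)%:R * p ^+ (m * j)) <= 2 / M%:R :> R.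
Proof.
move=> M0 j2 hM hn.
have Mp : 0 < M%:R :> R by rewrite ltr0n.
have jp : 0 < j%:R :> R by rewrite ltr0n (leq_trans _ j2).
apply: (@le_trans _ _ (\sum_(1 <= m < M.+1) m%:R / 2 ^+ m / M%:R)); last first.
  rewrite -mulr_suml sum_nat_half ler_wpM2r ?invr_ge0 ?(ltW Mp) //.
  by rewrite gerBl divr_ge0 // exprn_ge0.
rewrite big_nat_cond [leRHS]big_nat_cond; apply: ler_sum => m /andP[/andP[m0 mM] _].
have mp : 0 < m%:R :> R by rewrite ltr0n.
have mMr : m%:R <= M%:R :> R by rewrite ler_nat.
set rho := 3 * m%:R * p / (2 * j%:R).
have rho0 : 0 <= rho by rewrite divr_ge0 // ?mulr_ge0 //.
have rho1 : rho <= 1.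
  rewrite ler_pdivrMr ?mulr_gt0 // mul1r (le_trans _ hM) // ler_wpM2r //.
  by rewrite ler_wpM2l.
have e3 := expR1_le3 R.
have b1 : 'C('C(m, 2), m * j)%:R * p ^+ (m * j) <= rho ^+ 2 ^+ m.
  apply: (le_trans (bin_exp_le _ _ p0)).
  apply: (@le_trans _ _ (rho ^+ (m * j))); last first.
    by rewrite -exprM ler_wiXn2l // mulnC leq_mul2l j2 orbT.
  apply: lerXn2r; rewrite ?nnegrE ?divr_ge0 ?mulr_ge0 ?expR_ge0 //.
  rewrite ler_pdivrMr ?ltr0n ?muln_gt0 ?m0 ?(leq_trans _ j2) //.
  have -> : rho * (m * j)%:R = 3 * (m%:R ^+ 2 / 2) * p.
    by rewrite /rho natrM; field; rewrite gt_eqF.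
  rewrite ler_wpM2r // ler_pM ?expR_ge0 // ler_pdivlMr // -natrX -natrM ler_nat.
  by rewrite mulnC -(mul_bin_diag m 1) bin1 leq_mul // leq_pred.
have b2 : 'C(n, m)%:R <= (3 * n%:R / m%:R) ^+ m :> R.
  have := bin_exp_le n m (ler01 : 0 <= 1 :> R); rewrite expr1n !mulr1 => /le_trans; apply.
  apply: lerXn2r; rewrite ?nnegrE ?divr_ge0 ?mulr_ge0 ?expR_ge0 //.
  by rewrite ler_wpM2r ?invr_ge0 // ler_wpM2r.
apply: (@le_trans _ _ ((m%:R / (2 * M%:R)) ^+ m)).
  apply: (@le_trans _ _ ((3 * n%:R / m%:R) ^+ m * rho ^+ 2 ^+ m)).
    by rewrite ler_pM // mulr_ge0 ?exprn_ge0.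
  rewrite -exprMn; apply: lerXn2r; rewrite ?nnegrE ?mulr_ge0 ?invr_ge0 ?exprn_ge0 //.
  have -> : 3 * n%:R / m%:R * rho ^+ 2 = 27 * n%:R * p ^+ 2 * M%:R * (m%:R / (4 * j%:R ^+ 2 * M%:R)).
    by rewrite /rho; field; rewrite !gt_eqF.
  apply: le_trans (ler_wpM2r _ hn) _; first by rewrite divr_ge0 ?mulr_ge0 ?exprn_ge0.
  by rewrite le_eqVlt; apply/orP; left; apply/eqP; field; rewrite !gt_eqF.
have -> : m%:R / (2 * M%:R) = m%:R / M%:R * 2^-1 :> R by field; rewrite gt_eqF.
rewrite exprMn exprVn [leRHS]mulrAC ler_wpM2r ?invr_ge0 ?exprn_ge0 //.
rewrite -[leRHS]expr1 ler_wiXn2l ?divr_ge0 //.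
by rewrite ler_pdivrMr // mul1r.
Qed.

(** This is [min_degree_sum] at M = n, where 27 (n p)^2 <= 27 j^2 / 16 <= 2 j^2. *)
Lemma functionality_sparse j : (0 < n)%N -> (2 <= j)%N -> 4 * n%:R * p <= j%:R ->
  pr p (fun E => (2 * j < functionality (gr E))%N) <= 2 / n%:R.
Proof.
move=> n0 j2 hj; have np0 : 0 <= n%:R * p by rewrite mulr_ge0.
apply: le_trans (min_degree_sum (M := n) n0 j2 _ _); first last.
- have : (4 * n%:R * p) ^+ 2 <= j%:R ^+ 2.
    by apply: lerXn2r; rewrite ?nnegrE ?mulr_ge0.
  have -> : (4 * n%:R * p) ^+ 2 = 16 * (n%:R * p) ^+ 2 by ring.
  have -> : 27 * n%:R * p ^+ 2 * n%:R = 27 * (n%:R * p) ^+ 2 by ring.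
  by have := exprn_ge0 2 np0; lra.
- by lra.
apply: le_trans _ (pr_min_degree n p01 j n); apply: pr_mono => // E.
rewrite ltnNge; apply: contraR => /existsPn nH.
apply: functionality_le_degenerate => H H0; have := nH H.
rewrite H0 (leq_trans (max_card _)) ?card_ord //= => /forall_inPn[y yH].
by rewrite -leqNgt => yj; exists y.
Qed.

(** The choice of S costs K L and that of K pairs 2 K L, while (1 - p)^(K^2) gains p K^2 >= 5 K
    L. *)
Lemma functionality_dense K : (1 < n)%N -> (0 < K)%N -> 5 * L <= p * K%:R ->
  pr p (fun E => (3 * K < functionality (gr E))%N) <= expR (- L).
Proof.
move=> n1 K0 hK; have n0 := ltnW n1.
have L0 : 0 <= L by rewrite ln_ge0 // ler1n.
have K1 : 1 <= K%:R :> R by rewrite ler1n.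
apply: (@le_trans _ _ (pr p (fun E => [exists S : {set 'I_n}, (#|S| == K) &&
   [exists l : K.-tuple ('I_n * 'I_n), true && matching (same_trace (gr E) S) (~: S)%SET l]]))).
  apply: pr_mono => // E; rewrite ltnNge; apply: contraR => /existsPn nS.
  have -> : (3 * K = K + 2 * K)%N by lia.
  apply: functionality_le_separating => S l cS sl; have := nS S.
  rewrite cS eqxx /= => /existsPn/(_ (Tuple (introT eqP sl))).
  by rewrite /=.
apply: (le_trans (pr_same_trace n p01 K K _)); first by case/andP: p0h.
rewrite natrX natr_expR // -natrX -expnM natrX natr_expR //.
apply: le_trans (ler_wpM2l (expR_ge0 _) (ler_wpM2l (expR_ge0 _) (onesubX_le _ _))) _.
  by case/andP: p01.
rewrite -!expRD ler_expR natrM natrM.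
have : 5 * L * K%:R <= p * K%:R * K%:R by rewrite ler_wpM2r.
have : L <= L * K%:R by rewrite ler_peMr.
by rewrite mulrA; lra.
Qed.

End EasyUpperBounds.

(** * Lower bounds *)

Section LowerBounds.
Variable R : realType.
Implicit Types (p w : R) (n : nat).
Local Notation gr := (@graph_of_edges _).

Lemma ln_natr_gt0 n : 0 < ln (n%:R : R) -> (1 < n)%N.
Proof.
move=> L0; rewrite ltnNge; apply/negP => n1.
by have := ln_le0 (_ : n%:R <= 1 :> R); rewrite lern1 => /(_ n1); rewrite leNgt L0.
Qed.

Lemma expR_ln_natr n : (0 < n)%N -> expR (ln n%:R) = n%:R :> R.
Proof. by move=> n0; rewrite lnK // posrE ltr0n. Qed.

(** This is 1 + y <= e^y at y = (ln n) / 4. The fourth power leaves one factor ln n over the cubes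
    of ln n that occur in the lower bounds. *)
Lemma ln_pow4_le n : (0 < n)%N -> ln (n%:R : R) ^+ 4 / 256 <= n%:R.
Proof.
move=> n0; have L0 : 0 <= ln (n%:R : R) by rewrite ln_ge0 // ler1n.
rewrite [leRHS](_ : _ = expR (ln (n%:R : R) / 4) ^+ 4); last first.
  by rewrite -expRM_natl mulrC divfK // expR_ln_natr.
have -> : ln (n%:R : R) ^+ 4 / 256 = (ln n%:R / 4) ^+ 4 by field.
apply: lerXn2r; rewrite ?nnegrE ?expR_ge0 ?divr_ge0 //.
by apply: le_trans (expR_ge1Dx _); rewrite lerDr.
Qed.

(** Exponential Markov inequality with a factor 1/e <= 1/2 per edge: each potential edge contributes
    at most 1 - p / 2, and there are at least n^2 / 4 of them. *)
Lemma pr_few_edges n p a : 0 <= p <= 1 -> (1 < n)%N ->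
  pr p (fun E : {set potential_edge n} => #|E|%:R <= a)
  <= expR (a - p * n%:R ^+ 2 / 8).
Proof.
move=> /andP[p0 p1] n1; have p01 : 0 <= p <= 1 by rewrite p0.
have eN1 : expR (-1) <= 2^-1 :> R.
  by rewrite expRN lef_pV2 ?posrE ?expR_gt0 // expR1_ge2.
apply: (@le_trans _ _ (expR a * \sum_(E : {set potential_edge n})
    bern_weight p E * expR (-1) ^+ #|E|)).
  rewrite mulr_sumr /pr big_mkcond; apply: ler_sum => E _.
  have b0 := bern_weight_ge0 p01 E.
  case: ifPn => [Ea|_]; last by rewrite mulr_ge0 ?mulr_ge0 ?exprn_ge0 ?expR_ge0.
  rewrite -expRM_natl mulrCA -expRD ler_peMr // -[leLHS]expR0 ler_expR; lra.
rewrite pr_mgf; set N := #|_|.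
have cN : n%:R ^+ 2 / 4 <= N%:R :> R.
  have -> : N = 'C(n, 2).
    by rewrite /N card_sig -[in RHS](card_ord n) -card_draws; apply: eq_card => e; rewrite !inE.
  have h : (n ^ 2 <= 4 * 'C(n, 2))%N.
    have := mul_bin_diag n 1; rewrite bin1 => hd; rewrite expnS expn1; move: n1 hd; case: (n) => //= k; nia.
  by rewrite ler_pdivrMr // -natrX -natrM ler_nat mulnC.
rewrite expRD ler_wpM2l ?expR_ge0 //.
apply: (@le_trans _ _ ((1 - p / 2) ^+ N)).
  have q0 : 0 <= p * expR (-1) by rewrite mulr_ge0 ?expR_ge0.
  have q1 := ler_wpM2l p0 eN1.
  by apply: lerXn2r; rewrite ?nnegrE; lra.
apply: le_trans (onesubX_le _ _) _; first by lra.
rewrite ler_expR lerN2.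
have := ler_wpM2l p0 cN; lra.
Qed.

(** [dense_subgraph] at d = n p / 32 gives H of minimum degree at least n p / 64 and degree sum at
    least n^2 p / 32, so #|H| D is at least n^2 p / 32 and H is large enough for
    [determines_card_nbr]. If #|S| were at most [kap], that lemma would bound the degree of y by kap
    (9 L / x) = 9 * 10^-4 n p, less than n p / 64. *)
Lemma lower_bound_sparse_det n (p x L : R) (E : {set potential_edge n}) D t :
  0 < L -> 1 <= x -> x <= 3 * L -> 0 < p -> (0 < n)%N ->
  n%:R ^+ 2 * p / 16 < #|E|%:R ->
  (forall y, #|nbr (gr E) y| <= D)%N ->
  (forall y z, y != z -> #|nbr (gr E) y :&: nbr (gr E) z|%SET <= t)%N ->
  t%:R <= 6 * L / x ->
  (10^-4 * (n%:R * p * x / L) + 1) * D.+1%:R * D%:R < n%:R ^+ 2 * p / 32 ->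
  10^-4 * (n%:R * p * x / L) <= (functionality (gr E))%:R.
Proof.
move=> L0 x1 xL p0 n0 Ea deg cod tx small; rewrite leNgt; apply/negP => flt.
set kap := 10^-4 * _ in small flt *; set f := functionality _ in flt *.
have np0 : 0 < n%:R * p by rewrite mulr_gt0 // ltr0n.
have [|H [Hdeg Hsum]] := @dense_subgraph _ (gr E) R (n%:R * p / 32).
  by rewrite divr_ge0 ?ltW.
have HD : n%:R ^+ 2 * p / 32 <= #|H|%:R * D%:R.
  apply: (@le_trans _ _ (\sum_(y in H) #|nbr (gr E) y :&: H|%SET%:R)); last first.
    rewrite mulr_natl -sumr_const; apply: ler_sum => y _; rewrite ler_nat.
    by apply: leq_trans (deg y); exact/subset_leq_card/subsetIl.
  apply: le_trans Hsum; rewrite card_ord.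
  have : #|E|%:R <= \sum_y #|nbr (gr E) y|%:R :> R.
    by rewrite -natr_sum ler_nat sum_degree_ge.
  have -> : n%:R * p / 32 * n%:R = n%:R ^+ 2 * p / 32 by field.
  by move: Ea; lra.
have big m : m%:R <= kap -> (m.+1 * D.+1 < #|H|)%N.
  move=> mk; rewrite -(ltr_nat R); have [D0|D0] := posnP D.
    have : 0 < n%:R ^+ 2 * p / 32 by rewrite divr_gt0 // mulr_gt0 // exprn_gt0 // ltr0n.
    by move: HD; rewrite D0 mulr0; lra.
  have Dp : 0 < D%:R :> R by rewrite ltr0n.
  rewrite -(ltr_pM2r Dp); apply: lt_le_trans HD; apply: le_lt_trans small.
  rewrite natrM ler_wpM2r ?ler0n // ler_wpM2r ?ler0n //.
  by rewrite -addn1 natrD lerD2r.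
have : (f < f)%N; last by rewrite ltnn.
have fH : (f.+1 <= #|H|)%N.
  by apply: ltnW; apply: leq_ltn_trans (big f (ltW flt)); rewrite leq_pmulr.
apply: (functionality_ge (H := H)) => //; first by rewrite -card_gt0 (leq_trans _ fH).
move=> y S yH sS yS det; rewrite ltnNge; apply/negP => Sf.
have Sk : #|S|%:R <= kap by rewrite (le_trans _ (ltW flt)) // ler_nat.
have := determines_card_nbr yH yS det cod deg (big _ Sk).
rewrite -(ler_nat R) natrM -addn1 natrD => h1.
have h2 := Hdeg y yH.
have t1 : t%:R + 1 <= 9 * L / x.
  apply: le_trans (lerD tx (_ : 1 <= 3 * L / x)) _; first by rewrite ler_pdivlMr ?mul1r //; lra.
  by rewrite -mulrDl ler_wpM2r ?invr_ge0 ?(le_trans ler01) //; move: L0; clear; lra.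
have : #|S|%:R * (t%:R + 1) <= kap * (9 * L / x) by apply: ler_pM.
have -> : kap * (9 * L / x) = 9 * 10^-4 * (n%:R * p).
  by rewrite /kap; field; rewrite !gt_eqF //; lra.
by move: h1 h2 np0; lra.
Qed.

Lemma truncn_bounds (y : R) : 0 <= y ->
  (Num.truncn y)%:R <= y /\ y < (Num.truncn y)%:R + 1.
Proof. by move=> /truncn_itv/andP[h1 h2]; rewrite -natr1 in h2. Qed.

Lemma lower_bound_sparse (c0 : R) : 0 < c0 -> exists K : R, forall n p w,
  K <= ln n%:R -> 0 <= p <= 2^-1 -> c0 / n%:R <= p -> 1 <= w ->
  p ^+ 2 * n%:R * w = ln n%:R ->
  pr p (fun E => (functionality (@graph_of_edges n E))%:R
    < 10^-4 * (n%:R * p * (1 + ln w) / ln n%:R)) <= 3 * expR (- ln n%:R).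
Proof.
move=> c00; exists (3 * 10 ^+ 3 + (3 * 10 ^+ 6) / c0 + 2 * `|ln c0|) => n p w.
set L := ln n%:R => KL /andP[p0 ph] pc w1 pw.
have c1 : 0 < (3 * 10 ^+ 6) / c0 by rewrite divr_gt0.
have L3 : 3 * 10 ^+ 3 <= L by have := normr_ge0 (ln c0); lra.
have Lc : (3 * 10 ^+ 6) <= L * c0 by rewrite -ler_pdivrMr //; have := normr_ge0 (ln c0); lra.
have Ll : - (2 * ln c0) <= L by have := ler_norm (- ln c0); rewrite normrN; lra.
have L0 : 0 < L by lra.
have n1 : (1 < n)%N := ln_natr_gt0 L0.
have n0 : (0 < n)%N := ltnW n1.
have nr : 0 < n%:R :> R by rewrite ltr0n.
have np0 : 0 < n%:R * p.
  by apply: lt_le_trans c00 _; rewrite mulrC -ler_pdivrMr.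
have pp : 0 < p by rewrite -(pmulr_rgt0 _ nr).
have nL := ln_pow4_le n0; rewrite -/L in nL.
have p01 : 0 <= p <= 1 by rewrite p0 (le_trans ph) // invf_le1 ?ler1n.
have w0 : 0 < w by lra.
set x := 1 + ln w.
have lw0 : 0 <= ln w by rewrite ln_ge0.
have x1 : 1 <= x by rewrite lerDl.
have xw : x <= w.
  by rewrite /x -lerBrDl -[X in ln X](subrK 1) addrC le_ln1Dx // ltrBrDr; lra.
have ex : expR x = expR 1 * w by rewrite expRD lnK // posrE.
have e3 := expR1_le3 R.
(* From n p >= c0 and (n p)^2 w = n L follows w <= n L / c0^2, so ln w is at most L + ln L - 2 ln
   c0. *)
have xL : x <= 3 * L.
  have c2w : c0 ^+ 2 * w <= n%:R * L.
    rewrite -pw; have -> : n%:R * (p ^+ 2 * n%:R * w) = (n%:R * p) ^+ 2 * w by ring.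
    rewrite ler_wpM2r ?(ltW w0) //; apply: lerXn2r; rewrite ?nnegrE ?(ltW c00) ?(ltW np0) //.
    by rewrite mulrC -ler_pdivrMr.
  have : ln (c0 ^+ 2 * w) <= ln (n%:R * L).
    by rewrite ler_ln ?posrE ?mulr_gt0 ?exprn_gt0.
  rewrite !lnM ?posrE ?mulr_gt0 // -/L.
  have : ln L <= L - 1 by rewrite -[X in ln X](subrK 1) addrC le_ln1Dx //; lra.
  by rewrite /x; lra.
pose a := n%:R ^+ 2 * p / 16.
have ya : 0 <= 9 * (n%:R * p) + 2 * L by lra.
pose D := Num.truncn (9 * (n%:R * p) + 2 * L).
have [D1 D2] := truncn_bounds ya; rewrite -/D in D1 D2.
have yt : 0 <= 6 * L / x by rewrite divr_ge0 ?mulr_ge0 ?ler0n ?(ltW L0) // (le_trans ler01).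
pose t := Num.truncn (6 * L / x).
have [t1 t2] := truncn_bounds yt; rewrite -/t in t1 t2.
have x0 : 0 < x by apply: lt_le_trans x1.
apply: (@le_trans _ _ (pr p (fun E : {set potential_edge n} => (#|E|%:R <= a) ||
  ([exists Z : {set 'I_n}, (#|Z| == 0)%N && [exists y, (y \notin Z) &&
     (D.+1 <= #|uncovered (gr E) Z y|)%N]] ||
   [exists y, true && [exists z, (y != z) &&
     (t.+1 <= #|nbr (gr E) y :&: nbr (gr E) z|%SET)%N]])))).
  apply: pr_mono => // E; rewrite ltNge; apply: contraR; rewrite !negb_or -ltNge.
  move=> /andP[Ea /andP[/existsPn nD /existsPn nt]].
  apply: (@lower_bound_sparse_det n p x L E D t) => //.
  - move=> y; have := nD finset.set0; rewrite cards0 eqxx /= => /existsPn/(_ y).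
    rewrite finset.in_set0 /= -ltnNge ltnS; apply: leq_trans.
    apply/subset_leq_card/fintype.subsetP => z yz; rewrite finset.in_set finset.setD0 yz.
    by apply/fintype.forallP => u; rewrite finset.in_set0.
  - by move=> y z nyz; have := nt y => /= /existsPn/(_ z); rewrite nyz /= -ltnNge ltnS.
  set kap := 10^-4 * _.
  have kap0 : 0 <= kap.
    by rewrite mulr_ge0 ?invr_ge0 ?exprn_ge0 // divr_ge0 ?(ltW L0) ?mulr_ge0 ?(ltW x0).
  have D0 : 0 <= D%:R :> R by [].
  (* [D] is of order n p or L, whichever is larger. If n p >= L, the left side is at most n^2 p
     times 132 (kap p + p), where kap p = 10^-4 x / w and p <= 10^-4. Otherwise it is at most 264
     L^3, which is beaten by n^2 p >= c0 n >= c0 L^4 / 256. *)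
  have [np_ge|np_lt] := leP L (n%:R * p).
    have p1 : p <= 10^-4.
      rewrite -(@ler_pXn2r _ 2) ?nnegrE //.
      have : p ^+ 2 * n%:R <= L by rewrite -pw ler_peMr ?mulr_ge0 ?exprn_ge0.
      have : p ^+ 2 * (L ^+ 4 / 256) <= p ^+ 2 * n%:R by rewrite ler_wpM2l ?exprn_ge0.
      move=> h1 h2; have h3 : p ^+ 2 * (L ^+ 3 / 256) * L <= 1 * L.
        by rewrite mul1r; apply: le_trans h2; apply: le_trans h1; rewrite le_eqVlt; apply/orP; left; apply/eqP; field.
      rewrite ler_pM2r // in h3.
      have : (3 * 10 ^+ 3) ^+ 3 <= L ^+ 3 by apply: lerXn2r; rewrite ?nnegrE ?(ltW L0) ?exprn_ge0 ?mulr_ge0 ?exprn_ge0 ?ler0n.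
      move=> h4; have h5 : p ^+ 2 * ((3 * 10 ^+ 3) ^+ 3 / 256) <= p ^+ 2 * (L ^+ 3 / 256).
        apply: ler_wpM2l; [exact: exprn_ge0|apply: ler_wpM2r; last exact: h4].
        by rewrite invr_ge0 ler0n.
      by move: h3 h5; clear; lra.
    have kp : kap * p <= 10^-4.
      have -> : kap * p = 10^-4 * (x / w).
        rewrite /kap; have -> : L = p ^+ 2 * n%:R * w by rewrite pw.
        by field; rewrite !gt_eqF.
      by rewrite ger_pMr // ler_pdivrMr // mul1r.
    have Db : D%:R <= 11 * (n%:R * p) by move: D1 np_ge; clear; lra.
    have Db1 : D.+1%:R <= 12 * (n%:R * p) by rewrite -(@natr1 R D); move: Db np_ge L3; clear; lra.
    apply: (@le_lt_trans _ _ ((kap + 1) * (12 * (n%:R * p)) * (11 * (n%:R * p)))).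
      by apply: ler_pM => //; [rewrite mulr_ge0 // addr_ge0 | rewrite ler_wpM2l // addr_ge0].
    have -> : (kap + 1) * (12 * (n%:R * p)) * (11 * (n%:R * p)) = (n%:R ^+ 2 * p) * (132 * (kap * p + p)) by ring.
    rewrite ltr_pM2l ?mulr_gt0 ?exprn_gt0 //.
    by move: kp p1; clear; lra.
  have kapL : kap <= L.
    have h1 : n%:R * p * x / L <= 3 * L.
      by rewrite ler_pdivrMr // mulrC ler_pM // ?(ltW np0) ?(ltW x0) ?(ltW np_lt).
    by rewrite /kap; move: h1 L0; set u := _ / L; clear; lra.
  have Db : D%:R <= 11 * L by move: D1 np_lt; clear; lra.
  have Db1 : D.+1%:R <= 12 * L by rewrite -(@natr1 R D); move: Db L3; clear; lra.
  apply: (@le_lt_trans _ _ ((2 * L) * (12 * L) * (11 * L))).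
    apply: ler_pM => //; first by rewrite mulr_ge0 // addr_ge0.
    by apply: ler_pM => //; rewrite ?addr_ge0 //; move: kapL L3; clear; lra.
  have -> : (2 * L) * (12 * L) * (11 * L) = 264 * L ^+ 3 by ring.
  have L30 : 0 < L ^+ 3 by rewrite exprn_gt0.
  have h1 : c0 * n%:R <= n%:R ^+ 2 * p.
    have -> : n%:R ^+ 2 * p = (n%:R * p) * n%:R by ring.
    by rewrite ler_wpM2r ?(ltW nr) // mulrC -ler_pdivrMr.
  have h2 : c0 * (L ^+ 4 / 256) <= c0 * n%:R by rewrite ler_wpM2l // ltW.
  have h3 : (3 * 10 ^+ 6) * L ^+ 3 <= c0 * L * L ^+ 3 by rewrite ler_wpM2r ?(ltW L30) // [leRHS]mulrC.
  have h4 : c0 * L * L ^+ 3 = 256 * (c0 * (L ^+ 4 / 256)) by field.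
  by move: h1 h2 h3 h4 L30; clear; lra.
have nE : expR L = n%:R by rewrite /L expR_ln_natr.
apply: (le_trans (pr_orb p01 _ _)).
have -> : 3 * expR (- L) = expR (- L) + (expR (- L) + expR (- L)) by ring.
apply: lerD.
  apply: (le_trans (pr_few_edges a p01 n1)); rewrite ler_expR /a.
  have h1 : c0 * n%:R <= n%:R ^+ 2 * p.
    have -> : n%:R ^+ 2 * p = (n%:R * p) * n%:R by ring.
    by rewrite ler_wpM2r ?(ltW nr) // mulrC -ler_pdivrMr.
  have h2 : c0 * (L ^+ 4 / 256) <= c0 * n%:R by rewrite ler_wpM2l // ltW.
  have h3 : (3 * 10 ^+ 6) * L ^+ 3 <= c0 * L * L ^+ 3.
    by rewrite ler_wpM2r ?exprn_ge0 ?(ltW L0) // [leRHS]mulrC.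
  have h4 : c0 * L * L ^+ 3 = 256 * (c0 * (L ^+ 4 / 256)) by field.
  have h5 : L <= L ^+ 3 by rewrite -[leLHS]expr1 ler_weXn2l //; move: L3; clear; lra.
  by rewrite [p * _]mulrC; move: h1 h2 h3 h4 h5 L0; clear; lra.
apply: (le_trans (pr_orb p01 _ _)); apply: lerD.
  apply: (le_trans (pr_uncovered n p01 0 D.+1)).
  rewrite bin0 mul1r expr0 mulr1.
  have h : 'C(n, D.+1)%:R * p ^+ D.+1 <= expR (- (1 * D.+1%:R)).
    apply: bin_tail => //; rewrite expRN ler_pdivlMr ?expR_gt0 //.
    have -> : expR 1 * n%:R * p * expR 1 = expR 1 * expR 1 * (n%:R * p) by ring.
    apply: (@le_trans _ _ (3 * 3 * (n%:R * p))).
      by rewrite ler_wpM2r ?(ltW np0) // ler_pM ?expR_ge0.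
    by rewrite -natr1; move: D2 L0; clear; lra.
  apply: (le_trans (ler_wpM2l (ltW nr) h)).
  rewrite -nE -expRD ler_expR -natr1 mul1r; move: D2 np0; clear; lra.
apply: (le_trans (pr_codegree n p01 t.+1)); rewrite exprM.
(* The mean codegree is at most n p^2 = L / w and the threshold is 6 L / x. Since e^x = e w, this
   gap yields a gain e^(-x/2) per common neighbour, in total more than 3 L in the exponent against 2
   L for the choice of the pair. *)
have h : 'C(n, t.+1)%:R * p ^+ 2 ^+ t.+1 <= expR (- (x / 2 * t.+1%:R)).
  apply: bin_tail; first exact: exprn_ge0.
  rewrite expRN ler_pdivlMr ?expR_gt0 //; set u := expR (x / 2).
  have uu : u * u = expR 1 * w by rewrite -expRD -ex; congr expR; field.
  have ux : expR 1 * (x / 2) <= u.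
    have -> : u = expR 1 * expR (x / 2 - 1) by rewrite /u -expRD; congr expR; field.
    rewrite ler_wpM2l ?expR_ge0 //; apply: le_trans (expR_ge1Dx _).
    by rewrite addrCA subrr addr0.
  have u0 : 0 < u := expR_gt0 _.
  apply: (@le_trans _ _ (6 * L / x)); last by rewrite -(@natr1 R t); exact: ltW.
  rewrite ler_pdivlMr // -(ler_pM2r u0).
  have -> : expR 1 * n%:R * p ^+ 2 * u * x * u = expR 1 ^+ 2 * x * (p ^+ 2 * n%:R * w).
    have -> : expR 1 * n%:R * p ^+ 2 * u * x * u = expR 1 * n%:R * p ^+ 2 * x * (u * u) by ring.
    by rewrite uu; ring.
  rewrite pw [leRHS]mulrAC ler_wpM2r ?(ltW L0) //.
  apply: (@le_trans _ _ (6 * (expR 1 * (x / 2)))); last by rewrite ler_wpM2l.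
  have -> : 6 * (expR 1 * (x / 2)) = expR 1 * 3 * x :> R by field.
  by rewrite expr2 ler_wpM2r ?(ltW x0) // ler_wpM2l ?expR_ge0.
apply: (le_trans (ler_wpM2l (ltW nr) (ler_wpM2l (ltW nr) h))).
rewrite -nE -!expRD ler_expR -(@natr1 R t).
by move: t2; rewrite ltr_pdivrMr //; clear; lra.
Qed.

End LowerBounds.

(** * Lower bound in case (2) *)

Section LowerBoundDense.
Variable R : realType.
Implicit Types (p w : R) (n : nat).

Definition no_trace n (E : {set potential_edge n}) k (b : bool) :=
  [exists S : {set 'I_n}, (#|S| <= k)%N && [exists y, (y \notin S) &&
     [forall z in ~: (y |: S), ~~ ((edges_adj E z y == b) &&
        [forall x in S, ~~ edges_adj E z x])]]].

Lemma functionality_gt n (E : {set potential_edge n}) k :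
  (k < n)%N -> ~~ no_trace E k true -> ~~ no_trace E k false ->
  (k < functionality (graph_of_edges E))%N.
Proof.
move=> kn nt nf; pose G := graph_of_edges E.
have hit b (S : {set 'I_n}) y : ~~ no_trace E k b -> (#|S| <= k)%N -> y \notin S ->
    exists z, [/\ z != y, z \notin S, adj G y z = b & {in S, forall x, adj G z x = false}].
  move=> /existsPn/(_ S) nb Sk yS; move: nb; rewrite Sk /= => /existsPn/(_ y).
  rewrite yS /= => /forall_inPn[z]; rewrite !inE negb_or negbK => /andP[zy zS].
  move=> /andP[/eqP zb /forall_inP zx]; exists z; split=> //; first by rewrite -zb; exact: edges_adj_sym.
  by move=> x xS; exact/negbTE/zx.
have n0 : (0 < n)%N by apply: leq_ltn_trans kn.
apply: (functionality_ge (H := finset.setT)).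
- by rewrite -card_gt0 cardsT card_ord.
- by rewrite cardsT card_ord.
move=> y S _ _ yS det; rewrite ltnNge; apply/negP => Sk.
have [z [zy zS zt zx]] := hit true S y nt Sk yS.
have [z' [z'y z'S z'f z'x]] := hit false S y nf Sk yS.
have := det z z'; rewrite !inE (negbTE zy) (negbTE zS) (negbTE z'y) (negbTE z'S) zt z'f.
by move=> /(_ isT isT) bad; suff : true = false by []; apply: bad => x xS; rewrite zx // z'x.
Qed.

(** In the exponent, measured in units of L / p, the choice of S costs at most x / 50. With p n =
    e^(x - 1) L / p, the independent vertices z gain at least e^(x - 1 - x/50) / 2 >= 49 x / 100.
    The rest has to pay 2 L, for the choice of y and for the final e^(-L). *)
Lemma lower_bound_dense n p w :
  10 ^+ 2 <= ln (n%:R : R) -> 0 <= p <= 2^-1 -> 1 <= w -> p ^+ 2 * n%:R = w * ln n%:R ->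
  pr p (fun E => (functionality (@graph_of_edges n E))%:R
    < 10^-2 * ((1 + ln w) / p)) <= 2 * expR (- ln n%:R).
Proof.
set L := ln n%:R => KL /andP[p0 ph] w1 pw.
have L0 : 0 < L by lra.
have n1 : (1 < n)%N := ln_natr_gt0 L0.
have n0 : (0 < n)%N := ltnW n1.
have nr : 0 < n%:R :> R by rewrite ltr0n.
have nL := ln_pow4_le R n0; rewrite -/L in nL.
have p01 : 0 <= p <= 1 by rewrite p0 (le_trans ph) // invf_le1 ?ler1n.
have w0 : 0 < w by lra.
have pp : 0 < p.
  rewrite lt_neqAle p0 andbT; apply/eqP => pe; move: pw; rewrite -pe expr0n mul0r.
  by have := mulr_gt0 w0 L0; lra.
set x := 1 + ln w.
have lw0 : 0 <= ln w by rewrite ln_ge0.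
have x1 : 1 <= x by rewrite lerDl.
have x0 : 0 < x by lra.
have xw : x <= w.
  by rewrite /x -lerBrDl -[X in ln X](subrK 1) addrC le_ln1Dx // ltrBrDr; lra.
have ex : w = expR (x - 1) by rewrite /x addrC addKr lnK // posrE.
have e3 := expR1_le3 R.
have pn : p * n%:R = w * L / p.
  by apply: (mulIf (lt0r_neq0 pp)); rewrite divfK ?gt_eqF // -pw; ring.
have yk : 0 <= 10^-2 * (x / p).
  by rewrite mulr_ge0 ?invr_ge0 ?exprn_ge0 // divr_ge0 // ltW.
pose k := Num.truncn (10^-2 * (x / p)).
have [k1 k2] := truncn_bounds yk; rewrite -/k in k1 k2.
have nbig : 4 <= n%:R :> R.
  apply: le_trans nL; rewrite (ler_pdivlMr _ _ (ltr0n R 256)).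
  apply: (@le_trans _ _ ((10 ^+ 2) ^+ 4)); first by clear; lra.
  by apply: lerXn2r KL; rewrite nnegrE ?(ltW L0) // exprn_ge0.
have xp : x / p <= n%:R / 2.
  apply: (@le_trans _ _ (p * n%:R)); last by rewrite mulrC ler_wpM2l.
  rewrite pn ler_wpM2r ?invr_ge0 //; apply: le_trans xw _.
  by rewrite ler_peMr ?(ltW w0) //; move: KL; clear; lra.
have kn2 : k.+1%:R <= n%:R / 2 :> R.
  by rewrite -(@natr1 R k); move: k1 xp nbig; set u := x / p; clear; lra.
have kn : (k < n)%N.
  by rewrite -(ltr_nat R); move: kn2 nbig; rewrite -(@natr1 R k); clear; lra.
have fall b : pr p (fun E : {set potential_edge n} => no_trace E k b) <= expR (- L).
  apply: (le_trans (pr_no_empty_trace p01 b ph kn)).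
  apply: le_trans (ler_pM _ _ (natrS_expR R k n1) (lexx _)) _ => //.
    case/andP: p01 => _ p1; rewrite mulr_ge0 ?ler0n // exprn_ge0 // subr_ge0.
    by rewrite mulr_ile1 ?exprn_ge0 ?exprn_ile1 ?subr_ge0 ?lerBlDr ?lerDl.
  have q1 : p * (1 - p) ^+ k <= 1.
    by case/andP: p01 => _ p1; rewrite mulr_ile1 ?exprn_ge0 ?exprn_ile1 ?subr_ge0 ?lerBlDr ?lerDl.
  rewrite -/L; have -> : n%:R = expR L :> R by rewrite /L expR_ln_natr.
  apply: le_trans (ler_wpM2l (expR_ge0 _) (ler_wpM2l (expR_ge0 _) (onesubX_le _ q1))) _.
  rewrite -!expRD ler_expR.
  have kr : (n - k.+1)%:R >= n%:R / 2 :> R by rewrite natrB //; move: kn2; clear; lra.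
  have pk : expR (- (x / 50)) <= (1 - p) ^+ k.
    apply: le_trans (onesubX_ge k _); last by rewrite p0.
    rewrite ler_expR lerN2.
    have : p * k%:R <= p * (10^-2 * (x / p)) by rewrite ler_wpM2l.
    have -> : p * (10^-2 * (x / p)) = 10^-2 * x by field; rewrite gt_eqF.
    clear; lra.
  have big : (L / p) * (49 / 100 * x) <= p * (1 - p) ^+ k * (n - k.+1)%:R.
    apply: (@le_trans _ _ (p * expR (- (x / 50)) * (n%:R / 2))); last first.
      apply: ler_pM => //; first by rewrite mulr_ge0 ?expR_ge0.
      by rewrite ler_wpM2l.
    have -> : p * expR (- (x / 50)) * (n%:R / 2) = p * n%:R * expR (- (x / 50)) / 2 by ring.
    rewrite pn ex.
    have -> : expR (x - 1) * L / p * expR (- (x / 50)) / 2 = (L / p) * ((expR (x - 1) * expR (- (x / 50))) / 2) by ring.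
    rewrite ler_wpM2l ?divr_ge0 ?(ltW L0) // -expRD.
    have := expR_ge1Dx (x - 1 + - (x / 50)); clear; lra.
  have kL : L * k%:R <= (L / p) * (x / 100).
    have -> : (L / p) * (x / 100) = L * (10^-2 * (x / p)) by field; rewrite gt_eqF.
    by rewrite ler_wpM2l // ltW.
  have Lp : L = (L / p) * p by rewrite divfK // gt_eqF.
  have Lp0 : 0 < L / p by rewrite divr_gt0.
  suff h : (L / p) * (2 * p) <= (L / p) * (47 / 100 * x).
    have h2L : 2 * L <= 47 / 100 * (L / p * x).
      have -> : 2 * L = L / p * (2 * p) by rewrite [in LHS]Lp; ring.
      by apply: le_trans h _; rewrite mulrCA.
    have h1 : 49 / 100 * (L / p * x) <= p * (1 - p) ^+ k * (n - k.+1)%:R.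
      by apply: le_trans big; rewrite mulrCA.
    have h2 : 2 * k%:R * L <= 2 / 100 * (L / p * x).
      have -> : 2 / 100 * (L / p * x) = 2 * (L / p * (x / 100)) by ring.
      by rewrite -mulrA ler_wpM2l // [k%:R * _]mulrC.
    move: h1 h2 h2L; set P := p * _ * _; set v := L / p * x; set kk := _ * L.
    by move: (kk) (P) (v) (L); clear; move=> *; lra.
  (* What remains is 2 p <= 47 x / 100. For x >= 3 it follows from p <= 1/2; for x < 3 one has w <=
     e^2 <= 9, and then p^2 n <= 9 L forces p <= 1/5. *)
  rewrite ler_pM2l //; have [x3|x3] := leP 3 x; first by move: x3 ph; clear; lra.
  have w9 : w <= 9.
    have : expR (x - 1) <= expR (2%:R * 1) by rewrite ler_expR; move: x3; clear; lra.
    rewrite -ex expRM_natl => /le_trans; apply.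
    by rewrite -[9](_ : 3 * 3 = 9) ?expr2; [rewrite ler_pM ?expR_ge0|ring].
  suff : p <= 5^-1 by move: x1; clear; lra.
  rewrite -(@ler_pXn2r _ 2) ?nnegrE //.
  have h1 : p ^+ 2 * (L ^+ 4 / 256) <= 9 * L.
    apply: (@le_trans _ _ (p ^+ 2 * n%:R)); first by rewrite ler_wpM2l ?exprn_ge0.
    by rewrite pw ler_wpM2r // ltW.
  have h2 : (10 ^+ 2) ^+ 3 <= L ^+ 3 by apply: lerXn2r; rewrite ?nnegrE ?exprn_ge0 ?(ltW L0).
  have h3 : p ^+ 2 * (L ^+ 3 / 256) * L <= 9 * L.
    by apply: le_trans h1; rewrite le_eqVlt; apply/orP; left; apply/eqP; field.
  rewrite ler_pM2r // in h3.
  have h4 : p ^+ 2 * ((10 ^+ 2) ^+ 3 / 256) <= p ^+ 2 * (L ^+ 3 / 256).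
    apply: ler_wpM2l; [exact: exprn_ge0|apply: ler_wpM2r; last exact: h2].
    by rewrite invr_ge0 ler0n.
  have -> : 5^-1 ^+ 2 = 1 / 25 :> R by field.
  have h5 := le_trans h4 h3.
  by move: h5; clear; lra.
apply: (@le_trans _ _ (pr p (fun E : {set potential_edge n} => no_trace E k true || no_trace E k false))).
  apply: pr_mono => // E; rewrite ltNge; apply: contraR; rewrite negb_or => /andP[nt nf].
  have := functionality_gt kn nt nf; rewrite -(ler_nat R) => h.
  by apply: ltW; apply: lt_le_trans h; rewrite -(@natr1 R k).
apply: (le_trans (pr_orb p01 _ _)).
have -> : 2 * expR (- L) = expR (- L) + expR (- L) by ring.
by apply: lerD; apply: fall.
Qed.

End LowerBoundDense.

(** * Upper bound when [w] is at most a small power of [n] *)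

Lemma cover_size j k u :
  (2 * j + (10 * k + 10 * u + 2 * (10 * k).+1) = 2 * j + (30 * k + 10 * u + 2))%N.
Proof. lia. Qed.

Section Middle.
(* [om] is [w] in case (1) and [1] in case (2).  All orders of magnitude are
   measured in powers of [T = n ^ (1 / 400)]: [p] is [T ^ -200] up to a factor
   [T], while [b = L / (om p)] and the target [Q = X / (om p)] are about
   [T ^ 200]. *)
Variables (R : realType) (n : nat) (p om L h T X b Q : R).
Local Notation gr := (@graph_of_edges n).
Hypothesis LE : L = ln n%:R.
Hypothesis hE : h = L / 400.
Hypothesis TE : T = expR h.
Hypothesis XE : X = 1 + ln om.
Hypothesis bE : b = L / (om * p).
Hypothesis QE : Q = X / (om * p).
Hypothesis h20 : 20 <= h.
Hypothesis p0h : 0 < p <= 2^-1.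
Hypothesis om1 : 1 <= om.
Hypothesis omT : ln om <= h.
Hypothesis np2_ge : L <= T * (n%:R * p ^+ 2).
Hypothesis np2_le : n%:R * p ^+ 2 <= T * L.

Let hL : L = 400 * h. Proof. by rewrite hE; field. Qed.
Let h0 : 0 < h. Proof. by apply: lt_le_trans h20; rewrite ltr0n. Qed.
Let L0 : 0 < L. Proof. by rewrite hL mulr_gt0 ?ltr0n ?h0. Qed.
Let n1 : (1 < n)%N. Proof. by apply: (@ln_natr_gt0 R); rewrite -LE. Qed.
Let n0 : (0 < n)%N. Proof. exact: ltnW n1. Qed.
Let nr : 0 < n%:R :> R. Proof. by rewrite ltr0n. Qed.
Let p0 : 0 < p. Proof. by case/andP: p0h. Qed.
Let p01 : 0 <= p <= 1.
Proof. by case/andP: p0h => /ltW -> hp; rewrite (le_trans hp) // invf_le1 ?ler1n. Qed.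
Let om0 : 0 < om. Proof. exact: lt_le_trans om1. Qed.
Let T0 : 0 < T. Proof. by rewrite TE expR_gt0. Qed.
Let L1 : 1 <= L. Proof. by rewrite hL; move: h20; lra. Qed.

(** From h >= 20 and e^20 >= 2^20 > 10^6: a single power of T absorbs L or any constant up to
    10^6. *)
Let T_big : 10 ^+ 6 <= T /\ L <= T.
Proof.
have T20 : 10 ^+ 6 <= expR 20 :> R.
  have -> : expR 20 = expR 1 ^+ 20 :> R by rewrite -expRM_natl mulr1.
  apply: (@le_trans _ _ (2 ^+ 20)); first by lra.
  by apply: lerXn2r (expR1_ge2 R); rewrite nnegrE ?expR_ge0.
have TE' : T = expR 20 * expR (h - 20) by rewrite -expRD TE; congr expR; ring.
have h1 := expR_ge1Dx (h - 20).
have h2 : 10 ^+ 6 * (1 + (h - 20)) <= T.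
  rewrite TE' ler_pM ?exprn_ge0 //; move: h20; lra.
by rewrite hL; move: h2 h20; lra.
Qed.

Let T6 : 10 ^+ 6 <= T. Proof. by case: T_big. Qed.
Let LT : L <= T. Proof. by case: T_big. Qed.
Let T1 : 1 <= T. Proof. by move: T6; lra. Qed.
Let TX a c : (a <= c)%N -> T ^+ a <= T ^+ c.
Proof. by move=> ac; rewrite ler_weXn2l. Qed.
Let TXS c a : c <= 10 ^+ 6 -> c * T ^+ a <= T ^+ a.+1.
Proof. by move=> c6; rewrite exprS ler_wpM2r ?exprn_ge0 ?(le_trans c6) // (ltW T0). Qed.
Let TX0 a : 0 < T ^+ a. Proof. by rewrite exprn_gt0. Qed.
Let TX1 a : 1 <= T ^+ a. Proof. by rewrite exprn_ege1. Qed.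

Let nT : n%:R = T ^+ 400.
Proof. by rewrite TE -expRM_natl -(expR_ln_natr R n0) -LE; congr expR; rewrite hL. Qed.

Let pT199 : p * T ^+ 199 <= 1.
Proof.
rewrite -(@ler_pXn2r _ 2) ?nnegrE ?mulr_ge0 ?exprn_ge0 ?(ltW p0) ?(ltW T0) //.
rewrite expr1n -(ler_pM2r (TX0 2)) mul1r.
have -> : (p * T ^+ 199) ^+ 2 * T ^+ 2 = n%:R * p ^+ 2 by rewrite nT; ring.
by apply: le_trans np2_le _; rewrite expr2 ler_wpM2l ?(ltW T0).
Qed.

Let pT201 : 1 <= p * T ^+ 201.
Proof.
rewrite -(@ler_pXn2r _ 2) ?nnegrE ?mulr_ge0 ?exprn_ge0 ?(ltW p0) ?(ltW T0) //.
rewrite expr1n; apply: le_trans L1 _; apply: le_trans np2_ge _.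
have -> : (p * T ^+ 201) ^+ 2 = T * (T * (n%:R * p ^+ 2)) by rewrite nT; ring.
by rewrite ler_peMl // mulr_ge0 ?(ltW T0) // mulr_ge0 ?exprn_ge0 ?ler0n ?(ltW p0).
Qed.

Let lom0 : 0 <= ln om. Proof. exact: ln_ge0. Qed.
Let X1 : 1 <= X. Proof. by rewrite XE lerDl. Qed.
Let X0 : 0 < X. Proof. exact: lt_le_trans X1. Qed.
Let Xh : X <= 2 * h. Proof. by rewrite XE; move: omT h20; lra. Qed.
Let omX : om = expR (X - 1). Proof. by rewrite XE addrC addKr lnK // posrE. Qed.
Let om_le : om <= T. Proof. by rewrite omX TE ler_expR XE addrC addKr. Qed.
Let omp0 : 0 < om * p. Proof. by rewrite mulr_gt0. Qed.

Let inv_ge : T ^+ 198 <= (om * p)^-1.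
Proof.
rewrite -[leRHS]mul1r ler_pdivlMr //.
have -> : T ^+ 198 * (om * p) = (om * T ^+ 198) * p by ring.
apply: le_trans pT199; rewrite mulrC ler_wpM2l ?(ltW p0) // [leRHS]exprS.
by rewrite ler_wpM2r // (ltW (TX0 _)).
Qed.

Let inv_le : (om * p)^-1 <= T ^+ 201.
Proof.
rewrite -[leLHS]mul1r ler_pdivrMr //; apply: le_trans pT201 _.
have -> : T ^+ 201 * (om * p) = om * (p * T ^+ 201) by ring.
by rewrite ler_peMl // mulr_ge0 ?(ltW p0) ?(ltW (TX0 _)).
Qed.

Let Q_ge : T ^+ 198 <= Q.
Proof. by rewrite QE; apply: le_trans inv_ge _; rewrite ler_peMl // invr_ge0 (ltW omp0). Qed.
Let b_ge : T ^+ 198 <= b.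
Proof. by rewrite bE; apply: le_trans inv_ge _; rewrite ler_peMl // invr_ge0 (ltW omp0). Qed.
Let b_le : b <= T ^+ 202.
Proof. by rewrite bE exprS ler_pM ?(ltW L0) // invr_ge0 (ltW omp0). Qed.
Let bXQ : b * X = 400 * h * Q. Proof. by rewrite bE QE hL; ring. Qed.
Let Q0 : 0 < Q. Proof. exact: lt_le_trans (TX0 198) Q_ge. Qed.
Let b0 : 0 < b. Proof. exact: lt_le_trans (TX0 198) b_ge. Qed.
Let eL : expR (- L) <= T^-1.
Proof. by rewrite TE -expRN ler_expR lerN2 hL; move: h0; lra. Qed.

(** As n p^2 <= T^2 and Q >= T^198, sets of up to T^392 vertices still have a vertex of degree O(Q).
    [lam] exceeds the codegrees, whose mean is at most n p^2. Spreading needs [r] far above T^12 L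
    and [m0] far above T^12 L times the set size, at most T^202; at the same time [r * lam] has to
    stay below T^197, and the blocks have to fit into [M] vertices. *)
Let M := Num.truncn (T ^+ 392).
Let j := (Num.truncn Q).+2.
Let lam := Num.truncn (T ^+ 10).
Let r := (Num.truncn (T ^+ 50)).+1.
Let m0 := Num.truncn (T ^+ 300).

Let truncT a : (Num.truncn (T ^+ a))%:R <= T ^+ a /\ T ^+ a < (Num.truncn (T ^+ a))%:R + 1.
Proof. exact/truncn_bounds/ltW. Qed.

Let j_bounds : Q <= j%:R <= Q + 2.
Proof.
have [h1 h2] := truncn_bounds (ltW Q0).
have -> : j%:R = (Num.truncn Q)%:R + 2 :> R by rewrite /j -addn2 natrD.
by move: h1 h2; lra.
Qed.

Lemma middle_density :
  pr p (fun E => [exists H : {set 'I_n}, ((H != finset.set0) && (#|H| <= M)%N) &&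
     [forall y in H, (2 * j < #|nbr (gr E) y :&: H|%SET)%N]]) <= T^-1.
Proof.
have [M1 M2] := truncT 392; rewrite -/M in M1 M2.
have [j1 j2] := andP j_bounds.
have TTM : 2 * T <= M%:R.
  have : 3 * T <= T ^+ 392.
    apply: le_trans (TX (_ : 2 <= 392)%N) => //; rewrite -{1}[T]expr1; apply: TXS.
    by lra.
  by move: M2 T1; lra.
have Mp : 0 < M%:R :> R by apply: lt_le_trans TTM; rewrite mulr_gt0.
apply: le_trans (pr_min_degree n p01 j M) _.
have ph : 0 <= p <= 2^-1 by case/andP: p0h => /ltW -> ->.
have M0 : (0 < M)%N by rewrite -(ltr0n R).
have hM : 3 * M%:R * p <= 2 * j%:R.
  apply: (@le_trans _ _ (3 * T ^+ 193)).
    rewrite -mulrA ler_wpM2l ?ler0n //; apply: (@le_trans _ _ (T ^+ 392 * p)).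
      by rewrite ler_wpM2r ?(ltW p0).
    have -> : T ^+ 392 * p = T ^+ 193 * (p * T ^+ 199) by ring.
    by rewrite ler_piMr // (ltW (TX0 _)).
  apply: (@le_trans _ _ (T ^+ 194)); first by apply: TXS; lra.
  apply: le_trans (TX (_ : 194 <= 198)%N) _ => //; apply: le_trans Q_ge _.
  by move: j1 Q0; lra.
have hj : 27 * n%:R * p ^+ 2 * M%:R <= 2 * j%:R ^+ 2.
  apply: (@le_trans _ _ (27 * T ^+ 394)).
    have -> : 27 * n%:R * p ^+ 2 * M%:R = 27 * ((n%:R * p ^+ 2) * M%:R) by ring.
    have -> : T ^+ 394 = T ^+ 2 * T ^+ 392 by rewrite -exprD.
    have np2 : n%:R * p ^+ 2 <= T ^+ 2.
      by apply: le_trans np2_le _; rewrite expr2 ler_wpM2l ?(ltW T0).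
    apply: ler_wpM2l; first by rewrite ler0n.
    apply: ler_pM => //; first by rewrite mulr_ge0 ?exprn_ge0 ?ler0n ?(ltW p0).
  apply: (@le_trans _ _ (T ^+ 395)); first by apply: TXS; lra.
  apply: le_trans (TX (_ : 395 <= 396)%N) _ => //.
  have -> : T ^+ 396 = (T ^+ 198) ^+ 2 by rewrite -exprM.
  have : (T ^+ 198) ^+ 2 <= j%:R ^+ 2.
    by apply: lerXn2r; rewrite ?nnegrE ?exprn_ge0 ?(ltW T0) ?ler0n // (le_trans Q_ge).
  have : 0 <= j%:R ^+ 2 :> R by rewrite exprn_ge0.
  by move: (j%:R ^+ 2) ((T ^+ 198) ^+ 2) => u v; lra.
apply: le_trans (min_degree_sum ph M0 _ hM hj) _ => //.
by rewrite ler_pdivrMr // mulrC ler_pdivlMr.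
Qed.

Lemma middle_codegree :
  pr p (fun E => [exists y, true && [exists z, (y != z) &&
     (lam.+1 <= #|nbr (gr E) y :&: nbr (gr E) z|%SET)%N]]) <= T^-1.
Proof.
have [l1 l2] := truncT 10; rewrite -/lam in l1 l2.
apply: le_trans _ eL; apply: le_trans (pr_codegree n p01 lam.+1) _; rewrite exprM.
have e3 := expR1_le3 R.
have hb : 'C(n, lam.+1)%:R * p ^+ 2 ^+ lam.+1 <= expR (- (1 * lam.+1%:R)).
  apply: bin_tail; first by rewrite exprn_ge0 // ltW.
  rewrite expRN ler_pdivlMr ?expR_gt0 // -(@natr1 R lam).
  apply: le_trans (ltW l2).
  have -> : expR 1 * n%:R * p ^+ 2 * expR 1 = expR 1 * expR 1 * (n%:R * p ^+ 2) by ring.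
  apply: (@le_trans _ _ (3 * 3 * T ^+ 2)).
    apply: ler_pM; rewrite ?mulr_ge0 ?expR_ge0 ?ler0n ?exprn_ge0 ?(ltW p0) //.
      by rewrite ler_pM ?expR_ge0.
    by apply: le_trans np2_le _; rewrite expr2 ler_wpM2l ?(ltW T0).
  by apply: le_trans (TX (_ : 3 <= 10)%N) => //; apply: TXS; lra.
apply: (le_trans (ler_wpM2l (ltW nr) (ler_wpM2l (ltW nr) hb))).
rewrite -(expR_ln_natr R n0) -LE -!expRD ler_expR -(@natr1 R lam) mul1r.
have : 3 * L <= T ^+ 10.
  apply: (@le_trans _ _ (3 * T ^+ 1)); first by rewrite expr1 ler_wpM2l.
  by apply: le_trans (TX (_ : 2 <= 10)%N) => //; apply: TXS; lra.
by move: l2; lra.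
Qed.

(** A single pair contributes n^2 k^9 p^18 = n^2 (k p)^9 p^9 <= T^(800 + 18 - 9 * 199) = T^(-973),
    and k + 1 disjoint pairs outweigh the at most T^(800 k) sets S. Eight common neighbours would
    only give T^(-776) per pair. *)
Lemma middle_twins k : k%:R * p <= T ^+ 2 ->
  pr p (fun E => [exists S : {set 'I_n}, (#|S| <= k)%N && [exists l : k.+1.-tuple ('I_n * 'I_n),
     true && matching (twins (gr E) S 9) (~: S)%SET l]]) <= T^-1.
Proof.
move=> kp; apply: le_trans _ eL; apply: le_trans (pr_twins n p01 k 9 k.+1) _.
have -> : (2 * 9 * k.+1 = 18 * k.+1)%N by [].
rewrite (exprM p) -!exprMn.
set Y := _ * (_ * _ ^+ 18).
have YT : Y <= expR (- (973 * h)).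
  rewrite expRN expRM_natl -TE -[leRHS]mul1r ler_pdivlMr //.
  have -> : Y * T ^+ 973 = (k%:R * p) ^+ 9 * (p * T ^+ 199) ^+ 9 * (T ^+ 18)^-1.
    rewrite /Y !natrX nT; have -> : T ^+ 973 = T ^+ 991 / T ^+ 18.
      by rewrite -[in RHS](_ : 973 + 18 = 991)%N // exprD mulfK // gt_eqF.
    by field; rewrite gt_eqF.
  rewrite ler_pdivrMr // mul1r -[leRHS]mulr1; apply: ler_pM.
  - by rewrite exprn_ge0 // mulr_ge0 // ltW.
  - by rewrite exprn_ge0 // mulr_ge0 // ltW.
  - rewrite (_ : 18 = 2 * 9)%N // exprM; apply: lerXn2r => //.
      by rewrite nnegrE mulr_ge0 // ltW.
    by rewrite nnegrE exprn_ge0 // ltW.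
  by rewrite exprn_ile1 // mulr_ge0 // ltW.
apply: (@le_trans _ _ (expR (2 * k%:R * L) * expR (- (973 * h)) ^+ k.+1)).
  apply: ler_pM; rewrite ?ler0n ?exprn_ge0 //.
  - by rewrite !mulr_ge0 ?exprn_ge0 ?ler0n // ltW.
  - by rewrite LE; exact: natrS_expR.
  by apply: lerXn2r; rewrite ?nnegrE ?expR_ge0 // !mulr_ge0 ?exprn_ge0 ?ler0n // ltW.
rewrite -expRM_natr -expRD ler_expR -(@natr1 R k) hL.
have : 0 <= k%:R * h by rewrite mulr_ge0 // ltW.
by move: h0; set kh := k%:R * h => h0' kh0; have -> : 2 * k%:R * (400 * h) + - (973 * h) * (k%:R + 1) = - 173 * kh - 973 * h; [rewrite /kh; ring|move: h0' kh0; lra].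
Qed.

(* In stage [i] about [9 yy i] neighbours of [y] are uncovered; a set of [vv i] of
   them has [vv i * p <= 2 * h], and a given vertex is adjacent to [tt i] of these
   with probability at least [beta = T ^ -12]. *)
Let tt i := Num.truncn (4 * h / (X + i%:R)).
Let yy i : R := b / 2 ^+ i.
Let vv i := Num.truncn (yy i / 200).

Let two_exp i : 2 ^+ i <= expR i%:R :> R.
Proof.
rewrite -[i%:R]mulr1 expRM_natl; apply: lerXn2r (expR1_ge2 R); by rewrite nnegrE ?expR_ge0.
Qed.

Let yy_ge i : i%:R <= h -> T ^+ 197 <= yy i.
Proof.
move=> ih; rewrite ler_pdivlMr ?exprn_gt0 //.
apply: le_trans b_ge; rewrite mulrC [leRHS]exprS ler_wpM2r ?(ltW (TX0 _)) //.
by apply: le_trans (two_exp i) _; rewrite TE ler_expR.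
Qed.

Let vv_bounds i : i%:R <= h -> yy i / 400 <= (vv i)%:R <= yy i / 200.
Proof.
move=> ih; have y1 := yy_ge ih.
have y0 : 0 <= yy i / 200 by rewrite divr_ge0 ?ler0n // (le_trans _ y1) // (ltW (TX0 _)).
have [h1 h2] := truncn_bounds y0; rewrite -/(vv i) in h1 h2.
have : 400 * T ^+ 0 <= T ^+ 1 by apply: TXS; lra.
have := TX (isT : (1 <= 197)%N); rewrite expr0.
by move: h1 h2 y1 => ? ? ? ? ?; apply/andP; split; lra.
Qed.

Let Xi_bounds i : i%:R <= h -> 1 <= X + i%:R <= 4 * h.
Proof.
move=> ih; have := ler0n R i; move: X1 Xh h20 ih => ? ? ? ? ?.
by apply/andP; split; lra.
Qed.

Let tt_bounds i : i%:R <= h -> 2 * h / (X + i%:R) <= (tt i)%:R <= 4 * h / (X + i%:R).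
Proof.
move=> ih; have [a1 a2] := andP (Xi_bounds ih).
have a0 : 0 < X + i%:R by apply: lt_le_trans a1.
have z1 : 1 <= 4 * h / (X + i%:R) by rewrite ler_pdivlMr // mul1r.
have [h1 h2] := truncn_bounds (le_trans ler01 z1); rewrite -/(tt i) in h1 h2.
have t1 : 1 <= (tt i)%:R :> R by rewrite ler1n truncn_gt0.
rewrite h1 andbT; have -> : 2 * h / (X + i%:R) = (4 * h / (X + i%:R)) / 2 by field; rewrite gt_eqF.
by move: h1 h2 t1 => ? ? ?; lra.
Qed.

Let tt_gt0 i : i%:R <= h -> (0 < tt i)%N.
Proof.
move=> ih; have [a1 a2] := andP (Xi_bounds ih).
by rewrite truncn_gt0 ler_pdivlMr ?mul1r // (lt_le_trans _ a1).
Qed.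

Let beta : R := expR (- (12 * h)).

(** The binomial coefficient is at least (v / t)^t, and v p / t >= e^(-2 (X + i)). As t (X + i) <= 4
    h, this costs at most 8 h in the exponent; (1 - p)^v >= e^(-2 p v) costs at most 4 h more. *)
Lemma middle_binomial i : i%:R <= h ->
  beta <= 'C(vv i, tt i)%:R * (p ^+ tt i * (1 - p) ^+ (vv i - tt i)).
Proof.
move=> ih; have [a1 a2] := andP (Xi_bounds ih).
have a0 : 0 < X + i%:R by apply: lt_le_trans a1.
have [v1 v2] := andP (vv_bounds ih); have [t1 t2] := andP (tt_bounds ih).
have t0 := tt_gt0 ih; have tr : 0 < (tt i)%:R :> R by rewrite ltr0n.
have y1 := yy_ge ih; have y0 : 0 < yy i := lt_le_trans (TX0 _) y1.
have t4 : (tt i)%:R <= 4 * h.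
  by apply: le_trans t2 _; rewrite ler_pdivrMr // ler_peMr // mulr_ge0 // ltW.
have tv : (tt i <= vv i)%N.
  rewrite -(ler_nat R); apply: le_trans t4 _; apply: le_trans _ v1.
  rewrite (ler_pdivlMr _ _ (ltr0n R 400)); apply: le_trans y1.
  have hT : 4 * h <= T by apply: le_trans LT; rewrite hL; move: h0; lra.
  apply: (@le_trans _ _ (400 * T ^+ 1)).
    by rewrite expr1 [leRHS]mulrC ler_wpM2r ?ler0n.
  by apply: le_trans (TX (_ : 2 <= 197)%N) => //; apply: TXS; lra.
have yp : yy i * p = 400 * h / (om * 2 ^+ i).
  by rewrite /yy bE hL; field; rewrite !gt_eqF ?exprn_gt0.
have o2 : 1 <= om * 2 ^+ i :> R.
  by rewrite -[leLHS]mulr1 ler_pM // exprn_ege1 // ler1n.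
have o20 : 0 < om * 2 ^+ i := lt_le_trans ltr01 o2.
have vp2 : 2 * p * (vv i)%:R <= 4 * h.
  apply: (@le_trans _ _ (2 * p * (yy i / 200))).
    by rewrite ler_wpM2l // mulr_ge0 // ltW.
  have -> : 2 * p * (yy i / 200) = (yy i * p) / 100 by field.
  rewrite yp ler_pdivrMr ?ltr0n // ler_pdivrMr //.
  have -> : 4 * h * 100 * (om * 2 ^+ i) = 400 * h * (om * 2 ^+ i) by ring.
  apply: ler_peMr o2; rewrite mulr_ge0 ?ler0n //; exact: ltW h0.
have vpt : expR (- (2 * (X + i%:R))) <= (vv i)%:R / (tt i)%:R * p.
  apply: (@le_trans _ _ ((4 * (om * 2 ^+ i))^-1)).
    rewrite expRN lef_pV2 ?posrE ?expR_gt0 ?mulr_gt0 ?exprn_gt0 //.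
    apply: (@le_trans _ _ (expR (2%:R * 1) * (expR (X - 1) * expR i%:R))).
      apply: ler_pM; rewrite ?ler0n ?mulr_ge0 ?exprn_ge0 ?(ltW om0) //.
        rewrite expRM_natl (_ : 4 = 2 ^+ 2); last by ring.
        by apply: lerXn2r (expR1_ge2 R); rewrite nnegrE ?expR_ge0.
      by rewrite -omX ler_wpM2l ?(ltW om0).
    by rewrite -!expRD ler_expR; move: a1 => ?; lra.
  rewrite mulrAC ler_pdivlMr //.
  apply: (@le_trans _ _ ((4 * (om * 2 ^+ i))^-1 * (4 * h))).
    by rewrite ler_wpM2l // invr_ge0 mulr_ge0 // ltW.
  apply: (@le_trans _ _ (yy i / 400 * p)); last by rewrite ler_wpM2r // ltW.
  by rewrite mulrAC yp le_eqVlt; apply/orP; left; apply/eqP; field; rewrite !gt_eqF ?exprn_gt0.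
apply: (@le_trans _ _ (((vv i)%:R / (tt i)%:R * p) ^+ tt i * (1 - p) ^+ vv i)); last first.
  rewrite exprMn -mulrA; apply: ler_pM; rewrite ?exprn_ge0 ?divr_ge0 ?ler0n //.
  - by rewrite mulr_ge0 ?exprn_ge0 ?(ltW p0) // subr_ge0; case/andP: p01.
  - by apply: bin_ge; rewrite t0 tv.
  rewrite ler_wpM2l ?exprn_ge0 ?(ltW p0) //.
  case/andP: p01 => _ p1; apply: ler_wiXn2l; rewrite ?leq_subr ?subr_ge0 //.
  by rewrite lerBlDr lerDl ltW.
apply: (@le_trans _ _ (expR (- (2 * (X + i%:R))) ^+ tt i * expR (- (4 * h)))); last first.
  apply: ler_pM; rewrite ?exprn_ge0 ?expR_ge0 //.
    by apply: lerXn2r vpt; rewrite nnegrE ?expR_ge0 // mulr_ge0 ?divr_ge0 ?ler0n ?(ltW p0).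
  have ph : 0 <= p <= 2^-1 by case/andP: p0h => /ltW -> ->.
  by apply: le_trans (onesubX_ge (vv i) ph); rewrite ler_expR lerN2.
rewrite -expRM_natr -expRD ler_expR.
move: t2; rewrite ler_pdivlMr // => t2.
have -> : - (2 * (X + i%:R)) * (tt i)%:R = - 2 * ((tt i)%:R * (X + i%:R)) by ring.
by move: t2 => ?; lra.
Qed.

(** The union bound costs (m0 + r v) L and the independent failures gain m0 r / T^12. Each of the
    two costs is at most a third of the gain, because r >= T^50, m0 >= T^299 and v <= T^202. *)
Lemma middle_spreading i : i%:R <= h ->
  pr p (fun E => [exists U : {set 'I_n}, (#|U| == m0) && [exists A : {ffun 'I_r -> {set 'I_n}},
     [&& [forall i0, #|A i0| == vv i], [forall i0, [forall j0, (i0 != j0) ==> [disjoint A i0 & A j0]]]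
       & [forall i0, [disjoint U & A i0]]] &&
     [forall x in U, [forall i0, (#|nbr (gr E) x :&: A i0|%SET < tt i)%N]]]])
  <= expR (- (2 * L)).
Proof.
move=> ih.
have beta1 : 0 <= 1 - beta.
  by rewrite subr_ge0 /beta -[leRHS]expR0 ler_expR oppr_le0 mulr_ge0 ?ler0n // ltW.
apply: le_trans (pr_not_spreading n p01 r m0 beta1 (middle_binomial ih)) _.
have [m1 m2] := truncT 300; rewrite -/m0 in m1 m2.
have [r1 r2] := truncT 50.
have rr : T ^+ 50 <= r%:R by rewrite /r -(@natr1 R (Num.truncn _)) ltW.
have r0 : 0 < r%:R :> R := lt_le_trans (TX0 _) rr.
have mm : T ^+ 299 <= m0%:R.
  have : 2 * T ^+ 299 <= T ^+ 300 by apply: TXS; lra.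
  have := TX1 299; move: m2 => ? ? ?; lra.
have m00 : 0 < m0%:R :> R := lt_le_trans (TX0 _) mm.
have vT : (vv i)%:R <= T ^+ 202.
  have [_ v2] := andP (vv_bounds ih); apply: le_trans v2 _; apply: le_trans _ b_le.
  rewrite /yy (ler_pdivrMr _ _ (ltr0n R 200)) ler_pdivrMr ?exprn_gt0 // -mulrA.
  apply: ler_peMr; first exact: ltW.
  by rewrite -[leLHS]mulr1 ler_pM ?ler1n ?ler01 ?exprn_ege1 ?ler1n.
apply: le_trans (ler_wpM2l (ler0n _ _) (ler_wpM2l _ (onesubX_le _ _))) _.
- by rewrite exprn_ge0.
- by rewrite -subr_ge0.
rewrite -natrX -expnM !natrX !natr_expR // -!expRD ler_expR -LE.
pose mr : R := m0%:R * r%:R.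
have mr0 : 0 < mr by rewrite mulr_gt0.
have bmr : beta * (m0 * r)%:R = mr / T ^+ 12.
  by rewrite natrM /beta expRN expRM_natl -TE mulrC.
have T12 : 0 < T ^+ 12 := TX0 12.
have L3 : 3 * L <= T ^+ 2.
  by apply: le_trans (TXS 1 (_ : 3 <= _)); [rewrite expr1 ler_wpM2l|lra].
have q1 : 3 * (m0%:R * L) <= mr / T ^+ 12.
  rewrite ler_pdivlMr // /mr; have -> : 3 * (m0%:R * L) * T ^+ 12 = m0%:R * (3 * L * T ^+ 12) by ring.
  rewrite ler_wpM2l // ?ler0n //; apply: le_trans _ rr; apply: le_trans (TX (_ : 14 <= 50)%N) => //.
  have -> : T ^+ 14 = T ^+ 2 * T ^+ 12 by rewrite -exprD.
  by rewrite ler_wpM2r // ltW.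
have q2 : 3 * ((vv i * r)%:R * L) <= mr / T ^+ 12.
  rewrite ler_pdivlMr // /mr natrM.
  have -> : 3 * ((vv i)%:R * r%:R * L) * T ^+ 12 = (3 * L * (T ^+ 12 * (vv i)%:R)) * r%:R by ring.
  rewrite ler_wpM2r ?ler0n //; apply: le_trans _ mm; apply: le_trans (TX (_ : 216 <= 299)%N) => //.
  have -> : T ^+ 216 = T ^+ 2 * (T ^+ 12 * T ^+ 202) by rewrite -!exprD.
  have a1 : 0 <= 3 * L by rewrite mulr_ge0 ?ler0n ?(ltW L0).
  have a2 : 0 <= T ^+ 12 * (vv i)%:R by rewrite mulr_ge0 ?ler0n ?(ltW T12).
  by apply: ler_pM => //; rewrite ler_wpM2l // ltW.
have m2' : 2 <= m0%:R :> R.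
  apply: le_trans _ mm; apply: le_trans (TX (_ : 1 <= 299)%N) => //.
  by rewrite expr1; move: T6; lra.
have q3 : 2 * L <= m0%:R * L by rewrite ler_wpM2r // ltW.
rewrite bmr; move: q1 q2 q3; set u := mr / _; set u1 := m0%:R * L; set u2 := _ * L.
by move: u u1 u2 => u u1 u2 *; lra.
Qed.

(** The factor 9 >= e^2 comes from the degrees: in case (1) [b = n p], and [bin_tail] at rate 1
    bounds all degrees by 9 n p. *)
Let uu i := Num.truncn (9 * yy i).
Let lev := Num.truncn h.

Let lev_le i : (i <= lev)%N -> i%:R <= h.
Proof.
move=> il; have [h1 _] := truncn_bounds (ltW h0).
by apply: le_trans h1; rewrite ler_nat.
Qed.

Let yy0 i : 0 < yy i. Proof. by rewrite divr_gt0 ?exprn_gt0 ?ltr0n. Qed.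

Let uu_bounds i : (uu i)%:R <= 9 * yy i /\ 9 * yy i < (uu i)%:R + 1.
Proof. by apply: truncn_bounds; rewrite mulr_ge0 ?ler0n // ltW. Qed.

Let trimming i : (i < lev)%N -> (r * lam + vv i <= uu i.+1)%N.
Proof.
move=> il; have ih := lev_le (ltnW il).
have [_ v2] := andP (vv_bounds ih); have y1 := yy_ge ih.
have [_ u2] := uu_bounds i.+1.
have yS : yy i.+1 = yy i / 2 by rewrite /yy exprS; field; rewrite expf_neq0.
rewrite yS in u2.
have [r1 _] := truncT 50; have [l1 _] := truncT 10.
have rT : r%:R <= T ^+ 51.
  have h1 : 2 * T ^+ 50 <= T ^+ 51 by apply: TXS; lra.
  have h2 := TX1 50; rewrite /r -(@natr1 R (Num.truncn _)).
  by apply: le_trans h1; rewrite mulr2n mulrDl mul1r lerD.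
have rlT : (r * lam)%:R <= T ^+ 61 :> R.
  by rewrite natrM (_ : 61 = 51 + 10)%N // exprD ler_pM ?ler0n.
have h3 : 10 * T ^+ 61 <= T ^+ 62 by apply: TXS; lra.
have h4 : T ^+ 62 <= yy i by apply: le_trans y1; apply: TX.
have h5 := TX1 61.
have h6 : (r * lam)%:R + (vv i)%:R < (uu i.+1)%:R + 1 :> R.
  apply: le_lt_trans u2; apply: le_trans (lerD rlT v2) _.
  have : 10 * T ^+ 61 <= yy i := le_trans h3 h4.
  by have := yy0 i; move: (T ^+ 61) (yy i) => a c *; lra.
by rewrite -ltnS -(ltr_nat R) natrD -(@natr1 R (uu i.+1)).
Qed.

Let sum_geometric (x : R) m :
  \sum_(i < m) (x + i%:R) / 2 ^+ i = 2 * x + 2 - 2 * (x + m%:R + 1) / 2 ^+ m.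
Proof.
elim: m => [|m IHm]; first by rewrite big_ord0 expr0; field.
rewrite big_ord_recr /= IHm exprS -(@natr1 R m); field.
by rewrite expf_neq0.
Qed.

Let Kg := (\sum_(i < lev) uu i %/ tt i)%N.

(** Stage i costs at most 9 b (X + i) / (2 h 2^i), and the sum of (X + i) / 2^i is at most 2 X + 2
    <= 4 X. The total 18 b X / h is 7200 Q. *)
Let Kg_le : Kg%:R <= 7200 * Q.
Proof.
apply: (@le_trans _ _ (\sum_(i < lev) 9 * b / (2 * h) * ((X + i%:R) / 2 ^+ i))).
  rewrite natr_sum; apply: ler_sum => i _.
  have ih := lev_le (ltnW (ltn_ord i)).
  have [t1 _] := andP (tt_bounds ih); have [u1 _] := uu_bounds i.
  have [a1 _] := andP (Xi_bounds ih).
  have a0 : 0 < X + i%:R by apply: lt_le_trans a1.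
  have t0 : 0 < (tt i)%:R :> R by rewrite ltr0n tt_gt0.
  apply: (@le_trans _ _ ((uu i)%:R / (tt i)%:R)).
    by rewrite ler_pdivlMr // -natrM ler_nat leq_trunc_div.
  have -> : 9 * b / (2 * h) * ((X + i%:R) / 2 ^+ i) = 9 * yy i / (2 * h / (X + i%:R)).
    by rewrite /yy; field; rewrite !gt_eqF ?exprn_gt0.
  apply: ler_pM; rewrite ?ler0n ?invr_ge0 //.
  by rewrite lef_pV2 ?posrE // divr_gt0 // mulr_gt0.
rewrite -mulr_sumr sum_geometric.
apply: (@le_trans _ _ (9 * b / (2 * h) * (4 * X))).
  rewrite ler_wpM2l ?divr_ge0 ?mulr_ge0 ?ler0n ?(ltW b0) ?(ltW h0) //.
  have : 0 <= 2 * (X + lev%:R + 1) / 2 ^+ lev.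
    by rewrite divr_ge0 ?mulr_ge0 ?addr_ge0 ?ler0n ?exprn_ge0 ?(ltW X0).
  by move: (_ / _) X1 => a *; lra.
have -> : 9 * b / (2 * h) * (4 * X) = 18 * (b * X) / h by field; rewrite gt_eqF.
rewrite bXQ le_eqVlt; apply/orP; left; apply/eqP; field; by rewrite gt_eqF.
Qed.

(** As 2^lev >= h, at most 9 b / h neighbours remain, and b X = 400 h Q with X >= 1. *)
Let uu_lev : (uu lev)%:R <= 3600 * Q.
Proof.
have [u1 _] := uu_bounds lev; apply: le_trans u1 _.
have [_ l2] := truncn_bounds (ltW h0).
have hh : h <= 2 ^+ lev.
  by apply: le_trans (ltW l2) _; rewrite natr1 -natrX ler_nat ltn_expl.
apply: (@le_trans _ _ (9 * (b * X / h))).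
  rewrite ler_wpM2l ?ler0n // /yy ler_pM ?invr_ge0 ?exprn_ge0 ?(ltW b0) ?ler0n //.
    by rewrite ler_peMr // ltW.
  by rewrite lef_pV2 ?posrE ?exprn_gt0 ?ltr0n.
by rewrite bXQ le_eqVlt; apply/orP; left; apply/eqP; field; rewrite gt_eqF.
Qed.

Section Cover.
(** Vertices taken from each block before the greedy cover: none in case (1), about 2 x / p in case
    (2). *)
Variable K1 : nat.
Hypothesis K1p : K1%:R * p <= T.
Hypothesis K1T : K1%:R <= T ^+ 298.

Let K := (10 * (K1 + Kg))%N.

Let Kp : K%:R * p <= T ^+ 2.
Proof.
have Qp : Q * p <= X.
  have -> : Q * p = X / om by rewrite QE; field; rewrite !gt_eqF.
  by rewrite ler_pdivrMr // ler_peMr // ltW.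
have h1 : Kg%:R * p <= 7200 * X.
  by apply: le_trans (ler_wpM2r (ltW p0) Kg_le) _; rewrite -mulrA ler_wpM2l ?ler0n.
have h2 : X <= T by apply: le_trans LT; rewrite hL; move: Xh h0; lra.
rewrite /K natrM natrD mulrDr mulrDl.
have h3 : 10 ^+ 6 * T ^+ 1 <= T ^+ 2 by apply: TXS.
rewrite expr1 in h3; apply: le_trans h3.
have -> : 10 * K1%:R * p = 10 * (K1%:R * p) by ring.
have -> : 10 * Kg%:R * p = 10 * (Kg%:R * p) by ring.
by move: h1 h2 K1p T1; move: (K1%:R * p) (Kg%:R * p) => a1 a2 *; lra.
Qed.

Let blocks_fit : (10 * m0 + 10 * (lev * r) <= M)%N.
Proof.
have [M1 M2] := truncT 392; rewrite -/M in M1 M2.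
have [m1 _] := truncT 300; rewrite -/m0 in m1.
have [r1 _] := truncT 50.
have rT : r%:R <= T ^+ 51.
  have h1 : 2 * T ^+ 50 <= T ^+ 51 by apply: TXS; lra.
  have h2 := TX1 50; rewrite /r -(@natr1 R (Num.truncn _)).
  by apply: le_trans h1; rewrite mulr2n mulrDl mul1r lerD.
have lT : lev%:R <= T.
  have [h1 _] := truncn_bounds (ltW h0); apply: le_trans h1 _.
  by apply: le_trans LT; rewrite hL; move: h0; lra.
have lr : lev%:R * r%:R <= T ^+ 300.
  apply: (@le_trans _ _ (T ^+ 52)); last exact: TX.
  by rewrite exprS ler_pM ?ler0n.
have h1 : 21 * T ^+ 300 <= T ^+ 301 by apply: TXS; lra.
have h2 : T ^+ 301 <= T ^+ 392 by apply: TX.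
have h3 := TX1 300.
rewrite -ltnS -(ltr_nat R) natrD !natrM -(@natr1 R M).
apply: le_lt_trans M2; apply: le_trans h2; apply: le_trans h1.
by move: m1 lr h3; move: (T ^+ 300) (_ * r%:R) => a c *; lra.
Qed.

Let B1 (E : {set potential_edge n}) := [exists H : {set 'I_n}, ((H != finset.set0) && (#|H| <= M)%N) &&
     [forall y in H, (2 * j < #|nbr (gr E) y :&: H|%SET)%N]].
Let B2 (E : {set potential_edge n}) := [exists Z : {set 'I_n}, (#|Z| == K1) && [exists y, (y \notin Z) &&
     ((uu 0).+1 <= #|uncovered (gr E) Z y|)%N]].
Let B3 (E : {set potential_edge n}) := [exists y, true && [exists z, (y != z) &&
     (lam.+1 <= #|nbr (gr E) y :&: nbr (gr E) z|%SET)%N]].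
Let B4 (E : {set potential_edge n}) := [exists S : {set 'I_n}, (#|S| <= K)%N && [exists l : K.+1.-tuple ('I_n * 'I_n),
     true && matching (twins (gr E) S 9) (~: S)%SET l]].
Let B5 (E : {set potential_edge n}) := [exists i : 'I_lev, true &&
   [exists U : {set 'I_n}, (#|U| == m0) && [exists A : {ffun 'I_r -> {set 'I_n}},
     [&& [forall i0, #|A i0| == vv i], [forall i0, [forall j0, (i0 != j0) ==> [disjoint A i0 & A j0]]]
       & [forall i0, [disjoint U & A i0]]] &&
     [forall x in U, [forall i0, (#|nbr (gr E) x :&: A i0|%SET < tt i)%N]]]]].

Let no_bad E : ~~ B1 E -> ~~ B2 E -> ~~ B3 E -> ~~ B4 E -> ~~ B5 E ->
  (functionality (gr E) <= maxn (2 * j) (10 * (K1 + Kg) + 10 * uu lev + 2 * K.+1))%N.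
Proof.
move=> /existsPn b1 /existsPn b2 /existsPn b3 /existsPn b4 /existsPn b5.
apply: (@functionality_le_cover _ (gr E) 9 M (2 * j) K1 Kg lam m0 K.+1 r lev uu tt vv).
- move=> H H0 HM; have := b1 H; rewrite H0 HM /= => /forall_inPn[y yH].
  by rewrite -leqNgt => yj; exists y.
- move=> Z y cZ yZ; have := b2 Z; rewrite cZ eqxx /= => /existsPn/(_ y).
  by rewrite yZ /= -ltnNge ltnS.
- by move=> y z nyz; have := b3 y => /= /existsPn/(_ z); rewrite nyz /= -ltnNge ltnS.
- move=> i il; have ih := lev_le (ltnW il); split; [|exact: trimming|exact: tt_gt0].
  move=> U A cU cA dA dUA; have := b5 (Ordinal il) => /= /existsPn/(_ U).
  rewrite cU eqxx /= => /existsPn/(_ [ffun a => A a]).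
  have -> : [&& [forall i0, #|[ffun a => A a] i0| == vv i],
      [forall i0, [forall j0, (i0 != j0) ==> [disjoint [ffun a => A a] i0 & [ffun a => A a] j0]]]
       & [forall i0, [disjoint U & [ffun a => A a] i0]]].
    apply/and3P; split; apply/fintype.forallP => a; rewrite ?ffunE ?cA //.
    by apply/fintype.forallP => c; apply/implyP => ac; rewrite !ffunE dA.
  move=> /= /forall_inPn[x xU /forallPn[a]]; rewrite ffunE -leqNgt => ta.
  by exists a, x.
- move=> S l cS sl; have := b4 S; rewrite cS /= => /existsPn/(_ (Tuple (introT eqP sl))).
  by [].
- by [].
- rewrite -(ler_nat R); have [_ m2] := truncT 300; rewrite -/m0 in m2.
  have h1 : 2 * T ^+ 299 <= T ^+ 300 by apply: TXS; lra.
  have h2 : T ^+ 298 <= T ^+ 299 by apply: TX.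
  have h3 := TX1 299; apply: le_trans K1T _; apply: le_trans h2 _.
  by move: m2 h1 h3; move: (T ^+ 299) (T ^+ 300) => a c *; lra.
- exact: blocks_fit.
Qed.

Lemma middle_upper_bound :
  pr p (fun E => [exists Z : {set 'I_n}, (#|Z| == K1) && [exists y, (y \notin Z) &&
     ((Num.truncn (9 * b)).+1 <= #|uncovered (gr E) Z y|)%N]]) <= T^-1 ->
  pr p (fun E => 30 * K1%:R + 26 * 10 ^+ 4 * Q < (functionality (gr E))%:R) <= 5 / T.
Proof.
move=> hB2.
have pB1 : pr p B1 <= T^-1 by exact: middle_density.
have pB2 : pr p B2 <= T^-1.
  by move: hB2; rewrite /B2 /uu /yy expr0 divr1.
have pB3 : pr p B3 <= T^-1 by exact: middle_codegree.
have pB4 : pr p B4 <= T^-1 by exact: middle_twins.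
have pB5 : pr p B5 <= T^-1.
  apply: le_trans (pr_exists_le (b := expR (- (2 * L))) p01 (expR_ge0 _) _) _.
    by move=> i _; apply: middle_spreading; apply: lev_le; apply: ltnW.
  have e2 : expR (- (2 * L)) = expR (- L) * expR (- L) by rewrite -expRD; congr expR; ring.
  have cl : #|(fun=> true) : pred 'I_lev|%:R <= T :> R.
    apply: (@le_trans _ _ lev%:R); first by rewrite ler_nat -[X in (_ <= X)%N](card_ord lev) max_card.
    have [h1 _] := truncn_bounds (ltW h0); apply: le_trans h1 _.
    by apply: le_trans LT; rewrite hL; move: h0; lra.
  rewrite e2 mulrA -[leRHS]mul1r; apply: ler_pM; rewrite ?mulr_ge0 ?ler0n ?expR_ge0 //.
  apply: (@le_trans _ _ (T * T^-1)); last by rewrite mulfV // lt0r_neq0.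
  by apply: ler_pM => //; rewrite ?ler0n ?expR_ge0.
apply: (@le_trans _ _ (pr p (fun E => B1 E || (B2 E || (B3 E || (B4 E || B5 E)))))).
  apply: pr_mono => // E; apply: contraLR; rewrite !negb_or -leNgt.
  move=> /and5P[b1 b2 b3 b4 b5]; have := no_bad b1 b2 b3 b4 b5.
  rewrite -(ler_nat R) => /le_trans; apply.
  have [j1 j2] := andP j_bounds.
  have le_max : (maxn (2 * j) (10 * (K1 + Kg) + 10 * uu lev + 2 * K.+1) <=
     2 * j + (10 * (K1 + Kg) + 10 * uu lev + 2 * K.+1))%N.
    by rewrite geq_max leq_addr leq_addl.
  apply: (@le_trans _ _ (2 * j + (10 * (K1 + Kg) + 10 * uu lev + 2 * K.+1))%:R); first by rewrite ler_nat.
  (* The 30 collects 10 for S itself and 20 for the endpoints of the K + 1 pairs, where K = 10 (K1 +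
     Kg). *)
  have -> : (2 * j + (10 * (K1 + Kg) + 10 * uu lev + 2 * K.+1) =
     2 * j + (30 * (K1 + Kg) + 10 * uu lev + 2))%N by exact: cover_size.
  rewrite (natrD _ (2 * j)) natrM (natrD _ _ 2) (natrD _ (30 * _)) (natrM _ 30) (natrM _ 10) (natrD _ K1).
  have Q1 : 1 <= Q by apply: le_trans Q_ge.
  by move: Kg_le uu_lev j2 Q1; move: (Kg%:R : R) ((uu lev)%:R : R) (j%:R : R) (K1%:R : R) => *; lra.
have -> : 5 / T = T^-1 + (T^-1 + (T^-1 + (T^-1 + T^-1))) by field; rewrite gt_eqF.
by do 4!(apply: (le_trans (pr_orb p01 _ _)); apply: lerD => //).
Qed.

End Cover.

End Middle.

(** * Conclusion *)

Section UpperBounds.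
Variable R : realType.
Implicit Types (p w : R) (n : nat).

Lemma upper_bound_sparse (c0 : R) : 0 < c0 -> exists2 C : R, 1 <= C & forall n p w,
  8 * 10 ^+ 3 <= ln (n%:R : R) -> 0 <= p <= 2^-1 -> c0 / n%:R <= p -> 1 <= w ->
  p ^+ 2 * n%:R * w = ln n%:R ->
  pr p (fun E => C * (n%:R * p * (1 + ln w) / ln n%:R)
    < (functionality (@graph_of_edges n E))%:R) <= 5 / expR (ln n%:R / 400).
Proof.
move=> c00; have i0 : 0 < c0^-1 by rewrite invr_gt0.
(* The first summand serves ln w <= h. Otherwise x >= h, hence n p <= 400 A, and the bound 2 j <= 8
   n p + 4 is at most (8 + 4 / c0) n p because n p >= c0. *)
exists (26 * 10 ^+ 4 + 400 * (8 + 4 / c0)) => [|n p w]; first by lra.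
set L := ln n%:R => KL ph pc w1 pw.
pose h := L / 400; have hL : L = 400 * h by rewrite /h; field.
have h20 : 20 <= h by rewrite ler_pdivlMr ?ltr0n //; lra.
have h0 : 0 < h by lra.
have L0 : 0 < L by lra.
have n1 : (1 < n)%N := ln_natr_gt0 L0.
have n0 : (0 < n)%N := ltnW n1.
have nr : 0 < n%:R :> R by rewrite ltr0n.
have np0 : 0 < n%:R * p by apply: lt_le_trans c00 _; rewrite mulrC -ler_pdivrMr.
have pp : 0 < p by rewrite -(pmulr_rgt0 _ nr).
have p01 : 0 <= p <= 1 by case/andP: ph => -> h1; rewrite (le_trans h1) // invf_le1 ?ler1n.
have nL := ln_pow4_le R n0; rewrite -/L in nL.
have w0 : 0 < w by lra.
have lw0 : 0 <= ln w by rewrite ln_ge0.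
have nE : n%:R = expR L by rewrite /L expR_ln_natr.
have T1 : 1 <= expR h by rewrite -[leLHS]expR0 ler_expR ltW.
set x := 1 + ln w; have x0 : 0 < x by rewrite /x; lra.
have A0 : 0 < n%:R * p * x / L by rewrite divr_gt0 ?mulr_gt0.
rewrite -/h; set A := n%:R * p * x / L in A0 *.
have [wh|hw] := leP (ln w) h.
  have wT : w <= expR h by rewrite -[leLHS]lnK ?posrE // ler_expR.
  have np2 : n%:R * p ^+ 2 = L / w by rewrite -pw; field; rewrite gt_eqF.
  have Q_A : x / (w * p) = A.
    rewrite /A; have -> : L = p ^+ 2 * n%:R * w by [].
    by field; rewrite !gt_eqF.
  have bn : L / (w * p) = n%:R * p by rewrite -pw; field; rewrite !gt_eqF.
  have g1 : L <= expR h * (n%:R * p ^+ 2).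
    by rewrite np2 mulrA ler_pdivlMr // mulrC ler_wpM2r // ltW.
  have g2 : n%:R * p ^+ 2 <= expR h * L.
    rewrite np2 ler_pdivrMr // -mulrA [L * w]mulrC mulrA.
    by rewrite ler_peMl ?(ltW L0) // -[leLHS]mulr1 ler_pM.
  have := @middle_upper_bound R n p w L h (expR h) x (L / (w * p)) (x / (w * p))
    erefl erefl erefl erefl erefl erefl h20 _ w1 wh g1 g2 0%N.
  rewrite pp mul0r mulr0 add0r; case/andP: ph => p0 ph2 /(_ ph2) mid.
  apply: le_trans (mid _ _ _); first last.
  - rewrite bn; set q := (Num.truncn _).+1.
    have [q1 q2] := @truncn_bounds R (9 * (n%:R * p)) (mulr_ge0 (ler0n _ _) (ltW np0)).
    have qr : 9 * (n%:R * p) < q%:R by rewrite /q -(@natr1 R (Num.truncn _)).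
    apply: le_trans (pr_uncovered n p01 0 q) _.
    rewrite bin0 mul1r expr0 mulr1 -expRN.
    have e3 := expR1_le3 R.
    have hb : 'C(n, q)%:R * p ^+ q <= expR (- (1 * q%:R)).
      apply: bin_tail => //; rewrite expRN ler_pdivlMr ?expR_gt0 //.
      have -> : expR 1 * n%:R * p * expR 1 = expR 1 * expR 1 * (n%:R * p) by ring.
      apply: le_trans (ltW qr).
      apply: (@le_trans _ _ (3 * 3 * (n%:R * p))).
        by rewrite ler_wpM2r ?(ltW np0) // ler_pM ?expR_ge0.
      by move: np0; clear; lra.
    apply: (le_trans (ler_wpM2l (ltW nr) hb)); rewrite nE -expRD ler_expR mul1r.
    (* Since (n p)^2 = n L / w and w <= e^h, the degrees are far above ln n, so the tail of 9 n p
       pays for the choice of y. *)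
    have npL : L <= n%:R * p.
      rewrite -(@ler_pXn2r _ 2) ?nnegrE ?(ltW L0) ?(ltW np0) //.
      have -> : (n%:R * p) ^+ 2 = n%:R * (L / w) by rewrite -np2; ring.
      rewrite mulrA ler_pdivlMr //.
      have -> : L ^+ 2 * w = (L * w) * L by ring.
      rewrite ler_wpM2r ?(ltW L0) //.
      apply: le_trans (ler_wpM2l (ltW L0) wT) _; rewrite nE.
      have -> : expR L = expR (399%:R * h) * expR h by rewrite -expRD hL; congr expR; ring.
      rewrite ler_wpM2r ?expR_ge0 // expRM_natl.
      apply: (@le_trans _ _ ((1 + h) ^+ 399)); last first.
        by apply: lerXn2r; rewrite ?nnegrE ?expR_ge0 ?expR_ge1Dx //; move: h0; clear; lra.
      have h1 : 1 <= 1 + h by move: h0; clear; lra.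
      apply: (@le_trans _ _ ((1 + h) ^+ 4)); last by rewrite ler_weXn2l.
      have h2 : (21 : R) ^+ 3 <= (1 + h) ^+ 3 by apply: lerXn2r; rewrite ?nnegrE; move: h20; clear; lra.
      rewrite exprSr hL; apply: (@le_trans _ _ ((21 : R) ^+ 3 * (1 + h))).
        by move: h0; clear; lra.
      by rewrite ler_wpM2r //; move: h0; clear; lra.
    by move: qr npL; rewrite hL; move: (q%:R : R) (n%:R * p) h0; clear; move=> *; lra.
  - by rewrite exprn_ge0 // expR_ge0.
  - exact: expR_ge0.
  apply: pr_mono => // E; apply: le_lt_trans; rewrite Q_A ler_wpM2r ?(ltW A0) //.
  by move: i0; clear; lra.
have yn : 0 <= 4 * n%:R * p by rewrite -mulrA mulr_ge0 // ltW.
pose j := (Num.truncn (4 * n%:R * p)).+2.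
have [j1 j2] := truncn_bounds yn.
have jE : j%:R = (Num.truncn (4 * n%:R * p))%:R + 2 :> R by rewrite /j -addn2 natrD.
have j4 : 4 * n%:R * p <= j%:R by rewrite jE; move: j2; clear; lra.
apply: le_trans _ (_ : 2 / n%:R <= _); last first.
  rewrite nE -!expRN; apply: ler_pM; rewrite ?ler0n ?expR_ge0 //.
    by clear; lra.
  by rewrite ler_expR lerN2 hL; move: h0; clear; lra.
apply: le_trans (functionality_sparse ph n0 (isT : (2 <= j)%N) j4).
apply: pr_mono => // E fE; rewrite -(ltr_nat R); apply: le_lt_trans fE.
have npA : n%:R * p <= 400 * A.
  have -> : 400 * A = x / h * (n%:R * p) by rewrite /A hL; field; rewrite gt_eqF.
  rewrite ler_peMl ?(ltW np0) // ler_pdivlMr // mul1r /x.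
  by move: hw; clear; lra.
have c1 : 4 <= 4 / c0 * (n%:R * p).
  rewrite mulrAC ler_pdivlMr // ler_wpM2l // mulrC -ler_pdivrMr //.
rewrite natrM jE.
apply: (@le_trans _ _ ((8 + 4 / c0) * (n%:R * p))).
  by move: j1 c1; rewrite -mulrA; move: (n%:R * p) (4 / c0) => a1 a2; clear; move=> *; lra.
apply: (@le_trans _ _ ((8 + 4 / c0) * (400 * A))).
  by rewrite ler_wpM2l //; move: i0; clear; lra.
rewrite mulrA [_ * 400]mulrC ler_wpM2r ?(ltW A0) // lerDr.
by rewrite mulr_ge0 ?exprn_ge0.
Qed.

Lemma upper_bound_dense n p w :
  8 * 10 ^+ 3 <= ln (n%:R : R) -> 0 <= p <= 2^-1 -> 1 <= w ->
  p ^+ 2 * n%:R = w * ln n%:R ->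
  pr p (fun E => 3 * 10 ^+ 5 * ((1 + ln w) / p)
    < (functionality (@graph_of_edges n E))%:R) <= 5 / expR (ln n%:R / 400).
Proof.
set L := ln n%:R => KL ph w1 pw.
pose h := L / 400; have hL : L = 400 * h by rewrite /h; field.
have h20 : 20 <= h by rewrite ler_pdivlMr ?ltr0n //; lra.
have h0 : 0 < h by lra.
have L0 : 0 < L by lra.
have n1 : (1 < n)%N := ln_natr_gt0 L0.
have n0 : (0 < n)%N := ltnW n1.
have nr : 0 < n%:R :> R by rewrite ltr0n.
have w0 : 0 < w by lra.
have p01 : 0 <= p <= 1 by case/andP: ph => -> h1; rewrite (le_trans h1) // invf_le1 ?ler1n.
have pp : 0 < p.
  case/andP: ph => p0 _; rewrite lt_neqAle p0 andbT; apply/eqP => pe; move: pw.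
  by rewrite -pe expr0n mul0r; have := mulr_gt0 w0 L0; lra.
have lw0 : 0 <= ln w by rewrite ln_ge0.
have nE : n%:R = expR L by rewrite /L expR_ln_natr.
have T1 : 1 <= expR h by rewrite -[leLHS]expR0 ler_expR ltW.
have ph2 : p <= 2^-1 by case/andP: ph.
set x := 1 + ln w; have x1 : 1 <= x by rewrite lerDl.
have x0 : 0 < x by apply: lt_le_trans x1.
have xp2 : 2 <= x / p.
  by rewrite ler_pdivlMr //; move: ph2 x1; clear; lra.
have ex : expR x = expR 1 * w by rewrite expRD lnK // posrE.
rewrite -/h; have [wh|hw] := leP (ln w) h.
  have wT : w <= expR h by rewrite -[leLHS]lnK ?posrE // ler_expR.
  have g1 : L <= expR h * (n%:R * p ^+ 2).
    rewrite [n%:R * _]mulrC pw mulrA ler_peMl ?(ltW L0) //.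
    by rewrite -[leLHS]mulr1 ler_pM.
  have g2 : n%:R * p ^+ 2 <= expR h * L.
    by rewrite [n%:R * _]mulrC pw ler_wpM2r // ltW.
  have y0 : 0 <= 2 * (x / p) by move: xp2; clear; lra.
  (* With 2 x / p vertices, a neighbour of y escapes with probability at most e^(-2 x), roughly
     w^(-2): one factor w reduces the degree w L / p to L / p, the other pays for the choice of
     these vertices. *)
  pose K1 := (Num.truncn (2 * (x / p))).+1.
  have [k1 k2] := truncn_bounds y0.
  have K1E : K1%:R = (Num.truncn (2 * (x / p)))%:R + 1 :> R by rewrite natr1.
  have K1_le : K1%:R <= 2 * (x / p) + 1 by rewrite K1E; move: k1; clear; lra.
  have K1_ge : 2 * (x / p) <= K1%:R by rewrite K1E ltW.
  have pK : 2 * x <= p * K1%:R.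
    have -> : 2 * x = p * (2 * (x / p)) by field; rewrite gt_eqF.
    by rewrite ler_wpM2l // ltW.
  have K1p : K1%:R * p <= expR h.
    apply: (@le_trans _ _ ((2 * (x / p) + 1) * p)); first by rewrite ler_wpM2r // ltW.
    have -> : (2 * (x / p) + 1) * p = 2 * x + p by field; rewrite gt_eqF.
    have -> : expR h = expR (h / 2) ^+ 2 by rewrite -expRM_natl mulrC divfK // pnatr_eq0.
    have : (1 + h / 2) ^+ 2 <= expR (h / 2) ^+ 2.
      apply: lerXn2r; rewrite ?nnegrE ?expR_ge0 ?expR_ge1Dx //.
      by move: h0; clear; lra.
    apply: le_trans.
    have : 20 * h <= h * h by rewrite ler_wpM2r // ltW.
    by rewrite /x; move: wh ph2 h20; clear; lra.
  have pT200 : 1 <= p * expR h ^+ 200.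
    rewrite -(@ler_pXn2r _ 2) ?nnegrE ?mulr_ge0 ?exprn_ge0 ?expR_ge0 ?(ltW pp) //.
    rewrite expr1n exprMn -exprM -expRM_natl.
    have -> : (200 * 2)%N%:R * h = L by rewrite hL.
    rewrite -nE pw -[leLHS]mulr1 ler_pM //.
    by move: h20; rewrite hL; clear; lra.
  have K1T : K1%:R <= expR h ^+ 298.
    apply: (@le_trans _ _ (expR h ^+ 201)); last by rewrite ler_weXn2l.
    apply: (@le_trans _ _ (K1%:R * (p * expR h ^+ 200))).
      by rewrite ler_peMr ?ler0n.
    by rewrite mulrA exprS ler_wpM2r // exprn_ge0 // expR_ge0.
  have om0 : ln 1 <= h by rewrite ln1 ltW.
  have := @middle_upper_bound R n p 1 L h (expR h) (1 + ln 1) (L / (1 * p)) ((1 + ln 1) / (1 * p))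
    erefl erefl erefl erefl erefl erefl h20 _ (lexx 1) om0 g1 g2 K1 K1p K1T.
  rewrite pp ph2 ln1 addr0 !mul1r => /(_ isT) mid.
  apply: le_trans (mid _).
    apply: pr_mono => // E; apply: le_lt_trans.
    have : p^-1 <= x / p by rewrite ler_peMl // invr_ge0 ltW.
    move: K1_le xp2; move: (K1%:R : R) (x / p) (p^-1) => a1 a2 a3; clear; move=> *; lra.
  set q := (Num.truncn _).+1.
  have b0 : 0 < L / p by rewrite divr_gt0.
  have [q1 q2] := @truncn_bounds R (9 * (L / p)) (mulr_ge0 (ler0n _ _) (ltW b0)).
  have qr : 9 * (L / p) <= q%:R by rewrite /q -(@natr1 R (Num.truncn _)) ltW.
  apply: le_trans (pr_uncovered n p01 K1 q) _; rewrite -expRN.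
  have p1 : 0 <= 1 - p by rewrite subr_ge0; case/andP: p01.
  have a0 : 0 <= p * (1 - p) ^+ K1 by rewrite mulr_ge0 ?exprn_ge0 // ltW.
  (* The mean number of uncovered neighbours is at most n p e^(-2 x) = (w L / p) e^(-2 x), which e^x
     = e w puts so far below q that each vertex gains x. The total, at least 9 x L / p, exceeds the
     cost K1 L of choosing Z, about 2 x L / p. *)
  have hb : 'C(n, q)%:R * (p * (1 - p) ^+ K1) ^+ q <= expR (- (x * q%:R)).
    apply: bin_tail => //.
    apply: (@le_trans _ _ (expR 1 * n%:R * (p * expR (- (2 * x))))).
      rewrite ler_wpM2l ?mulr_ge0 ?expR_ge0 ?ler0n // ler_wpM2l ?(ltW pp) //.
      apply: le_trans (onesubX_le _ _) _; first by case/andP: p01.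
      by rewrite ler_expR lerN2.
    have npE : n%:R * p = w * (L / p).
      by apply: (mulIf (lt0r_neq0 pp)); rewrite -!mulrA -expr2 mulrC pw mulVf ?gt_eqF // mulr1.
    have -> : expR 1 * n%:R * (p * expR (- (2 * x))) = expR 1 * (n%:R * p) * expR (- (2 * x)) by ring.
    rewrite npE mulrA -ex.
    have -> : expR x * (L / p) * expR (- (2 * x)) = L / p * expR (- x).
      rewrite (_ : - (2 * x) = - x + - x); last by ring.
      rewrite (expRD (- x) (- x)); transitivity ((expR x * expR (- x)) * (L / p * expR (- x))); first by ring.
      by rewrite expRxMexpNx_1 mul1r.
    rewrite ler_wpM2r ?expR_ge0 //; apply: le_trans qr.
    by move: b0; clear; lra.
  have hK : 'C(n, K1)%:R <= expR (K1%:R * L) :> R.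
    by rewrite -natr_expR // -natrX ler_nat leq_bin_exp.
  apply: (@le_trans _ _ (expR (K1%:R * L) * (n%:R * expR (- (x * q%:R))))).
    apply: ler_pM => //; rewrite ?ler0n ?mulr_ge0 ?exprn_ge0 ?ler0n //.
    by rewrite ler_wpM2l ?ler0n.
  rewrite nE -!expRD ler_expR.
  have e1 : x * (9 * (L / p)) <= x * q%:R by rewrite ler_wpM2l // ltW.
  have e2 : K1%:R * L <= (2 * (x / p) + 1) * L by rewrite ler_wpM2r // ltW.
  have e3 : 2 * L <= x / p * L by rewrite ler_wpM2r // ltW.
  have e4 : x * (9 * (L / p)) = 9 * (x / p * L) by field; rewrite gt_eqF.
  have e5 : (2 * (x / p) + 1) * L = 2 * (x / p * L) + L by ring.
  rewrite e5 in e2; rewrite e4 in e1; have hle : h <= L by rewrite hL; move: h0; clear; lra.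
  move: e1 e2 e3 h0 hle; move: (x / p * L) (x * q%:R) (K1%:R * L) => a1 a2 a3; clear.
  by move=> *; lra.
have y0 : 0 <= 5 * L / p by rewrite divr_ge0 ?mulr_ge0 ?(ltW L0) ?(ltW pp).
pose K := (Num.truncn (5 * L / p)).+1.
have [k1 k2] := truncn_bounds y0.
have KE : K%:R = (Num.truncn (5 * L / p))%:R + 1 :> R by rewrite natr1.
have pK : 5 * L <= p * K%:R.
  by rewrite [leRHS]mulrC -ler_pdivrMr // KE ltW.
apply: le_trans _ (_ : expR (- L) <= _); last first.
  rewrite -expRN -[leLHS]mul1r; apply: ler_pM; rewrite ?ler01 ?expR_ge0 ?ler1n //.
  by rewrite ler_expR lerN2 hL; move: h0; clear; lra.
apply: le_trans (functionality_dense ph n1 (isT : (0 < K)%N) pK).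
apply: pr_mono => // E fE; rewrite -(ltr_nat R); apply: le_lt_trans fE.
rewrite natrM KE.
have Lx : L / p <= 400 * (x / p).
  rewrite mulrA; apply: ler_wpM2r; first by rewrite invr_ge0 ltW.
  rewrite hL; apply: ler_wpM2l; first exact: ler0n.
  by rewrite /x; move: hw; clear; lra.
have k3 : (Num.truncn (5 * L / p))%:R <= 5 * (L / p) by rewrite mulrA.
by move: k3 Lx xp2; move: ((Num.truncn (5 * L / p))%:R : R) (L / p) (x / p) => a1 a2 a3; clear; move=> *; lra.
Qed.

End UpperBounds.

(** * From tail bounds to limits of probabilities *)

Section WithHighProbability.
Variable R : realType.

Lemma near_ln_ge (K : R) : \forall n \near \oo, K <= ln n%:R.
Proof.
near=> n; have h : expR K <= n%:R by near: n; exact: nbhs_infty_ger.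
rewrite -ler_expR lnK // posrE; exact: lt_le_trans (expR_gt0 K) h.
Unshelve. all: by end_near. Qed.

(** The rate n^(-1/400) = 1 / T is the slowest among the failure bounds, so this one form serves
    both cases. *)
Lemma whp_of_tail (p : nat -> R) (A : forall n, pred (sgraph 'I_n)) (c : R) :
  (forall n, 0 <= p n <= 1) -> 0 < c ->
  (\forall n \near \oo, pr (p n) (fun E => ~~ A n (graph_of_edges E))
     <= c / expR (ln n%:R / 400)) ->
  gnp_prob n (p n) (A n) @[n --> \oo] --> (1 : R).
Proof.
move=> p01 c0 tail; apply/cvgrPdist_le => eps eps0; near=> n.
rewrite gnp_probE -prC ger0_norm; last exact: pr_ge0.
apply: (@le_trans _ _ (c / expR (ln n%:R / 400))); first by near: n.
rewrite ler_pdivrMr ?expR_gt0 // mulrC -ler_pdivrMr //.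
rewrite -[leLHS]lnK ?posrE ?divr_gt0 // ler_expR ler_pdivlMr ?ltr0n //.
by near: n; exact: near_ln_ge.
Unshelve. all: by end_near. Qed.

End WithHighProbability.

Theorem theorem1p1 (R : realType) (p w : nat -> R)
    (p_bounds : forall n, 0 <= p n <= 1 / 2)
    (p_Omega : exists2 c0 : R, 0 < c0 & \forall n \near \oo, c0 / n%:R <= p n)
    (w_ge1 : forall n, 1 <= w n) :
  ((\forall n \near \oo, p n = Num.sqrt (ln n%:R / (n%:R * w n))) ->
    exists c C : R, [/\ 0 < c, c <= C &
      gnp_prob n (p n) (fun G =>
        c * (n%:R * p n * ln (expR 1 * w n) / ln n%:R)
          <= (functionality G)%:R
          <= C * (n%:R * p n * ln (expR 1 * w n) / ln n%:R))
      @[n --> \oo] --> (1 : R)])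
  /\
  ((\forall n \near \oo, p n = Num.sqrt (w n * ln n%:R / n%:R)) ->
    exists c C : R, [/\ 0 < c, c <= C &
      gnp_prob n (p n) (fun G =>
        c * (ln (expR 1 * w n) / p n)
          <= (functionality G)%:R
          <= C * (ln (expR 1 * w n) / p n))
      @[n --> \oo] --> (1 : R)]).
Proof.
have ph n : 0 <= p n <= 2^-1 by have := p_bounds n; rewrite div1r.
have p01 n : 0 <= p n <= 1.
  by case/andP: (ph n) => -> h1; rewrite (le_trans h1) // invf_le1 ?ler1n.
have w0 n : 0 < w n := lt_le_trans ltr01 (w_ge1 n).
have lnew n : ln (expR 1 * w n) = 1 + ln (w n).
  by rewrite lnM ?posrE ?expR_gt0 // expRK.
have weaken (L : R) : 0 <= L -> expR (- L) <= (expR (L / 400))^-1.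
  by move=> L0; rewrite -expRN ler_expR lerN2 ler_pdivrMr ?ltr0n //; lra.
split=> pE.
  have [c0 c00 pc] := p_Omega.
  have [K lower] := lower_bound_sparse c00.
  have [C C1 upper] := upper_bound_sparse c00.
  exists (10^-4), C; split; first by rewrite invr_gt0 exprn_gt0.
    by apply: le_trans C1; rewrite invf_le1 ?exprn_gt0 // exprn_ege1 // ler1n.
  (* The constant is 3 from the lower bound plus 5 from the upper bound. *)
  apply: (@whp_of_tail _ _ _ 8) => //; near=> n.
  have nK : K <= ln n%:R by near: n; exact: near_ln_ge.
  have nU : 8 * 10 ^+ 3 <= ln (n%:R : R) by near: n; exact: near_ln_ge.
  have pcn : c0 / n%:R <= p n by near: n.
  have pn : p n = Num.sqrt (ln n%:R / (n%:R * w n)) by near: n.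
  have L0 : 0 < ln (n%:R : R) by lra.
  have nr : 0 < n%:R :> R by rewrite ltr0n (ltnW (ln_natr_gt0 L0)).
  have pw : p n ^+ 2 * n%:R * w n = ln n%:R.
    rewrite pn sqr_sqrtr ?divr_ge0 ?mulr_ge0 ?(ltW L0) ?(ltW nr) ?(ltW (w0 n)) //.
    by field; rewrite !gt_eqF.
  rewrite lnew; have lo := lower n (p n) (w n) nK (ph n) pcn (w_ge1 n) pw.
  have up := upper n (p n) (w n) nU (ph n) pcn (w_ge1 n) pw.
  apply: (@le_trans _ _ (pr (p n) (fun E : {set potential_edge n} =>
    ((functionality (graph_of_edges E))%:R < 10^-4 * (n%:R * p n * (1 + ln (w n)) / ln n%:R)) ||
    (C * (n%:R * p n * (1 + ln (w n)) / ln n%:R) < (functionality (graph_of_edges E))%:R)))).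
    by apply: pr_mono => // E; rewrite negb_and -!ltNge.
  apply: le_trans (pr_orb (p01 n) _ _) _; apply: le_trans (lerD lo up) _.
  have := weaken _ (ltW L0); move: (expR (- _)) (expR _)^-1 => u v; clear; lra.
exists (10^-2), (3 * 10 ^+ 5); split; first by rewrite invr_gt0 exprn_gt0.
  by lra.
(* Here 2 from the lower bound plus 5 from the upper bound. *)
apply: (@whp_of_tail _ _ _ 7) => //; near=> n.
have nU : 8 * 10 ^+ 3 <= ln (n%:R : R) by near: n; exact: near_ln_ge.
have pn : p n = Num.sqrt (w n * ln n%:R / n%:R) by near: n.
have nL : 10 ^+ 2 <= ln (n%:R : R) by move: nU; clear; lra.
have L0 : 0 < ln (n%:R : R) by move: nL; clear; lra.
have nr : 0 < n%:R :> R by rewrite ltr0n (ltnW (ln_natr_gt0 L0)).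
have pw : p n ^+ 2 * n%:R = w n * ln n%:R.
  rewrite pn sqr_sqrtr ?divr_ge0 ?mulr_ge0 ?(ltW L0) ?(ltW nr) ?(ltW (w0 n)) //.
  by field; rewrite gt_eqF.
rewrite lnew; have lo := lower_bound_dense nL (ph n) (w_ge1 n) pw.
have up := upper_bound_dense nU (ph n) (w_ge1 n) pw.
apply: (@le_trans _ _ (pr (p n) (fun E : {set potential_edge n} =>
  ((functionality (graph_of_edges E))%:R < 10^-2 * ((1 + ln (w n)) / p n)) ||
  (3 * 10 ^+ 5 * ((1 + ln (w n)) / p n) < (functionality (graph_of_edges E))%:R)))).
  by apply: pr_mono => // E; rewrite negb_and -!ltNge.
apply: le_trans (pr_orb (p01 n) _ _) _; apply: le_trans (lerD lo up) _.
have := weaken _ (ltW L0); move: (expR (- _)) (expR _)^-1 => u v; clear; lra.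
Unshelve. all: by end_near. Qed.
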